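(* Every Spherical Diagram has at least two clockwise swirls, at least two counterclockwise swirls, and at least six arcs. Every Spherical Occlusion Diagram has at least eight arcs. Moreover, these bounds are matched by $6$-oriented examples with alignment $(3,3,3,3,3,3)$: there exists a $6$-oriented SD with alignment $(3,3,3,3,3,3)$ having exactly two clockwise swirls, two counterclockwise swirls and six arcs, and there exists a $6$-oriented SOD with alignment $(3,3,3,3,3,3)$ having exactly two clockwise swirls, two counterclockwise swirls and eight arcs.
   Context: A geodesic arc on the unit sphere in $\mathbb R^3$ is the unique shortest curve joining two non-antipodal points. An arc $a$ blocks an arc $b$ (equivalently, $b$ hits $a$) if an endpoint of $b$ lies in the relative interior of $a$. A Spherical Diagram (SD) is a finite non-empty collection $\mathcal D$ of pairwise interior-disjoint geodesic arcs on the unit sphere such that each arc of $\mathcal D$ is blocked by arcs of $\mathcal D$ at each of its endpoints. A Spherical Occlusion Diagram (SOD) is an SD such that all arcs of $\mathcal D$ that hit the same arc of $\mathcal D$ reach it from the same side. A swirl of an SD is a cycle of arcs, each of which hits the next (and the last hits the first), going either all clockwise (clockwise swirl) or all counterclockwise (counterclockwise swirl). An SD $\mathcal D$ is $k$-oriented if there exist a set $P$ of $k$ points on the unit sphere (poles), no two antipodal, and a function $f\colon\mathcal D\to P$ such that each arc $a\in\mathcal D$ lies on a great circle through $f(a)$ but contains neither $f(a)$ nor its antipode $-f(a)$. A $k$-oriented SD with poles $p_1,\dots,p_k$ has alignment $(d_1,\dots,d_k)$ (listed in nondecreasing order) if, for each $i$, there are exactly $d_i$ distinct great circles containing $p_i$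 and at least one other pole. *)

(* Defs.v *)
From Stdlib Require Import Reals List Permutation Sorting.Sorted.
Import ListNotations.
Open Scope R_scope.

Record vec3 := V3 { vx : R; vy : R; vz : R }.

Definition vadd (p q : vec3) : vec3 := V3 (vx p + vx q) (vy p + vy q) (vz p + vz q).
Definition vscale (a : R) (p : vec3) : vec3 := V3 (a * vx p) (a * vy p) (a * vz p).
Definition vopp (p : vec3) : vec3 := vscale (-1) p.
Definition vzero : vec3 := V3 0 0 0.
Definition dot (p q : vec3) : R := vx p * vx q + vy p * vy q + vz p * vz q.
Definition cross (p q : vec3) : vec3 :=
  V3 (vy p * vz q - vz p * vy q) (vz p * vx q - vx p * vz q) (vx p * vy q - vy p * vx q).
Definition det3 (p q r : vec3) : R := dot p (cross q r).

Definition on_sphere (p : vec3) : Prop := dot p p = 1.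

(** * Geodesic arcs
    An arc is given by its two endpoints, which must be distinct,
    non-antipodal points of the unit sphere. *)
Record arc := Arc { a_u : vec3; a_v : vec3 }.

Definition arc_valid (A : arc) : Prop :=
  on_sphere (a_u A) /\ on_sphere (a_v A) /\
  a_u A <> a_v A /\ a_u A <> vopp (a_v A).

(** Points of the (closed) shortest geodesic arc: unit vectors in the
    closed cone spanned by the endpoints. *)
Definition in_arc (p : vec3) (A : arc) : Prop :=
  on_sphere p /\ exists a b, 0 <= a /\ 0 <= b /\
    p = vadd (vscale a (a_u A)) (vscale b (a_v A)).

Definition in_relint (p : vec3) (A : arc) : Prop :=
  on_sphere p /\ exists a b, 0 < a /\ 0 < b /\
    p = vadd (vscale a (a_u A)) (vscale b (a_v A)).

Definition ends (A : arc) (e w : vec3) : Prop :=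
  (e = a_u A /\ w = a_v A) \/ (e = a_v A /\ w = a_u A).

Definition blocks (A B : arc) : Prop :=
  exists e w, ends B e w /\ in_relint e A.

Definition great_circle (n : vec3) (x : vec3) : Prop :=
  on_sphere x /\ dot n x = 0.

(** * Diagrams: a diagram is a finite list of arcs; pairwise interior
    disjointness (for distinct positions) forbids repetitions, so the
    number of arcs is the length of the list. *)
Definition arcD (D : list arc) (i : nat) : arc := nth i D (Arc vzero vzero).

Definition interior_disjoint (A B : arc) : Prop :=
  ~ exists p, in_relint p A /\ in_relint p B.

Definition is_SD (D : list arc) : Prop :=
  D <> [] /\
  (forall A, In A D -> arc_valid A) /\
  (forall i j, (i < length D)%nat -> (j < length D)%nat -> i <> j ->
     interior_disjoint (arcD D i) (arcD D j)) /\
  (forall B e w, In B D -> ends B e w -> exists A, In A D /\ in_relint e A).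

(** All arcs hitting the same arc reach it from the same side:
    the side of the hitting arc B w.r.t. the great circle of A is the sign
    of its other endpoint against the normal a_u A x a_v A. *)
Definition is_SOD (D : list arc) : Prop :=
  is_SD D /\
  forall A B1 B2 e1 w1 e2 w2, In A D -> In B1 D -> In B2 D ->
    ends B1 e1 w1 -> ends B2 e2 w2 -> in_relint e1 A -> in_relint e2 A ->
    dot (cross (a_u A) (a_v A)) w1 * dot (cross (a_u A) (a_v A)) w2 > 0.

(** * Swirls
    Turning at a hit: arc A hits B at its endpoint e (w the other endpoint
    of A), and the cycle continues along B towards its endpoint e' which
    hits C.  Seen from outside the sphere the turn from A to B is
    counterclockwise iff det(e, w, e') < 0 and clockwise iff det(e,w,e') > 0. *)
Definition turn (A B C : arc) (cw : bool) : Prop :=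
  exists e w e' w', ends A e w /\ in_relint e B /\ ends B e' w' /\ in_relint e' C /\
    (if cw then det3 e w e' > 0 else det3 e w e' < 0).

Definition is_swirl (D : list arc) (cw : bool) (s : list nat) : Prop :=
  s <> [] /\ NoDup s /\ (forall i, In i s -> (i < length D)%nat) /\
  forall k, (k < length s)%nat ->
    turn (arcD D (nth k s 0%nat))
         (arcD D (nth ((k + 1) mod length s) s 0%nat))
         (arcD D (nth ((k + 2) mod length s) s 0%nat)) cw.

Definition same_cycle (s t : list nat) : Prop :=
  exists l1 l2, s = l1 ++ l2 /\ t = l2 ++ l1.

Definition at_least_two_swirls (D : list arc) (cw : bool) : Prop :=
  exists s t, is_swirl D cw s /\ is_swirl D cw t /\ ~ same_cycle s t.

Definition exactly_two_swirls (D : list arc) (cw : bool) : Prop :=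
  exists s t, is_swirl D cw s /\ is_swirl D cw t /\ ~ same_cycle s t /\
    forall u, is_swirl D cw u -> same_cycle u s \/ same_cycle u t.

Definition poles_ok (P : list vec3) : Prop :=
  (forall p, In p P -> on_sphere p) /\
  forall i j, (i < length P)%nat -> (j < length P)%nat -> i <> j ->
    nth i P vzero <> nth j P vzero /\ nth i P vzero <> vopp (nth j P vzero).

Definition arc_oriented_to (A : arc) (p : vec3) : Prop :=
  (exists n, n <> vzero /\ great_circle n p /\
     forall x, in_arc x A -> great_circle n x) /\
  ~ in_arc p A /\ ~ in_arc (vopp p) A.

Definition gc_through_pole_and_other (P : list vec3) (i : nat) (n : vec3) : Prop :=
  n <> vzero /\ great_circle n (nth i P vzero) /\
  exists j, (j < length P)%nat /\ j <> i /\ great_circle n (nth j P vzero).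

Definition same_gc (n m : vec3) : Prop :=
  forall x, great_circle n x <-> great_circle m x.

Definition circles_count (P : list vec3) (i d : nat) : Prop :=
  exists ns : list vec3, length ns = d /\
    (forall n, In n ns -> gc_through_pole_and_other P i n) /\
    (forall a b, (a < d)%nat -> (b < d)%nat -> a <> b ->
       ~ same_gc (nth a ns vzero) (nth b ns vzero)) /\
    (forall n, gc_through_pole_and_other P i n -> exists m, In m ns /\ same_gc n m).

Definition has_alignment (P : list vec3) (ds : list nat) : Prop :=
  length ds = length P /\ Sorted le ds /\
  exists ds', Permutation ds ds' /\
    forall i, (i < length P)%nat -> circles_count P i (nth i ds' 0%nat).

Definition oriented_with_alignment (D : list arc) (k : nat) (ds : list nat) : Prop :=
  exists (P : list vec3) (f : nat -> nat),
    length P = k /\ poles_ok P /\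
    (forall i, (i < length D)%nat ->
       (f i < k)%nat /\ arc_oriented_to (arcD D i) (nth (f i) P vzero)) /\
    has_alignment P ds.

(* Main.v *)
(** An endpoint of an arc together with the arc is a lane; turning right at every hit is a self-map of
    the finite set of lanes, so every right-turning walk ends in a cycle.

    A cycle of right turns is convex: otherwise, at the smallest index distance where convexity fails,
    it either runs outwards past the tail of one of its lanes, and then the walk followed backwards is
    trapped in a convex polygon bounded by arcs, or it spirals inwards, and then the forward walk is
    trapped.  Hence such a cycle is a clockwise swirl, and all its lanes keep a common point p (in its
    eye) on their right.

    For a second swirl, call a lane eastbound if it has p on its left.  Following eastbound lanes from
    the first swirl leads to a closed curve around p, a graph of latitude over longitude, that stays
    outside the eye.  At each of its vertices the curve either turns right or leaves the tail of the
    next arc below it, so a right-turning walk starting on the curve remains weakly below it, whereas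
    the lanes of the first swirl are westbound with only the eye above them.  Counterclockwise swirls
    are obtained by reflection.

    No two arcs hit each other, the two ends of an arc hit different arcs, and a 3-cycle of hits turns
    in one direction only.  The first two facts force at least five arcs and, with five arcs, a regular
    tournament, which contradicts the third fact.  In a one-sided diagram swirls of equal direction are
    disjoint, and a 3-swirl shares at most one arc with a 3- or 4-swirl of the other direction; with at
    most seven arcs there is no room for two swirls of each direction. *)

Require Import Defs.
From Stdlib Require Import Reals List Lia Lra Psatz ZArith Classical ClassicalEpsilon Arith.
From Stdlib Require Import Permutation Sorting.Sorted.
Import ListNotations.
Open Scope R_scope.

(** * Cones and crossings *)

(** Points are treated as nonzero vectors up to positive factors: an arc becomes the open cone over
    its endpoints, and lying on one side of a great circle becomes the sign of a linear functional.
    Unit length returns only when a common vector of two cones is normalized to a point of the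
    sphere.

    The obstacle throughout is degenerate position. Only relative interiors of arcs are disjoint, so
    several arcs may end at the same point, and an end may coincide with a vertex of the curve it is
    compared with. Hence weak and strict inequalities are kept apart in the convexity argument, and
    the position below the closed curve is recorded for a germ, a point together with a direction,
    and not for a point. General position is imposed on p alone, which is moved off the great
    circles of all arcs.

    The argument around p stays local: a lane is compared with one side of the curve at a time,
    within the longitudes of that side, and the final contradiction is an arc met inside the eye
    when going straight up from the walk.

    The extremal examples have integer coordinates up to scaling, so that every property of them is
    decided by computation on integers. *)

Definition lc (a : R) (x : vec3) (b : R) (y : vec3) : vec3 := vadd (vscale a x) (vscale b y).

(** Open cone over the arc from [t] to [e]: its relative interior up to positive scaling. *)
Definition cint (t e x : vec3) : Prop := exists a b, 0 < a /\ 0 < b /\ x = lc a t b e.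

Ltac vsimp :=
  unfold det3, lc, vopp, vadd, vscale, cross, dot, vzero in *; simpl in *.
(* Vector identities are proved after generalizing all atoms, so that [ring] sees only coordinates. *)
Ltac vabs :=
  repeat match goal with |- context [?v] =>
    lazymatch v with
    | vadd _ _ => fail | vscale _ _ => fail | vopp _ => fail | cross _ _ => fail
    | lc _ _ _ _ => fail | V3 _ _ _ => fail | vzero => fail
    | _ => lazymatch type of v with vec3 => tryif is_var v then fail else (generalize v; intro) end
    end
  end;
  clear; repeat match goal with x := _ |- _ => clearbody x end;
  repeat match goal with v : vec3 |- _ => destruct v end; vsimp.
Ltac vring := vabs; ring.
Ltac veq := vabs; f_equal; ring.

Lemma dot_lc n a x b y : dot n (lc a x b y) = a * dot n x + b * dot n y.
Proof. vring. Qed.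

Lemma dot_vscale n a x : dot n (vscale a x) = a * dot n x.
Proof. vring. Qed.

Lemma dot_cross_l x y : dot (cross x y) x = 0.
Proof. vring. Qed.

Lemma dot_cross_r x y : dot (cross x y) y = 0.
Proof. vring. Qed.

Lemma dot_self_pos x : x <> vzero -> 0 < dot x x.
Proof.
  destruct x as [a b c]; vsimp; intros H.
  destruct (Req_dec a 0), (Req_dec b 0), (Req_dec c 0); subst; try nra.
  contradiction.
Qed.

(* The coefficients are read off the identity
   |c|^2 x = (c.(x*e)) t + (c.(t*x)) e + (x.c) c  with  c = t*e. *)
Lemma plane_decomposition t e x :
  cross e t <> vzero -> dot (cross e t) x = 0 -> exists l m, x = lc l t m e.
Proof.
  intros Hc Hx. apply dot_self_pos in Hc.
  exists (dot (cross t e) (cross x e) / dot (cross e t) (cross e t)),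
         (dot (cross t e) (cross t x) / dot (cross e t) (cross e t)).
  assert (Hid : vscale (dot (cross e t) (cross e t)) x =
    vadd (lc (dot (cross t e) (cross x e)) t (dot (cross t e) (cross t x)) e)
         (vscale (dot (cross e t) x) (cross e t))) by veq.
  rewrite Hx in Hid.
  set (d := dot (cross e t) (cross e t)) in *.
  set (l := dot (cross t e) (cross x e)) in *.
  set (m := dot (cross t e) (cross t x)) in *.
  assert (H : x = vscale (/ d) (vscale d x)).
  { assert (d <> 0) by lra. destruct x; unfold vscale; simpl. f_equal; field; auto. }
  rewrite H, Hid. unfold Rdiv.
  clearbody d l m. clear - x. veq.
Qed.

Lemma cint_scale t e x c : 0 < c -> cint t e x -> cint t e (vscale c x).
Proof.
  intros Hc (a & b & Ha & Hb & ->). exists (c * a), (c * b).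
  split; [nra|]. split; [nra|]. veq.
Qed.

Lemma cint_toward_end t e x a b : cint t e x -> 0 < a -> 0 <= b -> cint t e (lc a x b e).
Proof.
  intros (u & v & Hu & Hv & ->) Ha Hb. exists (a * u), (a * v + b).
  split; [nra|]. split; [nra|]. veq.
Qed.

Lemma cint_unscale t e x c : 0 < c -> cint t e (vscale c x) -> cint t e x.
Proof.
  intros Hc H. apply (cint_scale _ _ _ (/ c)) in H; [|apply Rinv_0_lt_compat; auto].
  replace (vscale (/ c) (vscale c x)) with x in H; auto.
  destruct x; unfold vscale; simpl; f_equal; field; lra.
Qed.

Lemma cint_sym t e x : cint t e x -> cint e t x.
Proof. intros (a & b & Ha & Hb & ->). exists b, a. repeat split; auto. veq. Qed.

Lemma dot_cint_zero n t e x : dot n t = 0 -> dot n e = 0 -> cint t e x -> dot n x = 0.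
Proof. intros H1 H2 (a & b & _ & _ & ->). rewrite dot_lc, H1, H2. ring. Qed.

(** Each functional is linear along the segment from [x] to [e]. If the functional added in the
    induction is already negative at the crossing found so far, its own zero between [x] and that
    crossing comes earlier and replaces it. *)
Lemma first_crossing (f : Z -> vec3) (lo hi : Z) (x e : vec3) :
  (forall c, (lo <= c <= hi)%Z -> dot (f c) x > 0) ->
  (forall c, (lo <= c <= hi)%Z -> dot (f c) e > 0) \/
  exists a b, 0 <= a /\ 0 < b /\
    (forall c, (lo <= c <= hi)%Z -> dot (f c) (lc a x b e) >= 0) /\
    exists c, (lo <= c <= hi)%Z /\ dot (f c) (lc a x b e) = 0.
Proof.
  remember (Z.to_nat (hi - lo + 1)) as N eqn:EN. revert hi EN. induction N as [|N IH]; intros hi EN Hx.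
  - left. lia.
  - assert (Hhi : dot (f hi) x > 0) by (apply Hx; lia).
    destruct (IH (hi - 1)%Z) as [H1 | (a & b & Ha & Hb & Hall & c & Hc & Hc0)]; [lia|intros; apply Hx; lia| |].
    + destruct (Rlt_le_dec 0 (dot (f hi) e)) as [H|H].
      * left. intros c Hc. destruct (Z.eq_dec c hi) as [->|]; [auto|apply H1; lia].
      * right. exists (- dot (f hi) e), (dot (f hi) x). split; [lra|]. split; [lra|]. split.
        -- intros c Hc. rewrite dot_lc. destruct (Z.eq_dec c hi) as [->|]; [nra|].
           pose proof (H1 c ltac:(lia)). pose proof (Hx c Hc). nra.
        -- exists hi. split; [lia|]. rewrite dot_lc. ring.
    + right. destruct (Rle_lt_dec 0 (dot (f hi) (lc a x b e))) as [H|H].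
      * exists a, b. repeat split; auto.
        -- intros d Hd. destruct (Z.eq_dec d hi) as [->|]; [lra|apply Hall; lia].
        -- exists c. split; [lia|auto].
      * set (y := lc a x b e) in *. set (q := dot (f hi) y) in *. set (p := dot (f hi) x) in *.
        exists (- q + p * a), (p * b).
        replace (lc (- q + p * a) x (p * b) e) with (lc (- q) x p y)
          by (generalize p q; subst y; clear; intros; veq).
        split; [nra|]. split; [nra|]. split.
        -- intros d Hd. rewrite dot_lc. destruct (Z.eq_dec d hi) as [->|]; [fold p q; lra|].
           pose proof (Hall d ltac:(lia)). pose proof (Hx d Hd). nra.
        -- exists hi. split; [lia|]. rewrite dot_lc. unfold p, q. ring.
Qed.

Lemma cint_indep_nonzero t e x : cross t e <> vzero -> cint t e x -> x <> vzero.
Proof.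
  intros Hi (a & b & Ha & Hb & ->) E. apply Hi.
  assert (E2 : cross t e = vscale (/ a) (cross (lc a t b e) e)).
  { destruct t, e; vsimp. f_equal; field; lra. }
  rewrite E2, E. destruct e; vsimp. f_equal; ring.
Qed.

(** * Convexity of right-turning cycles *)

(** Indexing by Z lets a cycle be followed backwards and shifted freely. [rt_min] makes [k] the
    exact period. [rt_disj] still admits two lanes that traverse one arc in opposite directions;
    this is excluded only once the eye is known. *)
Record right_turning (t e : Z -> vec3) (k : Z) : Prop := {
  rt_pos : (0 < k)%Z;
  rt_t : forall i, t (i + k)%Z = t i;
  rt_e : forall i, e (i + k)%Z = e i;
  rt_min : forall i j, t i = t j -> e i = e j -> (k | i - j)%Z;
  rt_hit : forall i, cint (t i) (e i) (e (i - 1)%Z);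
  rt_turn : forall i, dot (cross (e (i - 1)%Z) (t (i - 1)%Z)) (e i) > 0;
  rt_disj : forall i j x, cint (t i) (e i) x -> cint (t j) (e j) x ->
    (t i = t j /\ e i = e j) \/ (t i = e j /\ e i = t j)
}.

Arguments rt_pos {t e k}.
Arguments rt_t {t e k}.
Arguments rt_e {t e k}.
Arguments rt_min {t e k}.
Arguments rt_hit {t e k}.
Arguments rt_turn {t e k}.
Arguments rt_disj {t e k}.

(** Normal of the great circle of lane [i], pointing to its right as seen from outside the
    sphere. *)
Definition rnormal (t e : Z -> vec3) (i : Z) : vec3 := cross (e i) (t i).

Lemma rnormal_t t e i : dot (rnormal t e i) (t i) = 0.
Proof. apply dot_cross_r. Qed.

Lemma rnormal_e t e i : dot (rnormal t e i) (e i) = 0.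
Proof. apply dot_cross_l. Qed.

Lemma rt_hit_succ {t e k} i : right_turning t e k -> cint (t (i + 1)%Z) (e (i + 1)%Z) (e i).
Proof. intros H. pose proof (rt_hit H (i + 1)%Z) as H1. replace (i + 1 - 1)%Z with i in H1 by lia. auto. Qed.

Lemma rnormal_entry t e k i : right_turning t e k -> dot (rnormal t e i) (e (i - 1)%Z) = 0.
Proof.
  intros H. apply (dot_cint_zero _ _ _ _ (rnormal_t t e i) (rnormal_e t e i) (rt_hit H i)).
Qed.

Lemma rnormal_pred_end {t e k} i : right_turning t e k -> dot (rnormal t e (i - 1)) (e i) > 0.
Proof. intros H. apply (rt_turn H). Qed.

Lemma rnormal_pred_tail {t e k} i : right_turning t e k -> dot (rnormal t e (i - 1)) (t i) < 0.
Proof.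
  intros H. pose proof (rnormal_pred_end i H) as H1.
  destruct (rt_hit H i) as (a & b & Ha & Hb & E).
  pose proof (rnormal_e t e (i - 1)) as H2. rewrite E, dot_lc in H2. nra.
Qed.

Lemma rnormal_succ_tail {t e k} i : right_turning t e k -> dot (rnormal t e (i + 1)) (t i) > 0.
Proof.
  intros H. pose proof (rnormal_pred_end (i + 1)%Z H) as H1.
  pose proof (rt_hit H (i + 1)%Z) as (a & b & Ha & Hb & E).
  unfold rnormal in *. replace (i + 1 - 1)%Z with i in * by lia.
  rewrite E in H1.
  replace (dot (cross (lc a (t (i + 1)%Z) b (e (i + 1)%Z)) (t i)) (e (i + 1)%Z))
    with (a * dot (cross (e (i + 1)%Z) (t (i + 1)%Z)) (t i)) in H1
    by (vring).
  nra.
Qed.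

Lemma rnormal_succ_end {t e k} i : right_turning t e k -> dot (rnormal t e (i + 1)) (e i) = 0.
Proof.
  intros H. pose proof (rnormal_entry _ _ _ (i + 1)%Z H) as H1.
  replace (i + 1 - 1)%Z with i in H1 by lia. auto.
Qed.

Lemma rnormal_succ_entry {t e k} i : right_turning t e k -> dot (rnormal t e (i + 1)) (e (i - 1)%Z) > 0.
Proof.
  intros H. destruct (rt_hit H i) as (a & b & Ha & Hb & ->).
  rewrite dot_lc, (rnormal_succ_end i H). pose proof (rnormal_succ_tail i H). nra.
Qed.

Lemma rnormal_nonzero t e k i : right_turning t e k -> rnormal t e i <> vzero.
Proof.
  intros H E. pose proof (rnormal_pred_end (i + 1)%Z H) as H1.
  replace (i + 1 - 1)%Z with i in H1 by lia.
  rewrite E in H1. unfold dot, vzero in H1; simpl in H1. lra.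
Qed.

Lemma rnormal_plane {t e k} i x : right_turning t e k -> dot (rnormal t e i) x = 0 ->
  exists l m, x = lc l (t i) m (e i).
Proof.
  intros H. apply plane_decomposition, (rnormal_nonzero _ _ _ i H).
Qed.

Lemma rnormal_plane_entry {t e k} i x : right_turning t e k -> dot (rnormal t e i) x = 0 ->
  exists l m, x = lc l (e (i - 1)%Z) m (e i).
Proof.
  intros H H0. destruct (rnormal_plane i x H H0) as (l & m & ->).
  destruct (rt_hit H i) as (a & b & Ha & _ & ->). exists (l / a), (m - l * b / a).
  generalize (t i) (e i). clear - Ha. intros [] []. vsimp; f_equal; field; lra.
Qed.

(* The conclusion says that turning right at the end of lane [r] leads onto lane [c], in its direction. *)
Lemma right_turning_closing t e k r c : right_turning t e k ->
  cint (t c) (e c) (e r) -> dot (rnormal t e c) (e (r - 1)%Z) > 0 -> (k | r + 1 - c)%Z.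
Proof.
  intros H Hc Hp.
  pose proof (rt_hit_succ r H) as Hr.
  destruct (rt_disj H _ _ _ Hr Hc) as [[E1 E2]|[E1 E2]].
  - apply (rt_min H); auto.
  - exfalso. pose proof (rnormal_succ_tail r H) as H1.
    assert (E : forall v, dot (rnormal t e (r + 1)) v = - dot (rnormal t e c) v).
    { intros v. unfold rnormal. rewrite E1, E2. vring. }
    rewrite E in H1.
    pose proof (dot_cint_zero _ _ _ _ (rnormal_t t e c) (rnormal_e t e c) Hc) as H2.
    destruct (rt_hit H r) as (a & b & Ha & Hb & E3).
    rewrite E3, dot_lc, H2 in Hp. nra.
Qed.

Lemma rnormal_same_arc t e k i c x : right_turning t e k ->
  cint (t i) (e i) x -> cint (t c) (e c) x ->
  dot (rnormal t e c) (t i) = 0 /\ dot (rnormal t e c) (e i) = 0.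
Proof.
  intros H H1 H2. destruct (rt_disj H _ _ _ H1 H2) as [[-> ->]|[-> ->]];
  split; auto using rnormal_t, rnormal_e.
Qed.

(** On the great circle of lane [c], lane [c + 1] cuts off what lies beyond the end and lane [c - 1]
    what lies behind the entry, so the two neighbours alone confine [x] to the side. *)
Lemma right_turning_side t e k c x : right_turning t e k ->
  dot (rnormal t e c) x = 0 -> dot (rnormal t e (c - 1)) x >= 0 -> dot (rnormal t e (c + 1)) x >= 0 ->
  x <> vzero ->
  cint (t c) (e c) x \/ exists m, 0 < m /\ x = vscale m (e c).
Proof.
  intros H H0 H1 H2 Hx.
  destruct (rnormal_plane c x H H0) as (l & m & ->).
  rewrite dot_lc in H1, H2.
  pose proof (rnormal_pred_end c H). pose proof (rnormal_pred_tail c H).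
  pose proof (rnormal_succ_tail c H). rewrite (rnormal_succ_end c H) in H2.
  assert (Hl : 0 <= l) by nra.
  destruct (Rle_lt_or_eq_dec _ _ Hl) as [Hl'|<-].
  - left. exists l, m. repeat split; auto. nra.
  - right. exists m. assert (0 <= m) by nra. split.
    + destruct (Req_dec m 0) as [->|]; [|lra]. exfalso. apply Hx. veq.
    + veq.
Qed.

Lemma dot_pos_nonzero n x : dot n x > 0 -> x <> vzero.
Proof. intros H ->. unfold dot, vzero in H; simpl in H. lra. Qed.

(** [e (b - 1)] is the vertex at which lane [b] is entered. The ranges cover the [d] vertices after
    [e a] and the [d] vertices before [e (a - 1)]; these two themselves lie on lane [a]. *)
Definition convex_upto (t e : Z -> vec3) (d : Z) : Prop :=
  forall a, (forall b, (a + 2 <= b <= a + 1 + d)%Z -> dot (rnormal t e a) (e (b - 1)%Z) > 0) /\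
            (forall b, (a - d <= b <= a - 1)%Z -> dot (rnormal t e a) (e (b - 1)%Z) > 0).

Lemma lc_cancel_l (x y v : vec3) l m : 0 < l -> y = lc l x m v -> x = lc (/ l) y (- m / l) v.
Proof.
  intros Hl ->. destruct x, v; vsimp. f_equal; field; lra.
Qed.

(* Lane [m] leaving through the line of lane [0] would pass behind its tail; then the backward
   walk from lane [0] is trapped in the convex polygon cut out by lanes [0..m]. *)
Lemma no_outward_escape0 t e k d : right_turning t e k -> (1 <= d)%Z -> (d + 2 < k)%Z ->
  convex_upto t e d -> dot (rnormal t e 0) (e (d + 1)%Z) > 0.
Proof.
  intros H Hd Hdk Hc. set (n := rnormal t e). set (m := (d + 1)%Z).
  assert (Em : m = (d + 1)%Z) by reflexivity.
  change (dot (n 0%Z) (e m) > 0). clearbody m.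
  destruct (Rlt_le_dec 0 (dot (n 0%Z) (e m))) as [|Hneg]; [lra|exfalso].
  assert (Hf : forall a b, (a + 2 <= b <= a + m)%Z -> dot (n a) (e (b - 1)%Z) > 0)
    by (intros a b Hab; apply (proj1 (Hc a)); lia).
  assert (Hb : forall a b, (a - d <= b <= a - 1)%Z -> dot (n a) (e (b - 1)%Z) > 0)
    by (intros a b Hab; apply (proj2 (Hc a)); lia).
  assert (Hz : forall a, dot (n a) (e (a - 1)%Z) = 0) by (intros; apply (rnormal_entry _ _ _ _ H)).
  assert (He : forall a, dot (n a) (e a) = 0) by (intros; apply rnormal_e).
  assert (Hm : dot (n 0%Z) (e (m - 1)%Z) > 0) by (apply Hf; lia).
  (* [y] is the point where the side from [e (m - 1)] to [e m] meets the plane of lane 0; [al = 0]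
     is the case in which [e m] itself lies on this plane. *)
  set (al := - dot (n 0%Z) (e m)). set (be := dot (n 0%Z) (e (m - 1)%Z)).
  set (y := lc al (e (m - 1)%Z) be (e m)).
  assert (Hy0 : dot (n 0%Z) y = 0) by (unfold y; rewrite dot_lc; unfold al, be; ring).
  assert (Hal : 0 <= al) by (unfold al; lra). assert (Hbe : 0 < be) by (unfold be; lra).
  assert (Hyc : forall c, (1 <= c <= m)%Z -> dot (n c) y >= 0).
  { intros c Hcm. unfold y. rewrite dot_lc.
    assert (dot (n c) (e m) >= 0).
    { destruct (Z.eq_dec c m) as [->|]; [rewrite He; lra|].
      apply Rgt_ge. replace m with (m + 1 - 1)%Z by lia. apply Hf. lia. }
    assert (dot (n c) (e (m - 1)%Z) >= 0).
    { destruct (Z.eq_dec c m) as [->|]; [rewrite Hz; lra|].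
      destruct (Z.eq_dec c (m - 1)) as [->|]; [rewrite He; lra|].
      apply Rgt_ge, Hf. lia. }
    nra. }
  assert (Hy1 : dot (n 1%Z) y > 0).
  { unfold y. rewrite dot_lc.
    assert (dot (n 1%Z) (e m) > 0) by (replace m with (m + 1 - 1)%Z by lia; apply Hf; lia).
    assert (dot (n 1%Z) (e (m - 1)%Z) >= 0).
    { destruct (Z.eq_dec 1 (m - 1)) as [E|]; [rewrite <- E; rewrite He; lra|].
      apply Rgt_ge, Hf. lia. }
    nra. }
  destruct (rnormal_plane 0%Z y H Hy0) as (l & mu & Ey).
  assert (Ht1 : dot (n 1%Z) (t 0%Z) > 0) by (apply (rnormal_succ_tail 0%Z H)).
  assert (He1 : dot (n 1%Z) (e 0%Z) = 0) by (apply (rnormal_succ_end 0%Z H)).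
  assert (Hl : 0 < l) by (rewrite Ey, dot_lc, He1 in Hy1; nra).
  destruct (Rlt_le_dec 0 mu) as [Hmu|Hmu].
  (* Inside lane 0, the point [y] would either be a crossing of two arcs or be the end of lane [m],
     which closes the cycle after [m + 1 < k] lanes. *)
  { assert (Hy_in : cint (t 0%Z) (e 0%Z) y) by (exists l, mu; auto).
    destruct (Rle_lt_or_eq_dec _ _ Hal) as [Hal'|Hal'].
    - assert (Hy_in2 : cint (t m) (e m) y).
      { apply cint_toward_end; [apply (rt_hit H m)|lra|lra]. }
      destruct (rnormal_same_arc _ _ _ m 0%Z y H Hy_in2 Hy_in) as [E1 E2].
      pose proof (dot_cint_zero _ _ _ _ E1 E2 (rt_hit H m)) as E3. fold n in E3. lra.
    - assert (Hem : cint (t 0%Z) (e 0%Z) (e m)).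
      { apply (cint_unscale _ _ _ be); auto. replace (vscale be (e m)) with y; auto.
        unfold y. rewrite <- Hal'. veq. }
      pose proof (right_turning_closing _ _ _ m 0%Z H Hem Hm) as [q Hq].
      pose proof (rt_pos H). assert (0 < q)%Z by nia. assert (q < 1)%Z by nia. lia. }
  (* Now [t 0] lies between [y] and [e 0], possibly at [y], so lane 0 starts within the polygon cut
     out by lanes 0 to [m]. *)
  assert (HP0 : forall c, (1 <= c <= m)%Z -> dot (n c) (e (-1)%Z) > 0).
  { intros c Hcm. destruct (rt_hit H 0%Z) as (a & b & Ha & Hb' & E).
    change (0 - 1)%Z with (-1)%Z in E.
    assert (Et : t 0%Z = lc (/ l) y (- mu / l) (e 0%Z)) by (apply lc_cancel_l; auto).
    rewrite E, dot_lc, Et, dot_lc.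
    assert (0 < / l) by (apply Rinv_0_lt_compat; auto).
    assert (0 <= - mu / l) by (unfold Rdiv; nra).
    assert (dot (n c) (e 0%Z) >= 0 /\ (dot (n c) (e 0%Z) > 0 \/ dot (n c) y > 0)) as [Q1 Q2].
    { destruct (Z.eq_dec c 1) as [->|].
      - rewrite He1. split; [lra|]. auto.
      - assert (dot (n c) (e 0%Z) > 0) by (change 0%Z with (1 - 1)%Z; apply Hb; lia).
        split; [lra|auto]. }
    pose proof (Hyc c Hcm).
    assert (0 <= - mu / l * dot (n c) (e 0%Z)) by nra.
    destruct Q2 as [Q2|Q2].
    - assert (0 <= / l * dot (n c) y) by nra. nra.
    - assert (0 < / l * dot (n c) y) by nra. nra. }
  (* Backward walk: the vertex at which lane [- r] is entered is strictly right of lanes [- r + 1]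
     to [m]. After one full period this puts [e (-1)] strictly to the right of lane 0, on which it
     lies. *)
  assert (G : forall r : nat, forall c, (- Z.of_nat r + 1 <= c <= m)%Z ->
    dot (n c) (e (- Z.of_nat r - 1)%Z) > 0).
  { induction r as [|r IH].
    - intros c Hcm. simpl. apply HP0. simpl in Hcm. lia.
    - set (i := (- Z.of_nat (S r))%Z).
      assert (Edi : i = (- Z.of_nat (S r))%Z) by reflexivity. clearbody i.
      assert (Ei : (- Z.of_nat r = i + 1)%Z) by lia.
      rewrite Ei in IH. replace (i + 1 - 1)%Z with i in IH by lia.
      assert (Hi : (i <= -1)%Z) by lia.
      assert (Hs : dot (n (i + 1)%Z) (t i) > 0) by apply (rnormal_succ_tail i H).
      assert (Hse : dot (n (i + 1)%Z) (e i) = 0) by apply (rnormal_succ_end i H).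
      assert (Hti : forall c, (i + 1 <= c <= m)%Z -> dot (n c) (t i) >= 0).
      { intros c0 Hc0. destruct (Z.eq_dec c0 (i + 1)) as [->|Hn0]; [lra|].
        destruct (Rlt_le_dec (dot (n c0) (t i)) 0) as [Hlt|]; [exfalso|lra].
        destruct (first_crossing n (i + 2)%Z m (e i) (t i)) as
          [Hbad | (a & b & Ha & Hb' & Hall & c & Hcr & Hc0')].
        { intros c Hcr. apply IH. lia. }
        { specialize (Hbad c0). assert (dot (n c0) (t i) > 0) by (apply Hbad; lia). lra. }
        set (x := lc a (e i) b (t i)) in *.
        assert (Hxs : dot (n (i + 1)%Z) x > 0) by (unfold x; rewrite dot_lc; nra).
        assert (Hxall : forall c, (i + 1 <= c <= m)%Z -> dot (n c) x >= 0).
        { intros c' Hc'. destruct (Z.eq_dec c' (i + 1)) as [->|]; [lra|apply Hall; lia]. }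
        assert (Hxnz : x <> vzero) by (apply (dot_pos_nonzero _ _ Hxs)).
        assert (Hei : dot (n c) (e i) > 0) by (apply IH; lia).
        assert (Ha' : 0 < a).
        { destruct (Rle_lt_or_eq_dec _ _ Ha) as [|<-]; auto. exfalso.
          specialize (Hall c0). unfold x in Hall. rewrite dot_lc in Hall.
          assert (0 * dot (n c0) (e i) + b * dot (n c0) (t i) >= 0) by (apply Hall; lia). nra. }
        assert (Hxi : cint (t i) (e i) x) by (apply cint_sym; exists a, b; auto).
        assert (Hno : forall c', (i + 2 <= c' <= m)%Z -> ~ cint (t c') (e c') x).
        { intros c' Hc' Hx'. destruct (rnormal_same_arc _ _ _ _ _ _ H Hxi Hx') as [_ E2].
          fold n in E2. assert (dot (n c') (e i) > 0) by (apply IH; lia). lra. }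
        destruct (Z.eq_dec c m) as [->|Hcm].
        - destruct (rnormal_plane_entry m x H Hc0') as (p' & q' & Ex').
          assert (Hm1 : dot (n (m - 1)%Z) x >= 0) by (apply Hxall; lia).
          assert (Hm0 : dot (n 0%Z) x >= 0) by (apply Hxall; lia).
          rewrite Ex', dot_lc in Hm1, Hm0.
          assert (P1 : dot (n (m - 1)%Z) (e m) > 0) by apply (rnormal_pred_end m H).
          rewrite He in Hm1. assert (Hq : 0 <= q') by nra.
          assert (Hp : 0 <= p') by (unfold be in *; nra).
          destruct (Rle_lt_or_eq_dec _ _ Hp) as [Hp'|Hp'].
          + apply (Hno m); [lia|]. rewrite Ex'. apply cint_toward_end; [apply (rt_hit H m)|lra|lra].
          + rewrite <- Hp' in *.
            assert (Hq' : 0 < q').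
            { destruct (Rle_lt_or_eq_dec _ _ Hq) as [|Hq']; auto. exfalso. apply Hxnz.
              rewrite Ex', <- Hq'. veq. }
            assert (Hem : dot (n 0%Z) (e m) = 0) by nra.
            destruct (Z.eq_dec i (-1)) as [Ei1|Ei1].
            * rewrite Ei1 in Hxs. change (-1 + 1)%Z with 0%Z in Hxs.
              rewrite Ex', dot_lc, Hem in Hxs. lra.
            * assert (Hx1 : dot (n (-1)%Z) x >= 0) by (apply Hxall; lia).
              assert (Hy2 : dot (n (-1)%Z) y < 0).
              { rewrite Ey, dot_lc.
                pose proof (rnormal_pred_tail 0%Z H) as Q1.
                pose proof (rnormal_pred_end 0%Z H) as Q2.
                change (0 - 1)%Z with (-1)%Z in Q1, Q2. fold n in Q1, Q2. nra. }
              unfold y in Hy2. rewrite dot_lc in Hy2. unfold al in Hy2. rewrite Hem in Hy2.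
              rewrite Ex', dot_lc in Hx1. nra.
        - destruct (right_turning_side _ _ _ c x H Hc0') as [Hin | (mu' & Hmu' & Ein)]; auto.
          + apply Hxall. lia.
          + apply Hxall. lia.
          + apply (Hno c); auto; lia.
          + apply (Hno (c + 1)%Z); [lia|]. rewrite Ein. apply cint_scale; auto. apply (rt_hit_succ c H). }
      intros c Hcm. destruct (rt_hit H i) as (a & b & Ha & Hb' & ->). rewrite dot_lc.
      pose proof (Hti c ltac:(lia)).
      destruct (Z.eq_dec c (i + 1)) as [->|].
      + rewrite Hse. nra.
      + assert (dot (n c) (e i) > 0) by (apply IH; lia). nra. }
  pose proof (rt_pos H).
  specialize (G (Z.to_nat k) 0%Z ltac:(lia)).
  replace (- Z.of_nat (Z.to_nat k) - 1)%Z with (0 - 1 - k)%Z in G by lia.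
  pose proof (rt_e H (0 - 1 - k)%Z) as E. replace (0 - 1 - k + k)%Z with (0 - 1)%Z in E by lia.
  rewrite <- E, Hz in G. lra.
Qed.

(* Dually, if lane [0] is about to run into the side of lane [-m], the forward walk spirals
   inwards and is trapped. *)
Lemma no_inward_spiral0 t e k d : right_turning t e k -> (1 <= d)%Z -> (d + 2 < k)%Z ->
  convex_upto t e d -> dot (rnormal t e 0) (e (- d - 2)%Z) > 0.
Proof.
  intros H Hd Hdk Hc. set (n := rnormal t e). set (m := (d + 1)%Z).
  assert (Em : m = (d + 1)%Z) by reflexivity.
  replace (- d - 2)%Z with (- m - 1)%Z by lia.
  clearbody m. change (dot (n 0%Z) (e (- m - 1)%Z) > 0).
  destruct (Rlt_le_dec 0 (dot (n 0%Z) (e (- m - 1)%Z))) as [|Hneg]; [lra|exfalso].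
  assert (Hf : forall a b, (a + 2 <= b <= a + m)%Z -> dot (n a) (e (b - 1)%Z) > 0)
    by (intros a b Hab; apply (proj1 (Hc a)); lia).
  assert (Hb : forall a b, (a - d <= b <= a - 1)%Z -> dot (n a) (e (b - 1)%Z) > 0)
    by (intros a b Hab; apply (proj2 (Hc a)); lia).
  assert (Hz : forall a, dot (n a) (e (a - 1)%Z) = 0) by (intros; apply (rnormal_entry _ _ _ _ H)).
  assert (He : forall a, dot (n a) (e a) = 0) by (intros; apply rnormal_e).
  assert (Hm : dot (n 0%Z) (e (- m)%Z) > 0).
  { replace (- m)%Z with (- d - 1)%Z by lia. apply Hb. lia. }
  (* [y] is the point where the side from [e (- m - 1)] to [e (- m)] meets the plane of lane 0. *)
  set (al := dot (n 0%Z) (e (- m)%Z)). set (be := - dot (n 0%Z) (e (- m - 1)%Z)).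
  set (y := lc al (e (- m - 1)%Z) be (e (- m)%Z)).
  assert (Hy0 : dot (n 0%Z) y = 0) by (unfold y; rewrite dot_lc; unfold al, be; ring).
  assert (Hal : 0 < al) by (unfold al; lra). assert (Hbe : 0 <= be) by (unfold be; lra).
  assert (Hyc : forall c, (- m <= c <= -1)%Z -> dot (n c) y >= 0).
  { intros c Hcm. unfold y. rewrite dot_lc.
    assert (dot (n c) (e (- m)%Z) >= 0).
    { destruct (Z.eq_dec c (- m)) as [->|]; [rewrite He; lra|].
      destruct (Z.eq_dec c (- m + 1)) as [->|].
      { pose proof (Hz (- m + 1)%Z) as E. replace (- m + 1 - 1)%Z with (- m)%Z in E by lia. lra. }
      apply Rgt_ge. replace (- m)%Z with (- m + 1 - 1)%Z by lia. apply Hb. lia. }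
    assert (dot (n c) (e (- m - 1)%Z) >= 0).
    { destruct (Z.eq_dec c (- m)) as [->|]; [rewrite Hz; lra|]. apply Rgt_ge, Hb. lia. }
    nra. }
  assert (Hy1 : dot (n (-1)%Z) y > 0).
  { unfold y. rewrite dot_lc.
    assert (dot (n (-1)%Z) (e (- m - 1)%Z) > 0) by (apply Hb; lia).
    assert (dot (n (-1)%Z) (e (- m)%Z) >= 0).
    { destruct (Z.eq_dec (-1) (- m + 1)) as [E|].
      - pose proof (Hz (-1)%Z) as E1. replace (-1 - 1)%Z with (- m)%Z in E1 by lia. lra.
      - replace (- m)%Z with (- m + 1 - 1)%Z by lia. apply Rgt_ge, Hb. lia. }
    nra. }
  destruct (rnormal_plane_entry 0 y H Hy0) as (l & mu & Ey). change (0 - 1)%Z with (-1)%Z in Ey.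
  assert (Hp1 : dot (n (-1)%Z) (e 0%Z) > 0) by apply (rnormal_pred_end 0%Z H).
  assert (Hmu : 0 < mu) by (rewrite Ey, dot_lc, He in Hy1; nra).
  assert (Hym : cint (t (- m)%Z) (e (- m)%Z) y).
  { apply cint_toward_end; [apply (rt_hit H (- m)%Z)|lra|lra]. }
  destruct (Rle_lt_dec 0 l) as [Hl|Hl].
  { destruct (Rle_lt_or_eq_dec _ _ Hl) as [Hl'|Hl'].
    - assert (Hy_in : cint (t 0%Z) (e 0%Z) y).
      { rewrite Ey. apply cint_toward_end; [apply (rt_hit H 0%Z)|lra|lra]. }
      destruct (rnormal_same_arc _ _ _ (- m)%Z 0%Z y H Hym Hy_in) as [_ E2]. fold n in E2. lra.
    - assert (Hem : cint (t (- m)%Z) (e (- m)%Z) (e 0%Z)).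
      { apply (cint_unscale _ _ _ mu); auto. replace (vscale mu (e 0%Z)) with y; auto.
        rewrite Ey, <- Hl'. veq. }
      assert (Hp : dot (n (- m)%Z) (e (0 - 1)%Z) > 0) by (apply Hf; lia).
      pose proof (right_turning_closing _ _ _ 0%Z (- m)%Z H Hem Hp) as [q Hq].
      assert (0 < q)%Z by nia. assert (q < 1)%Z by nia. lia. }
  (* Now [e 0] lies strictly between [e (-1)] and [y]: lane 0 stops short of lane [- m], inside the
     polygon. *)
  assert (HP1 : forall c, (- m <= c <= -1)%Z -> dot (n c) (e 0%Z) > 0).
  { intros c Hcm.
    assert (Et : e 0%Z = lc (/ mu) y (- l / mu) (e (-1)%Z)).
    { apply lc_cancel_l; auto. rewrite Ey. veq. }
    rewrite Et, dot_lc.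
    assert (0 < / mu) by (apply Rinv_0_lt_compat; auto).
    assert (0 < - l / mu) by (unfold Rdiv; nra).
    destruct (Z.eq_dec c (-1)) as [->|].
    - rewrite He. nra.
    - assert (dot (n c) (e (-1)%Z) > 0) by (change (-1)%Z with (0 - 1)%Z; apply Hf; lia).
      pose proof (Hyc c Hcm).
      assert (0 <= / mu * dot (n c) y) by nra. nra. }
  (* The walk is followed up to lane [k - m - 1], whose end is [e (- m - 1)] by periodicity, the
     vertex assumed not to be on the right of lane 0. *)
  assert (G : forall r : nat, (Z.of_nat r + 1 <= k - m)%Z -> forall c, (- m <= c <= Z.of_nat r - 1)%Z ->
    dot (n c) (e (Z.of_nat r)) > 0).
  { induction r as [|r IH].
    - intros _ c Hcm. apply HP1. simpl in *. lia.
    - intros Hrk. specialize (IH ltac:(lia)).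
      set (i := Z.of_nat (S r)) in *.
      assert (Edi : i = Z.of_nat (S r)) by reflexivity. clearbody i. replace (Z.of_nat r) with (i - 1)%Z in IH by lia.
      assert (Hi : (1 <= i)%Z) by lia.
      assert (Hpe : dot (n (i - 1)%Z) (e i) > 0) by apply (rnormal_pred_end i H).
      intros c0 Hc0. destruct (Z.eq_dec c0 (i - 1)) as [->|Hn0]; [lra|].
      destruct (Rlt_le_dec 0 (dot (n c0) (e i))) as [Hlt|Hlt]; [lra|exfalso].
      destruct (first_crossing n (- m)%Z (i - 2)%Z (e (i - 1)%Z) (e i)) as
          [Hbad | (a & b & Ha & Hb' & Hall & c & Hcr & Hc0')].
      { intros c Hcr. apply IH. lia. }
      { assert (dot (n c0) (e i) > 0) by (apply Hbad; lia). lra. }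
      set (x := lc a (e (i - 1)%Z) b (e i)) in *.
      assert (Hxs : dot (n (i - 1)%Z) x > 0) by (unfold x; rewrite dot_lc, He; nra).
      assert (Hxall : forall c, (- m <= c <= i - 1)%Z -> dot (n c) x >= 0).
      { intros c' Hc'. destruct (Z.eq_dec c' (i - 1)) as [->|]; [lra|apply Hall; lia]. }
      assert (Hxnz : x <> vzero) by (apply (dot_pos_nonzero _ _ Hxs)).
      assert (Hci : dot (n c) (e (i - 1)%Z) > 0) by (apply IH; lia).
      assert (Hside : exists c', (- m <= c' <= i - 1)%Z /\ cint (t c') (e c') x).
      { destruct (Z.eq_dec c (- m)) as [->|Hcm].
        - assert (Hm1 : dot (n (- m + 1)%Z) x >= 0) by (apply Hxall; lia).
          assert (Hm0 : dot (n 0%Z) x >= 0) by (apply Hxall; lia).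
          destruct (rnormal_plane_entry (- m) x H Hc0') as (p' & q' & Ex').
          rewrite Ex', dot_lc in Hm1, Hm0.
          assert (P1 : dot (n (- m + 1)%Z) (e (- m - 1)%Z) > 0) by apply (rnormal_succ_entry _ H).
          assert (P2 : dot (n (- m + 1)%Z) (e (- m)%Z) = 0) by apply (rnormal_succ_end _ H).
          rewrite P2 in Hm1. assert (Hp : 0 <= p') by nra.
          assert (Hq : 0 <= q') by (unfold be, al in *; nra).
          destruct (Rle_lt_or_eq_dec _ _ Hp) as [Hp'|Hp'].
          + exists (- m)%Z. split; [lia|]. rewrite Ex'. apply cint_toward_end; [apply (rt_hit H (- m)%Z)|lra|lra].
          + rewrite <- Hp' in *.
            assert (Hq' : 0 < q').
            { destruct (Rle_lt_or_eq_dec _ _ Hq) as [|Hq']; auto. exfalso. apply Hxnz.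
              rewrite Ex', <- Hq'. veq. }
            exists (- m + 1)%Z. split; [lia|].
            replace x with (vscale q' (e (- m)%Z)).
            * apply cint_scale; auto.
              pose proof (rt_hit H (- m + 1)%Z) as Hh.
              replace (- m + 1 - 1)%Z with (- m)%Z in Hh by lia. auto.
            * rewrite Ex'. veq.
        - destruct (right_turning_side _ _ _ c x H Hc0') as [Hin | (mu' & Hmu' & Ein)]; auto.
          + apply Hxall. lia.
          + apply Hxall. lia.
          + exists c. split; auto; lia.
          + exists (c + 1)%Z. split; [lia|]. rewrite Ein. apply cint_scale; auto. apply (rt_hit_succ c H). }
      destruct Hside as (c' & Hc' & Hin).
      destruct (Rle_lt_or_eq_dec _ _ Ha) as [Ha'|Ha'].
      + assert (Hxi : cint (t i) (e i) x).
        { apply cint_toward_end; [apply (rt_hit H i)|lra|lra]. }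
        destruct (rnormal_same_arc _ _ _ _ _ _ H Hxi Hin) as [E1 E2].
        pose proof (dot_cint_zero _ _ _ _ E1 E2 (rt_hit H i)) as E3. fold n in E1, E2, E3.
        destruct (Z.eq_dec c' (i - 1)) as [->|]; [lra|].
        assert (dot (n c') (e (i - 1)%Z) > 0) by (apply IH; lia). lra.
      + assert (Hei : cint (t c') (e c') (e i)).
        { apply (cint_unscale _ _ _ b); auto. replace (vscale b (e i)) with x; auto.
          unfold x. rewrite <- Ha'. veq. }
        destruct (Z.eq_dec c' (i - 1)) as [->|Hc1].
        { pose proof (dot_cint_zero _ _ _ _ (rnormal_t t e (i - 1)) (rnormal_e t e (i - 1)) Hei) as E3.
          fold n in E3. lra. }
        assert (Hp : dot (n c') (e (i - 1)%Z) > 0) by (apply IH; lia).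
        destruct (right_turning_closing _ _ _ _ _ H Hei Hp) as [q Hq].
        assert (q = 1)%Z by nia. subst q.
        (* The walk has legitimately returned to lane [- m]. If it took more than one step,
           [e (- m - 1)] is on the plane of lane 0, so [y] is a multiple of it; but [y] lies beyond
           the end of lane 0 and hence strictly left of lane 1. *)
        assert (Ec' : c' = (- m)%Z) by lia.
        assert (Eik : i = (- m - 1 + k)%Z) by lia.
        unfold x in Hxs.
        assert (Eei : e i = e (- m - 1)%Z) by (rewrite Eik; apply (rt_e H)).
        assert (Hx0 : dot (n 0%Z) x >= 0) by (apply Hxall; lia).
        unfold x in Hx0. rewrite dot_lc, <- Ha', Eei in Hx0.
        destruct (Z.eq_dec i 1) as [Ei|Ei].
        { rewrite dot_lc, <- Ha', Ei in Hxs. change (1 - 1)%Z with 0%Z in Hxs.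
          rewrite <- Ei, Eei in Hxs. nra. }
        assert (Hx1 : dot (n 1%Z) x >= 0) by (apply Hxall; lia).
        unfold x in Hx1. rewrite dot_lc, <- Ha', Eei in Hx1.
        assert (Hn0' : dot (n 0%Z) (e (- m - 1)%Z) = 0) by nra.
        assert (Hy2 : dot (n 1%Z) y < 0).
        { rewrite Ey, dot_lc.
          pose proof (rnormal_succ_entry 0%Z H) as Q1. pose proof (rnormal_succ_end 0%Z H) as Q2.
          change (0 - 1)%Z with (-1)%Z in Q1. change (0 + 1)%Z with 1%Z in Q1, Q2.
          fold n in Q1, Q2. rewrite Q2. nra. }
        unfold y in Hy2. rewrite dot_lc in Hy2. unfold be in Hy2. rewrite Hn0' in Hy2. nra. }
  pose proof (rt_pos H).
  specialize (G (Z.to_nat (k - m - 1)) ltac:(lia) 0%Z ltac:(lia)).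
  replace (Z.of_nat (Z.to_nat (k - m - 1))) with (- m - 1 + k)%Z in G by lia.
  rewrite (rt_e H) in G. lra.
Qed.

Lemma right_turning_shift t e k s : right_turning t e k ->
  right_turning (fun i => t (i + s)%Z) (fun i => e (i + s)%Z) k.
Proof.
  intros H. split.
  - apply (rt_pos H).
  - intros i. replace (i + k + s)%Z with (i + s + k)%Z by lia. apply (rt_t H).
  - intros i. replace (i + k + s)%Z with (i + s + k)%Z by lia. apply (rt_e H).
  - intros i j E1 E2. replace (i - j)%Z with (i + s - (j + s))%Z by lia. apply (rt_min H); auto.
  - intros i. replace (i - 1 + s)%Z with (i + s - 1)%Z by lia. apply (rt_hit H).
  - intros i. replace (i - 1 + s)%Z with (i + s - 1)%Z by lia. apply (rt_turn H).
  - intros i j x. apply (rt_disj H).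
Qed.

Lemma convex_upto_shift t e d s : convex_upto t e d ->
  convex_upto (fun i => t (i + s)%Z) (fun i => e (i + s)%Z) d.
Proof.
  intros H a. unfold rnormal. split; intros b Hb;
  replace (b - 1 + s)%Z with (b + s - 1)%Z by lia.
  - apply (proj1 (H (a + s)%Z)). lia.
  - apply (proj2 (H (a + s)%Z)). lia.
Qed.

(** With period 1 or 2 the vertex [e 1] would lie on lane 0, although the turn puts it strictly to
    the right. The two trapping lemmas, applied at every shift, raise [d] by one; [d = k - 2] covers
    all vertices not on the lane. *)
Lemma convex_upto_all t e k : right_turning t e k -> (3 <= k)%Z /\ convex_upto t e (k - 2).
Proof.
  intros H.
  assert (Hk : (3 <= k)%Z).
  { pose proof (rt_pos H). pose proof (rnormal_pred_end 1%Z H) as H1.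
    change (1 - 1)%Z with 0%Z in H1.
    destruct (Z.eq_dec k 1) as [->|].
    { pose proof (rt_e H 0%Z) as E. change (0 + 1)%Z with 1%Z in E.
      rewrite E, rnormal_e in H1. lra. }
    destruct (Z.eq_dec k 2) as [->|]; [|lia].
    pose proof (rt_e H (-1)%Z) as E. change (-1 + 2)%Z with 1%Z in E.
    pose proof (rnormal_entry _ _ _ 0%Z H) as E2. change (0 - 1)%Z with (-1)%Z in E2.
    rewrite E, E2 in H1. lra. }
  split; auto.
  assert (G : forall d : nat, (Z.of_nat d + 1 <= k - 2)%Z -> convex_upto t e (Z.of_nat d + 1)).
  { induction d as [|d IH]; intros Hd.
    - intros a. split; intros b Hb.
      + replace b with (a + 2)%Z by lia. replace (a + 2 - 1)%Z with (a + 1)%Z by lia.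
        pose proof (rnormal_pred_end (a + 1)%Z H) as H1.
        replace (a + 1 - 1)%Z with a in H1 by lia. auto.
      + replace b with (a - 1)%Z by lia.
        pose proof (rnormal_succ_entry (a - 1)%Z H) as H1.
        replace (a - 1 + 1)%Z with a in H1 by lia. auto.
    - specialize (IH ltac:(lia)). set (D := (Z.of_nat d + 1)%Z) in *.
      replace (Z.of_nat (S d) + 1)%Z with (D + 1)%Z by lia.
      intros a. split; intros b Hb.
      + destruct (Z.eq_dec b (a + 2 + D)) as [->|]; [|apply (proj1 (IH a)); lia].
        pose proof (no_outward_escape0 _ _ k D (right_turning_shift _ _ _ a H) ltac:(lia) ltac:(lia)
          (convex_upto_shift _ _ _ a IH)) as H1.
        unfold rnormal in *. simpl in H1.
        replace (a + 2 + D - 1)%Z with (D + 1 + a)%Z by lia. auto.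
      + destruct (Z.eq_dec b (a - 1 - D)) as [->|]; [|apply (proj2 (IH a)); lia].
        pose proof (no_inward_spiral0 _ _ k D (right_turning_shift _ _ _ a H) ltac:(lia) ltac:(lia)
          (convex_upto_shift _ _ _ a IH)) as H1.
        unfold rnormal in *. simpl in H1.
        replace (a - 1 - D - 1)%Z with (- D - 2 + a)%Z by lia. auto. }
  specialize (G (Z.to_nat (k - 3)) ltac:(lia)).
  replace (Z.of_nat (Z.to_nat (k - 3)) + 1)%Z with (k - 2)%Z in G by lia. auto.
Qed.

Lemma periodic_shift {X} (L : Z -> X) K z q : (forall z, L (z + K)%Z = L z) -> L (z + q * K)%Z = L z.
Proof.
  intros H.
  assert (G : forall n : nat, forall z, L (z + Z.of_nat n * K)%Z = L z).
  { induction n as [|n IH]; intros y; [f_equal; lia|].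
    replace (y + Z.of_nat (S n) * K)%Z with (y + Z.of_nat n * K + K)%Z by lia. rewrite H. auto. }
  destruct (Z_le_gt_dec 0 q).
  - rewrite <- (G (Z.to_nat q) z), Z2Nat.id; auto.
  - rewrite <- (G (Z.to_nat (- q)) (z + q * K)%Z), Z2Nat.id by lia. f_equal. ring.
Qed.

Lemma right_turning_period t e k i q : right_turning t e k ->
  t (i + q * k)%Z = t i /\ e (i + q * k)%Z = e i.
Proof. intros H. split; apply periodic_shift; apply H. Qed.

Lemma right_turning_convex t e k i j : right_turning t e k -> dot (rnormal t e i) (e j) >= 0.
Proof.
  intros H. destruct (convex_upto_all _ _ _ H) as [Hk Hc].
  pose proof (Z.div_mod (j - i) k ltac:(lia)) as E.
  pose proof (Z.mod_pos_bound (j - i) k ltac:(lia)) as B.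
  set (r := ((j - i) mod k)%Z) in *. set (q := ((j - i) / k)%Z) in *.
  destruct (right_turning_period _ _ _ (i + r)%Z q H) as [_ E2].
  replace (i + r + q * k)%Z with j in E2 by lia. rewrite E2.
  destruct (Z.eq_dec r 0) as [->|]; [rewrite Z.add_0_r, rnormal_e; lra|].
  destruct (Z.eq_dec r (k - 1)) as [Er|].
  { destruct (right_turning_period _ _ _ (i - 1)%Z 1%Z H) as [_ E3].
    replace (i - 1 + 1 * k)%Z with (i + r)%Z in E3 by lia. rewrite E3, (rnormal_entry _ _ _ _ H). lra. }
  apply Rgt_ge. replace (i + r)%Z with (i + r + 1 - 1)%Z by lia. apply (proj1 (Hc i)). lia.
Qed.

(** * A point of the eye *)

Fixpoint vsum (f : nat -> vec3) (N : nat) : vec3 :=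
  match N with O => vzero | S N => vadd (vsum f N) (f N) end.

Lemma dot_vadd n x y : dot n (vadd x y) = dot n x + dot n y.
Proof. vring. Qed.

Lemma vsum_nonneg n f N : (forall i, (i < N)%nat -> dot n (f i) >= 0) -> dot n (vsum f N) >= 0.
Proof.
  induction N as [|N IH]; intros H; simpl.
  - unfold dot, vzero; simpl. lra.
  - rewrite dot_vadd. assert (dot n (vsum f N) >= 0) by (apply IH; intros; apply H; lia).
    assert (dot n (f N) >= 0) by (apply H; lia). lra.
Qed.

Lemma vsum_pos n f N i : (forall i, (i < N)%nat -> dot n (f i) >= 0) -> (i < N)%nat ->
  dot n (f i) > 0 -> dot n (vsum f N) > 0.
Proof.
  induction N as [|N IH]; intros H Hi Hp; [lia|]. simpl. rewrite dot_vadd.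
  assert (dot n (vsum f N) >= 0) by (apply vsum_nonneg; intros; apply H; lia).
  assert (dot n (f N) >= 0) by (apply H; lia).
  destruct (Nat.eq_dec i N) as [->|]; [lra|].
  assert (dot n (vsum f N) > 0) by (apply IH; [intros; apply H|..]; auto; lia). lra.
Qed.

(** The sum of the vertices of one period works: all are weakly right of lane [i], and [e (i + 1)]
    strictly. *)
Lemma right_turning_eye t e k : right_turning t e k -> exists p, forall i, dot (rnormal t e i) p > 0.
Proof.
  intros H. pose proof (rt_pos H).
  exists (vsum (fun j => e (Z.of_nat j)) (Z.to_nat k)). intros i.
  pose proof (Z.mod_pos_bound (i + 1) k ltac:(lia)) as B.
  apply (vsum_pos _ _ _ (Z.to_nat ((i + 1) mod k))).
  - intros j _. apply (right_turning_convex _ _ _ _ _ H).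
  - lia.
  - rewrite Z2Nat.id; [|lia].
    pose proof (Z.div_mod (i + 1) k ltac:(lia)) as E.
    destruct (right_turning_period _ _ _ ((i + 1) mod k)%Z ((i + 1) / k) H) as [_ E2].
    rewrite <- E2. replace ((i + 1) mod k + (i + 1) / k * k)%Z with (i + 1)%Z by lia.
    pose proof (rnormal_pred_end (i + 1)%Z H) as H1.
    replace (i + 1 - 1)%Z with i in H1 by lia. auto.
Qed.

(** * Walking below a strand *)

(** [A] relates tail and end of each lane, every arc being present in both directions. This isolates
    what the walk below the strand uses of a diagram. *)
Record arc_system (A : vec3 -> vec3 -> Prop) : Prop := {
  as_indep : forall t e, A t e -> cross t e <> vzero;
  as_sym : forall t e, A t e -> A e t;
  as_disj : forall t e t' e' x, A t e -> A t' e' -> cint t e x -> cint t' e' x ->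
    (t = t' /\ e = e') \/ (t = e' /\ e = t')
}.

Definition next_lane (t e t' e' : vec3) : Prop := cint t' e' e /\ dot (cross e t) e' > 0.

(** Signs of [n] at [x + s w] for small [s > 0]. When the walk touches the strand at [x], only the
    direction of departure tells above from below. *)
Definition lexpos (n x w : vec3) : Prop := dot n x > 0 \/ (dot n x = 0 /\ dot n w > 0).
Definition lexneg (n x w : vec3) : Prop := dot n x < 0 \/ (dot n x = 0 /\ dot n w < 0).
Definition lexnonneg (n x w : vec3) : Prop := dot n x > 0 \/ (dot n x = 0 /\ dot n w >= 0).

Lemma lexpos_small n x w : lexpos n x w ->
  exists d, 0 < d /\ forall s, 0 < s < d -> dot n (lc 1 x s w) > 0.
Proof.
  intros [H|[H0 H]].
  - exists (dot n x / (Rabs (dot n w) + 1)). pose proof (Rabs_pos (dot n w)).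
    split; [apply Rdiv_lt_0_compat; lra|]. intros s [Hs1 Hs2]. rewrite dot_lc.
    apply (Rmult_lt_compat_r (Rabs (dot n w) + 1)) in Hs2; [|lra].
    unfold Rdiv in Hs2. rewrite Rmult_assoc, Rinv_l, Rmult_1_r in Hs2; [|lra].
    assert (- dot n w <= Rabs (dot n w)) by (rewrite <- Rabs_Ropp; apply Rle_abs). nra.
  - exists 1. split; [lra|]. intros s Hs. rewrite dot_lc, H0. nra.
Qed.

Lemma lexneg_small n x w : lexneg n x w ->
  exists d, 0 < d /\ forall s, 0 < s < d -> dot n (lc 1 x s w) < 0.
Proof.
  intros H. destruct (lexpos_small (vopp n) x w) as (d & Hd & Hs).
  - assert (E : forall v, dot (vopp n) v = - dot n v) by (intros; vring).
    unfold lexpos. rewrite !E. destruct H as [H|[H1 H2]]; [left|right]; lra.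
  - exists d. split; auto. intros s Hs'. specialize (Hs s Hs').
    replace (dot (vopp n) (lc 1 x s w)) with (- dot n (lc 1 x s w)) in Hs by vring. lra.
Qed.

Lemma lexnonneg_small n x w : lexnonneg n x w ->
  exists d, 0 < d /\ forall s, 0 < s < d -> dot n (lc 1 x s w) >= 0.
Proof.
  intros [H|[H0 H]].
  - destruct (lexpos_small n x w) as (d & Hd & Hs); [left; auto|].
    exists d. split; auto. intros s Hs'. specialize (Hs s Hs'). lra.
  - exists 1. split; [lra|]. intros s Hs. rewrite dot_lc, H0. nra.
Qed.

(* Seen from the axis [p], "east" is the direction of increasing longitude.  A strand is a cyclic
   sequence of eastbound lanes, each hitting the next; the part of lane [i] between [ez (i - 1)] and
   [ez i] is its [i]-th side, and the sides together form the graph of a function of longitude. *)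
Record strand (A : vec3 -> vec3 -> Prop) (p : vec3) (tz ez : Z -> vec3) (K : Z) : Prop := {
  st_pos : (0 < K)%Z;
  st_t : forall i, tz (i + K)%Z = tz i;
  st_e : forall i, ez (i + K)%Z = ez i;
  st_arc : forall i, A (tz i) (ez i);
  st_hit : forall i, cint (tz i) (ez i) (ez (i - 1)%Z);
  st_east : forall i, dot (cross (tz i) (ez i)) p > 0
}.

Arguments st_pos {A p tz ez K}.
Arguments st_t {A p tz ez K}.
Arguments st_e {A p tz ez K}.
Arguments st_arc {A p tz ez K}.
Arguments st_hit {A p tz ez K}.
Arguments st_east {A p tz ez K}.

(** [unorm] points towards [p], that is upwards, and [merid] points east. *)
Definition unorm (tz ez : Z -> vec3) (i : Z) : vec3 := cross (tz i) (ez i).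
Definition merid (p : vec3) (ez : Z -> vec3) (i : Z) : vec3 := cross p (ez i).

(* The germ at [x] in direction [w] runs strictly below side [i]. *)
Definition germ_below_side (p : vec3) (tz ez : Z -> vec3) (i : Z) (x w : vec3) : Prop :=
  lexnonneg (merid p ez (i - 1)) x w /\ lexneg (merid p ez i) x w /\ lexneg (unorm tz ez i) x w.

Definition germ_below (p : vec3) (tz ez : Z -> vec3) (x w : vec3) : Prop :=
  exists i, germ_below_side p tz ez i x w.

Lemma unorm_t tz ez i : dot (unorm tz ez i) (tz i) = 0.
Proof. apply dot_cross_l. Qed.
Lemma unorm_e tz ez i : dot (unorm tz ez i) (ez i) = 0.
Proof. apply dot_cross_r. Qed.
Lemma merid_p p ez i : dot (merid p ez i) p = 0.
Proof. apply dot_cross_l. Qed.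
Lemma merid_e p ez i : dot (merid p ez i) (ez i) = 0.
Proof. apply dot_cross_r. Qed.

Lemma st_hit_succ {A p tz ez K} i : strand A p tz ez K -> cint (tz (i + 1)%Z) (ez (i + 1)%Z) (ez i).
Proof. intros H. pose proof (st_hit H (i + 1)%Z) as H1. replace (i + 1 - 1)%Z with i in H1 by lia. auto. Qed.

Lemma unorm_entry {A p tz ez K} i : strand A p tz ez K -> dot (unorm tz ez i) (ez (i - 1)%Z) = 0.
Proof. intros H. apply (dot_cint_zero _ _ _ _ (unorm_t tz ez i) (unorm_e tz ez i) (st_hit H i)). Qed.

Lemma merid_t {A p tz ez K} i : strand A p tz ez K -> dot (merid p ez i) (tz i) < 0.
Proof.
  intros H. pose proof (st_east H i) as H1. unfold merid.
  replace (dot (cross p (ez i)) (tz i)) with (- dot (cross (tz i) (ez i)) p); [lra|].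
  vring.
Qed.

Lemma merid_entry {A p tz ez K} i : strand A p tz ez K -> dot (merid p ez i) (ez (i - 1)%Z) < 0.
Proof.
  intros H. destruct (st_hit H i) as (a & b & Ha & Hb & ->).
  rewrite dot_lc, merid_e. pose proof (merid_t i H). nra.
Qed.

Lemma merid_pred_end {A p tz ez K} i : strand A p tz ez K -> dot (merid p ez (i - 1)) (ez i) > 0.
Proof.
  intros H. pose proof (merid_entry i H) as H1. unfold merid in *.
  replace (dot (cross p (ez (i - 1)%Z)) (ez i)) with (- dot (cross p (ez i)) (ez (i - 1)%Z)); [lra|].
  vring.
Qed.

Lemma merid_pred_tail {A p tz ez K} i : strand A p tz ez K -> dot (merid p ez (i - 1)) (tz i) < 0.
Proof.
  intros H. pose proof (merid_t i H) as H1.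
  destruct (st_hit H i) as (a & b & Ha & Hb & E). unfold merid in *. rewrite E.
  replace (dot (cross p (lc a (tz i) b (ez i))) (tz i)) with (b * dot (cross p (ez i)) (tz i)); [nra|].
  vring.
Qed.

(** The western bound may be weak because the entry [ez (i - 1)] is itself interior to lane [i],
    whereas the end [ez i] is not. *)
Lemma side_cint A p tz ez K i y : strand A p tz ez K ->
  dot (merid p ez (i - 1)) y >= 0 -> dot (merid p ez i) y < 0 -> dot (unorm tz ez i) y = 0 ->
  cint (tz i) (ez i) y.
Proof.
  intros H H1 H2 H0. pose proof (st_east H i) as Hp.
  destruct (plane_decomposition (ez i) (tz i) y) as (m & l & ->); auto.
  { intros E. rewrite E in Hp. unfold dot, vzero in Hp; simpl in Hp. lra. }
  rewrite dot_lc, merid_e in H2. pose proof (merid_t i H) as H3.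
  assert (Hl : 0 < l) by nra.
  rewrite dot_lc in H1. pose proof (merid_pred_end i H). pose proof (merid_pred_tail i H).
  exists l, m. split; auto. split; [nra|]. veq.
Qed.

Lemma meridian_decomposition p v y : dot (cross p v) y = 0 -> cross p v <> vzero ->
  exists a b, y = lc a v b p.
Proof. intros H1 H2. apply plane_decomposition; auto. Qed.

Lemma merid_nonzero {A p tz ez K} i : strand A p tz ez K -> merid p ez i <> vzero.
Proof.
  intros H E. pose proof (merid_t i H) as H1. rewrite E in H1.
  unfold dot, vzero in H1; simpl in H1. lra.
Qed.

Lemma cross_zero_scale a x y : cross (vscale a x) y = vscale a (cross x y).
Proof. veq. Qed.

(** [ez i] is interior to the arc of lane [i + 1], so the turn leads onto that arc. Forwards it
    stays on the strand; backwards it heads for [tz (i + 1)], which a right turn off an eastbound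
    lane places below. *)
Lemma turn_from_strand A p tz ez K i t' e' : arc_system A -> strand A p tz ez K -> A t' e' ->
  next_lane (tz i) (ez i) t' e' ->
  germ_below p tz ez (ez i) e' \/ exists j, t' = tz j /\ e' = ez j.
Proof.
  intros HA H HA' [Hh Ht].
  pose proof (st_hit_succ i H) as Hh2.
  destruct (as_disj _ HA _ _ _ _ _ HA' (st_arc H (i + 1)%Z) Hh Hh2) as [[-> ->]|[-> ->]].
  - right. eauto.
  - left. exists i. split; [|split].
    + left. apply (merid_pred_end i H).
    + right. split; [apply merid_e|].
      pose proof (merid_pred_tail (i + 1)%Z H) as H1.
      replace (i + 1 - 1)%Z with i in H1 by lia. auto.
    + right. split; [apply unorm_e|]. unfold unorm.
      replace (dot (cross (tz i) (ez i)) (tz (i + 1)%Z)) with (- dot (cross (ez i) (tz i)) (tz (i + 1)%Z)); [lra|].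
      vring.
Qed.

Lemma turn_below A p tz ez K t e t' e' : arc_system A -> strand A p tz ez K -> A t' e' ->
  dot (cross p e) t <> 0 -> next_lane t e t' e' -> germ_below p tz ez e t ->
  germ_below p tz ez e e' \/ exists j, t' = tz j /\ e' = ez j.
Proof.
  intros HA H HA' Hgen [Hh Ht] (i & H1 & H2 & H3).
  assert (Hq1 : dot (merid p ez (i - 1)) e >= 0) by (destruct H1 as [|[]]; lra).
  assert (Hq2 : dot (merid p ez i) e <= 0) by (destruct H2 as [|[]]; lra).
  pose proof (st_east H i) as Hpi. fold (unorm tz ez i) in Hpi.
  assert (Hcol : forall b, e <> lc 0 (ez i) b p /\ e <> lc 0 (ez (i - 1)%Z) b p).
  { intros b; split; intros E; apply Hgen; rewrite E; [generalize (ez i)|generalize (ez (i - 1)%Z)];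
    clear; intros; vring. }
  assert (Heast : dot (merid p ez i) e = 0 ->
    exists a b, 0 < a /\ e = lc a (ez i) b p).
  { intros E0. destruct (meridian_decomposition p (ez i) e E0 (merid_nonzero i H)) as (a & b & E).
    exists a, b. split; auto. rewrite E, dot_lc, merid_p in Hq1.
    pose proof (merid_pred_end i H).
    assert (0 <= a) by nra. destruct (Req_dec a 0) as [->|]; [|lra]. exfalso. apply (proj1 (Hcol b)); auto. }
  destruct H3 as [H3|[H3 H3t]].
  - left.
    destruct (Rle_lt_or_eq_dec _ _ Hq2) as [Hq2'|Hq2'].
    + destruct (Rtotal_order (dot (merid p ez (i - 1)) e) 0) as [|[Hq1'|Hq1']]; [lra| |].
      * destruct (meridian_decomposition p (ez (i - 1)%Z) e Hq1' (merid_nonzero (i - 1)%Z H))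
          as (a & b & E).
        assert (Ha : 0 < a).
        { rewrite E, dot_lc, merid_p in Hq2'. pose proof (merid_entry i H). nra. }
        destruct (Rlt_le_dec (dot (merid p ez (i - 1)) e') 0) as [Hw|Hw].
        -- exists (i - 1)%Z. split; [|split].
           ++ left. rewrite E, dot_lc, merid_p. pose proof (merid_pred_end (i - 1)%Z H). nra.
           ++ right. auto.
           ++ left. rewrite E, dot_lc, (unorm_entry i H) in H3. rewrite E, dot_lc, unorm_e.
              pose proof (st_east H (i - 1)%Z) as Hp'. fold (unorm tz ez (i - 1)) in Hp'.
              assert (b < 0) by nra. nra.
        -- exists i. split; [|split]; [right; lra|left; auto|left; auto].
      * exists i. split; [|split]; left; auto.
    + destruct (Heast Hq2') as (a & b & Ha & E).
      assert (Hq1' : dot (merid p ez (i - 1)) e > 0).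
      { rewrite E, dot_lc, merid_p. pose proof (merid_pred_end i H). nra. }
      destruct (Rlt_le_dec (dot (merid p ez i) e') 0) as [Hw|Hw].
      * exists i. split; [|split]; [left|right|left]; auto.
      * exists (i + 1)%Z. replace (i + 1 - 1)%Z with i by lia.
        pose proof (merid_entry (i + 1)%Z H) as H4.
        pose proof (unorm_entry (i + 1)%Z H) as H5.
        pose proof (st_east H (i + 1)%Z) as Hp'. fold (unorm tz ez (i + 1)) in Hp'.
        replace (i + 1 - 1)%Z with i in H4, H5 by lia.
        unfold germ_below_side. replace (i + 1 - 1)%Z with i by lia.
        split; [|split].
        -- right. lra.
        -- left. rewrite E, dot_lc, merid_p. nra.
        -- left. rewrite E, dot_lc, unorm_e in H3. rewrite E, dot_lc, H5. assert (b < 0) by nra. nra.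
  - destruct (Rle_lt_or_eq_dec _ _ Hq2) as [Hq2'|Hq2'].
    + right. pose proof (side_cint _ _ _ _ _ i e H Hq1 Hq2' H3) as Hin.
      destruct (as_disj _ HA _ _ _ _ _ HA' (st_arc H i) Hh Hin) as [[-> ->]|[-> ->]]; [eauto|].
      exfalso. destruct Hin as (a & b & Ha & Hb & E). rewrite E in Ht.
      replace (dot (cross (lc a (tz i) b (ez i)) t) (tz i)) with (b * dot (unorm tz ez i) t) in Ht.
      { nra. }
      unfold unorm. vring.
    + destruct (Heast Hq2') as (a & b & Ha & E).
      assert (b = 0).
      { rewrite E, dot_lc, unorm_e in H3. nra. }
      subst b.
      assert (Ee : e = vscale a (ez i)) by (rewrite E; veq).
      pose proof (st_hit_succ i H) as Hh2.
      apply (cint_scale _ _ _ a Ha) in Hh2. rewrite <- Ee in Hh2.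
      destruct (as_disj _ HA _ _ _ _ _ HA' (st_arc H (i + 1)%Z) Hh Hh2) as [[-> ->]|[-> ->]]; [right; eauto|].
      left. exists i.
      pose proof (merid_pred_tail (i + 1)%Z H) as Hw. replace (i + 1 - 1)%Z with i in Hw by lia.
      split; [|split].
      * left. rewrite Ee, dot_vscale. pose proof (merid_pred_end i H). nra.
      * right. auto.
      * right. split; auto.
        assert (Hqt : dot (merid p ez i) t < 0) by (destruct H2 as [|[]]; lra).
        pose proof (merid_t i H) as Hqz.
        rewrite Ee, cross_zero_scale in Ht.
        replace (dot (vscale a (cross (ez i) t)) (tz (i + 1)%Z)) with (a * dot (cross (ez i) t) (tz (i + 1)%Z)) in Ht
          by (vring).
        assert (Ht' : 0 < dot (cross (ez i) t) (tz (i + 1)%Z)) by nra.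
        (* three-term relation between t, tz i and tz (i+1) in the tangent plane at ez i *)
        assert (Id : dot (merid p ez i) t * dot (unorm tz ez i) (tz (i + 1)%Z) =
          - dot (merid p ez i) (tz i) * dot (cross (ez i) t) (tz (i + 1)%Z) +
          dot (merid p ez i) (tz (i + 1)%Z) * dot (unorm tz ez i) t).
        { unfold merid, unorm. vring. }
        nra.
Qed.

(** * Following a lane below the strand *)

Lemma combination_pos a b x y : 0 <= a -> 0 <= b -> 0 < a + b -> 0 < x -> 0 < y -> 0 < a * x + b * y.
Proof.
  intros Ha Hb Hab Hx Hy. destruct (Req_dec a 0) as [->|].
  - nra.
  - assert (0 < a * x) by nra. nra.
Qed.

Lemma cint_between t e x y a b : cint t e x -> cint t e y -> 0 <= a -> 0 <= b -> 0 < a + b ->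
  cint t e (lc a x b y).
Proof.
  intros (a1 & b1 & Ha1 & Hb1 & ->) (a2 & b2 & Ha2 & Hb2 & ->) Ha Hb Hab.
  exists (a * a1 + b * a2), (a * b1 + b * b2).
  split; [apply combination_pos; auto|]. split; [apply combination_pos; auto|]. veq.
Qed.

Lemma not_side_arc A p tz ez K t e i x y : arc_system A -> strand A p tz ez K -> A t e ->
  cint t e x -> lexneg (unorm tz ez i) x e -> cint t e y -> ~ cint (tz i) (ez i) y.
Proof.
  intros HA H Hte Hx Hlex Hy Hy'.
  assert (dot (unorm tz ez i) t = 0 /\ dot (unorm tz ez i) e = 0) as [E1 E2].
  { destruct (as_disj _ HA _ _ _ _ _ Hte (st_arc H i) Hy Hy') as [[-> ->]|[-> ->]];
    split; auto using unorm_t, unorm_e. }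
  pose proof (dot_cint_zero _ _ _ _ E1 E2 Hx). destruct Hlex as [|[]]; lra.
Qed.

(* The germ stays strictly below the side it started under as long as it does not leave its range
   of longitudes: otherwise the two arcs would cross. *)
Lemma no_crossing A p tz ez K t e i x y : arc_system A -> strand A p tz ez K -> A t e ->
  cint t e x -> lexneg (unorm tz ez i) x e -> (cint t e y \/ y = e) ->
  dot (merid p ez (i - 1)) x >= 0 -> dot (merid p ez i) x <= 0 ->
  dot (merid p ez (i - 1)) y >= 0 -> dot (merid p ez i) y <= 0 ->
  dot (merid p ez i) x < 0 \/ dot (merid p ez i) y < 0 ->
  (exists a b, 0 <= a /\ 0 < b /\ y = lc a x b e) ->
  dot (unorm tz ez i) y <= 0.
Proof.
  intros HA H Hte Hx Hlex Hy Hx1 Hx2 Hy1 Hy2 Hs (a & b & Ha & Hb & Ey).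
  destruct (Rlt_le_dec 0 (dot (unorm tz ez i) y)) as [Hp|]; [exfalso|lra].
  assert (Hxn : dot (unorm tz ez i) x < 0).
  { destruct Hlex as [|[H0 H1]]; auto. rewrite Ey, dot_lc, H0 in Hp. nra. }
  set (u := lc (dot (unorm tz ez i) y) x (- dot (unorm tz ez i) x) y).
  assert (Hu : cint (tz i) (ez i) u).
  { apply (side_cint _ _ _ _ _ _ _ H); unfold u; rewrite dot_lc.
    - assert (0 <= dot (unorm tz ez i) y * dot (merid p ez (i - 1)) x) by nra.
      assert (0 <= - dot (unorm tz ez i) x * dot (merid p ez (i - 1)) y) by nra. lra.
    - assert (0 <= dot (unorm tz ez i) y * - dot (merid p ez i) x) by nra.
      assert (0 <= - dot (unorm tz ez i) x * - dot (merid p ez i) y) by nra.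
      destruct Hs.
      + assert (0 < dot (unorm tz ez i) y * - dot (merid p ez i) x) by nra. lra.
      + assert (0 < - dot (unorm tz ez i) x * - dot (merid p ez i) y) by nra. lra.
    - ring. }
  apply (not_side_arc _ _ _ _ _ _ _ _ _ u HA H Hte Hx Hlex); auto.
  unfold u. destruct Hy as [Hy|Hy].
  - apply cint_between; auto; lra.
  - destruct Hx as (a1 & b1 & Ha1 & Hb1 & ->). rewrite Hy in *.
    set (w := dot (unorm tz ez i) e) in *. set (v := dot (unorm tz ez i) (lc a1 t b1 e)) in *.
    exists (w * a1), (w * b1 + - v). split; [nra|]. split; [nra|]. veq.
Qed.

(** A linear functional that is negative just after [x] and not positive at [e] is negative just
    before [e]; this turns the germ leaving [x] into the germ looking back from [e]. *)
Lemma lexneg_end n t e x : cint t e x -> lexneg n x e -> dot n e <= 0 -> lexneg n e t.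
Proof.
  intros (a & b & Ha & Hb & ->) Hl He. rewrite ?dot_lc in *. unfold lexneg in *. rewrite dot_lc in Hl.
  destruct (Rle_lt_or_eq_dec _ _ He) as [|E]; [left; auto|].
  right. split; auto. rewrite E in Hl. destruct Hl as [Hl|[]]; nra.
Qed.

(** Three-term Plücker relation for [ez (i - 1)], [ez i], [x] and [e] in the plane obtained by
    projecting along [p]. It shows that a lane progressing in one direction of longitude cannot
    leave a side at the opposite end. *)
Lemma merid_plucker p ez i x e :
  dot (merid p ez (i - 1)) e * - dot (merid p ez i) x =
  dot (merid p ez (i - 1)) (ez i) * dot (cross p x) e +
  dot (merid p ez (i - 1)) x * - dot (merid p ez i) e.
Proof. unfold merid. vring. Qed.

Definition follow_result (p : vec3) (tz ez : Z -> vec3) (t e : vec3) : Prop :=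
  germ_below p tz ez e t \/ exists j, t = tz j /\ e = ez j.

(* [r / s] is the position along the lane. *)
Lemma follow_east_step A p tz ez K t e i s r : arc_system A -> strand A p tz ez K -> A t e ->
  dot (cross p t) e > 0 -> 0 < s -> 0 < r -> germ_below_side p tz ez i (lc s t r e) e ->
  follow_result p tz ez t e \/
  exists s' r', 0 < s' /\ 0 < r' /\ r * s' < r' * s /\
    dot (merid p ez i) (lc s' t r' e) = 0 /\ dot (merid p ez i) e > 0 /\
    germ_below_side p tz ez (i + 1) (lc s' t r' e) e.
Proof.
  intros HA H Hte Hg Hs Hr (H1 & H2 & H3). set (x := lc s t r e) in *.
  assert (Hx : cint t e x) by (exists s, r; auto).
  assert (Hxe : dot (cross p x) e > 0).
  { unfold x. replace (dot (cross p (lc s t r e)) e) with (s * dot (cross p t) e) by vring. nra. }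
  assert (Hx1 : dot (merid p ez (i - 1)) x >= 0) by (destruct H1 as [|[]]; lra).
  assert (Hx2 : dot (merid p ez i) x <= 0) by (destruct H2 as [|[]]; lra).
  pose proof (merid_pred_end i H) as HV.
  destruct (Rle_lt_dec (dot (merid p ez i) e) 0) as [He|He].
  - left. left. exists i.
    pose proof (merid_plucker p ez i x e) as Pl.
    assert (He1 : dot (merid p ez (i - 1)) e > 0).
    { assert (0 < dot (merid p ez (i - 1)) (ez i) * dot (cross p x) e) by nra.
      assert (0 <= dot (merid p ez (i - 1)) x * - dot (merid p ez i) e) by nra. nra. }
    split; [left; auto|]. split; [apply (lexneg_end _ _ _ x); auto|].
    apply (lexneg_end _ _ _ x); auto.
    apply (no_crossing _ _ _ _ _ t e i x e HA H Hte Hx); auto; try lra.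
    + destruct H2 as [|[]]; auto.
    + exists 0, 1. split; [lra|]. split; [lra|]. veq.
  - assert (Hx2' : dot (merid p ez i) x < 0) by (destruct H2 as [|[]]; lra).
    set (qe := dot (merid p ez i) e) in *. set (qx := - dot (merid p ez i) x).
    assert (Hqx : 0 < qx) by (unfold qx; lra).
    (* The point where the lane crosses the meridian of [ez i], the eastern end of the side. *)
    set (y := lc qe x qx e).
    assert (Ey : y = lc (qe * s) t (qe * r + qx) e).
    { unfold y, x. veq. }
    assert (Hy : cint t e y) by (rewrite Ey; exists (qe * s), (qe * r + qx); repeat split; nra).
    assert (Hy0 : dot (merid p ez i) y = 0) by (unfold y; rewrite dot_lc; fold qe; unfold qx; ring).
    destruct (meridian_decomposition p (ez i) y Hy0 (merid_nonzero i H)) as (a & b & Eab).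
    assert (Ha : 0 < a).
    { assert (Hxy : dot (cross p x) y = qx * dot (cross p x) e) by (unfold y; vring).
      rewrite Eab in Hxy.
      replace (dot (cross p x) (lc a (ez i) b p)) with (a * qx) in Hxy.
      - nra.
      - unfold qx, merid. vring. }
    assert (Hy1 : dot (merid p ez (i - 1)) y > 0) by (rewrite Eab, dot_lc, merid_p; nra).
    assert (Hmy : dot (unorm tz ez i) y <= 0).
    { apply (no_crossing _ _ _ _ _ t e i x y HA H Hte Hx); auto; try lra.
      exists qe, qx. repeat split; lra. }
    pose proof (st_east H i) as Hpi. fold (unorm tz ez i) in Hpi.
    rewrite Eab, dot_lc, unorm_e in Hmy.
    pose proof (st_hit_succ i H) as Hh.
    (* For [b = 0] the lane passes through [ez i], a point interior to lane [i + 1]; both being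
       eastbound, it is that lane. *)
    destruct (Req_dec b 0) as [->|Hb].
    + left. right. exists (i + 1)%Z.
      assert (Hh' : cint (tz (i + 1)%Z) (ez (i + 1)%Z) y).
      { rewrite Eab. replace (lc a (ez i) 0 p) with (vscale a (ez i)); [apply cint_scale; auto|].
        veq. }
      destruct (as_disj _ HA _ _ _ _ _ Hte (st_arc H (i + 1)%Z) Hy Hh') as [|[E1 E2]]; auto.
      exfalso. pose proof (st_east H (i + 1)%Z) as Hp'. rewrite E1, E2 in Hg.
      replace (dot (cross p (ez (i + 1)%Z)) (tz (i + 1)%Z)) with
        (- dot (cross (tz (i + 1)%Z) (ez (i + 1)%Z)) p) in Hg; [lra|].
      vring.
    + assert (Hb' : b < 0) by nra.
      right. exists (qe * s), (qe * r + qx). rewrite <- Ey.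
      split; [nra|]. split; [nra|]. split; [nra|]. split; auto. split; [auto|].
      unfold germ_below_side. replace (i + 1 - 1)%Z with i by lia.
      pose proof (merid_entry (i + 1)%Z H) as H4.
      pose proof (unorm_entry (i + 1)%Z H) as H5.
      pose proof (st_east H (i + 1)%Z) as Hp'. fold (unorm tz ez (i + 1)) in Hp'.
      replace (i + 1 - 1)%Z with i in H4, H5 by lia.
      split; [right; unfold qe in He; split; [auto|lra]|].
      split; left; rewrite Eab, dot_lc; [rewrite merid_p|rewrite H5]; nra.
Qed.

Lemma follow_west_step A p tz ez K t e i s r : arc_system A -> strand A p tz ez K -> A t e ->
  dot (cross p t) e < 0 -> 0 < s -> 0 < r -> germ_below_side p tz ez i (lc s t r e) e ->
  follow_result p tz ez t e \/
  exists s' r', 0 < s' /\ 0 < r' /\ r * s' < r' * s /\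
    dot (merid p ez (i - 1)) (lc s' t r' e) = 0 /\ dot (merid p ez (i - 1)) e < 0 /\
    germ_below_side p tz ez (i - 1) (lc s' t r' e) e.
Proof.
  intros HA H Hte Hg Hs Hr (H1 & H2 & H3). set (x := lc s t r e) in *.
  assert (Hx : cint t e x) by (exists s, r; auto).
  assert (Hxe : dot (cross p x) e < 0).
  { unfold x. replace (dot (cross p (lc s t r e)) e) with (s * dot (cross p t) e) by vring. nra. }
  assert (Hx1 : dot (merid p ez (i - 1)) x >= 0) by (destruct H1 as [|[]]; lra).
  assert (Hx2 : dot (merid p ez i) x <= 0) by (destruct H2 as [|[]]; lra).
  pose proof (merid_pred_end i H) as HV.
  pose proof (merid_plucker p ez i x e) as Pl.
  destruct (Rle_lt_dec 0 (dot (merid p ez (i - 1)) e)) as [He|He].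
  - left. left. exists i.
    assert (He2 : dot (merid p ez i) e < 0).
    { assert (0 < dot (merid p ez (i - 1)) (ez i) * - dot (cross p x) e) by nra.
      assert (0 <= dot (merid p ez (i - 1)) e * - dot (merid p ez i) x) by nra. nra. }
    split; [|split; [left; auto|]].
    + destruct (Rle_lt_or_eq_dec _ _ He) as [|E0]; [left; auto|right]. symmetry in E0. split; auto.
      unfold x in Hx1. rewrite dot_lc, E0 in Hx1. nra.
    + apply (lexneg_end _ _ _ x); auto.
      apply (no_crossing _ _ _ _ _ t e i x e HA H Hte Hx); auto; try lra.
      exists 0, 1. split; [lra|]. split; [lra|]. veq.
  - assert (Hx1' : dot (merid p ez (i - 1)) x > 0) by (destruct H1 as [|[]]; lra).
    set (qe := - dot (merid p ez (i - 1)) e). set (qx := dot (merid p ez (i - 1)) x) in *.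
    assert (Hqe : 0 < qe) by (unfold qe; lra).
    set (y := lc qe x qx e).
    assert (Ey : y = lc (qe * s) t (qe * r + qx) e).
    { unfold y. clearbody qe qx. unfold x. veq. }
    assert (Hy : cint t e y) by (rewrite Ey; exists (qe * s), (qe * r + qx); repeat split; nra).
    assert (Hy0 : dot (merid p ez (i - 1)) y = 0) by (unfold y; rewrite dot_lc; fold qx; unfold qe; ring).
    destruct (meridian_decomposition p (ez (i - 1)%Z) y Hy0 (merid_nonzero (i - 1)%Z H)) as (a & b & Eab).
    assert (Ha : 0 < a).
    { assert (Hxy : dot (cross p y) x = qx * - dot (cross p x) e).
      { unfold y. vring. }
      rewrite Eab in Hxy.
      replace (dot (cross p (lc a (ez (i - 1)%Z) b p)) x) with (a * qx) in Hxy.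
      - assert (0 < qx) by lra. assert (0 < qx * - dot (cross p x) e) by nra. nra.
      - unfold qx, merid. vring. }
    pose proof (merid_entry i H) as Hent.
    assert (Hy2 : dot (merid p ez i) y < 0) by (rewrite Eab, dot_lc, merid_p; nra).
    assert (Hmy : dot (unorm tz ez i) y <= 0).
    { apply (no_crossing _ _ _ _ _ t e i x y HA H Hte Hx); auto; try lra.
      exists qe, qx. repeat split; lra. }
    pose proof (st_east H i) as Hpi. fold (unorm tz ez i) in Hpi.
    rewrite Eab, dot_lc, (unorm_entry i H) in Hmy.
    (* For [b = 0] the lane passes through the entry of side [i], a point interior to the arc of
       that side, against the strictness of the germ. *)
    destruct (Req_dec b 0) as [->|Hb].
    + exfalso. apply (not_side_arc _ _ _ _ _ t e i x y HA H Hte Hx H3 Hy).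
      rewrite Eab. replace (lc a (ez (i - 1)%Z) 0 p) with (vscale a (ez (i - 1)%Z)).
      * apply cint_scale; auto. apply (st_hit H).
      * veq.
    + assert (Hb' : b < 0) by nra.
      right. exists (qe * s), (qe * r + qx). rewrite <- Ey.
      split; [nra|]. split; [nra|]. split; [nra|]. split; auto. split; [unfold qe in Hqe; lra|].
      pose proof (st_east H (i - 1)%Z) as Hp'. fold (unorm tz ez (i - 1)) in Hp'.
      split; [|split].
      * left. rewrite Eab, dot_lc, merid_p. pose proof (merid_pred_end (i - 1)%Z H). nra.
      * right. split; auto.
      * left. rewrite Eab, dot_lc, unorm_e. nra.
Qed.

(* The position along the lane increases at every side, so a lane cannot pass all sides of the strand. *)
Lemma follow_sides (Q : Prop) (B : Z -> R -> R -> Prop) (v : Z -> vec3) (t e : vec3) (dl K : Z) :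
  (0 < K)%Z -> (forall i, v (i + dl * K)%Z = v i) ->
  (forall i s r, 0 < s -> 0 < r -> B i s r -> Q \/
    exists s' r', 0 < s' /\ 0 < r' /\ r * s' < r' * s /\
      dot (v i) (lc s' t r' e) = 0 /\ dot (v i) e <> 0 /\ B (i + dl)%Z s' r') ->
  forall i s r, 0 < s -> 0 < r -> B i s r -> Q.
Proof.
  intros HK Hv Hstep.
  assert (F : forall n : nat, forall i s r, 0 < s -> 0 < r -> B i s r -> Q \/
    exists s' r', 0 < s' /\ 0 < r' /\ r * s' < r' * s /\
      dot (v (i + dl * Z.of_nat n)%Z) (lc s' t r' e) = 0 /\ B (i + dl * Z.of_nat n + dl)%Z s' r').
  { induction n as [|n IH]; intros i s r Hs Hr HB.
    - replace (i + dl * Z.of_nat 0)%Z with i by lia.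
      destruct (Hstep i s r Hs Hr HB) as [|(s' & r' & Hs' & Hr' & Hlt & H0 & _ & HB')]; auto.
      right. exists s', r'. auto 6.
    - destruct (IH i s r Hs Hr HB) as [|(s' & r' & Hs' & Hr' & Hlt & H0 & HB')]; auto.
      destruct (Hstep _ s' r' Hs' Hr' HB') as [|(s2 & r2 & Hs2 & Hr2 & Hlt2 & H02 & _ & HB2)]; auto.
      right. exists s2, r2. replace (i + dl * Z.of_nat (S n))%Z with (i + dl * Z.of_nat n + dl)%Z by lia.
      repeat split; auto.
      assert (r * s' * s2 < r' * s * s2) by nra.
      assert (r' * s2 * s < r2 * s' * s) by nra. nra. }
  intros i s r Hs Hr HB.
  destruct (Hstep i s r Hs Hr HB) as [|(s1 & r1 & Hs1 & Hr1 & _ & H1 & He & HB1)]; auto.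
  destruct (F (Z.to_nat (K - 1)) _ _ _ Hs1 Hr1 HB1) as [|(s2 & r2 & Hs2 & Hr2 & Hlt & H2 & _)]; auto.
  exfalso. rewrite Z2Nat.id in H2 by lia. replace (i + dl + dl * (K - 1))%Z with (i + dl * K)%Z in H2 by ring.
  rewrite Hv in H2. rewrite dot_lc in H1, H2.
  assert (E : (r2 * s1 - r1 * s2) * dot (v i) e = (s2 * dot (v i) t + r2 * dot (v i) e) * s1
    - (s1 * dot (v i) t + r1 * dot (v i) e) * s2) by ring.
  rewrite H1, H2 in E. replace (0 * s1 - 0 * s2) with 0 in E by ring.
  apply Rmult_integral in E. destruct E; [nra|contradiction].
Qed.

Lemma follow_east A p tz ez K t e i s r : arc_system A -> strand A p tz ez K -> A t e ->
  dot (cross p t) e > 0 -> 0 < s -> 0 < r -> germ_below_side p tz ez i (lc s t r e) e ->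
  follow_result p tz ez t e.
Proof.
  intros HA H Hte Hg. revert i s r.
  apply (follow_sides _ (fun i s r => germ_below_side p tz ez i (lc s t r e) e) (merid p ez) t e 1 K (st_pos H)).
  - intros i. unfold merid. rewrite Z.mul_1_l, (st_e H). auto.
  - intros i s r Hs Hr HB.
    destruct (follow_east_step _ _ _ _ _ t e i s r HA H Hte Hg Hs Hr HB) as [|(s' & r' & P1 & P2 & P3 & P4 & P5 & P6)]; auto.
    right. exists s', r'. repeat split; auto; try apply P6; lra.
Qed.

Lemma follow_west A p tz ez K t e i s r : arc_system A -> strand A p tz ez K -> A t e ->
  dot (cross p t) e < 0 -> 0 < s -> 0 < r -> germ_below_side p tz ez i (lc s t r e) e ->
  follow_result p tz ez t e.
Proof.
  intros HA H Hte Hg. revert i s r.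
  apply (follow_sides _ (fun i s r => germ_below_side p tz ez i (lc s t r e) e)
    (fun i => merid p ez (i - 1)) t e (-1) K (st_pos H)).
  - intros i. unfold merid. rewrite <- (st_e H). do 2 f_equal. ring.
  - intros i s r Hs Hr HB.
    destruct (follow_west_step _ _ _ _ _ t e i s r HA H Hte Hg Hs Hr HB) as [|(s' & r' & P1 & P2 & P3 & P4 & P5 & P6)]; auto.
    right. exists s', r'. repeat split; auto; try apply P6; lra.
Qed.

(* The invariant of the right-turning walk below a strand. *)
Definition under_strand (p : vec3) (tz ez : Z -> vec3) (q t e : vec3) : Prop :=
  germ_below p tz ez q e \/ exists j, t = tz j /\ e = ez j.

(** Two halves: along the lane, from the germ at [q] pointing forwards to the germ at [e] pointing
    back, then around the hit at [e]. General position of [p] excludes lanes running along a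
    meridian. *)
Lemma under_strand_step A p tz ez K q t e t' e' : arc_system A -> strand A p tz ez K ->
  (forall t e, A t e -> dot (cross p t) e <> 0) -> A t e -> A t' e' ->
  cint t e q -> next_lane t e t' e' ->
  under_strand p tz ez q t e -> under_strand p tz ez e t' e'.
Proof.
  intros HA H Hgen Hte Hte' Hq Hn HI.
  assert (Hf : follow_result p tz ez t e).
  { destruct HI as [(i & HB)|HI]; [|right; auto].
    destruct Hq as (s & r & Hs & Hr & ->).
    destruct (Rtotal_order (dot (cross p t) e) 0) as [Hlt|[H0|Hgt]].
    - apply (follow_west _ _ _ _ _ t e i s r HA H); auto.
    - exfalso. apply (Hgen _ _ Hte H0).
    - apply (follow_east _ _ _ _ _ t e i s r HA H); auto. }
  destruct Hf as [Hf|(j & -> & ->)].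
  - apply (turn_below A p tz ez K t e t' e' HA H Hte'); auto.
    apply Hgen, (as_sym _ HA), Hte.
  - apply (turn_from_strand A p tz ez K j t' e' HA H Hte' Hn).
Qed.

(** * Arcs avoiding the eye *)

Definition in_eye (t e : Z -> vec3) (x : vec3) : Prop := forall s, dot (rnormal t e s) x > 0.

Definition avoids_eye (t e : Z -> vec3) (a b : vec3) : Prop :=
  forall al be, 0 <= al -> 0 <= be -> ~ in_eye t e (lc al a be b).

Lemma rnormal_period t e k s : right_turning t e k ->
  rnormal t e s = rnormal t e (s mod k).
Proof.
  intros H. pose proof (rt_pos H).
  destruct (right_turning_period _ _ _ (s mod k)%Z (s / k) H) as [E1 E2].
  replace (s mod k + s / k * k)%Z with s in E1, E2 by (pose proof (Z.div_mod s k ltac:(lia)); lia).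
  unfold rnormal. rewrite E1, E2. auto.
Qed.

(* An arc entering the open eye cannot leave it, since the sides of the eye are covered by arcs. *)
Lemma avoids_eye_step A t e k a b a' b' : arc_system A -> right_turning t e k ->
  (forall s, A (t s) (e s)) -> A a' b' -> cint a' b' b -> avoids_eye t e a b -> avoids_eye t e a' b'.
Proof.
  intros HA H HS Hab' Hb Hav al be Hal Hbe Hy.
  pose proof (rt_pos H) as Hk.
  set (y := lc al a' be b') in *.
  assert (Hbn : ~ in_eye t e b).
  { intros Hi. apply (Hav 0 1); [lra|lra|]. replace (lc 0 a 1 b) with b by (veq). auto. }
  destruct (first_crossing (rnormal t e) 0%Z (k - 1)%Z y b) as
    [Hall | (c1 & c2 & Hc1 & Hc2 & Hall & c & Hc & Hc0)].
  - intros c _. apply Hy.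
  - apply Hbn. intros s. rewrite (rnormal_period _ _ _ s H). apply Hall.
    pose proof (Z.mod_pos_bound s k Hk). lia.
  - set (u := lc c1 y c2 b) in *.
    assert (Hall' : forall s, dot (rnormal t e s) u >= 0).
    { intros s. rewrite (rnormal_period _ _ _ s H). apply Hall.
      pose proof (Z.mod_pos_bound s k Hk). lia. }
    assert (Hu : cint a' b' u).
    { destruct Hb as (b1 & b2 & Hb1 & Hb2 & E).
      exists (c1 * al + c2 * b1), (c1 * be + c2 * b2). split; [nra|]. split; [nra|].
      unfold u, y. rewrite E. veq. }
    pose proof (cint_indep_nonzero _ _ _ (as_indep _ HA _ _ Hab') Hu) as Hunz.
    assert (exists s, cint (t s) (e s) u) as (s & Hs).
    { destruct (right_turning_side _ _ _ c u H Hc0) as [|(m & Hm & Eu)]; auto; eauto.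
      exists (c + 1)%Z. rewrite Eu. apply cint_scale; auto. apply (rt_hit_succ c H). }
    assert (dot (rnormal t e s) a' = 0 /\ dot (rnormal t e s) b' = 0) as [E1 E2].
    { destruct (as_disj _ HA _ _ _ _ _ Hab' (HS s) Hu Hs) as [[-> ->]|[-> ->]];
      split; auto using rnormal_t, rnormal_e. }
    specialize (Hy s). unfold y in Hy. rewrite dot_lc, E1, E2 in Hy. lra.
Qed.

(* Points of the lanes of the swirl have nothing but the open eye above them. *)
Lemma eye_lane_not_under A p t e k tz ez K s : right_turning t e k -> in_eye t e p ->
  strand A p tz ez K -> (forall i, avoids_eye t e (tz i) (ez i)) ->
  ~ under_strand p tz ez (e (s - 1)%Z) (t s) (e s).
Proof.
  intros H Hp Hst Hav [(i & H1 & H2 & H3)|(j & E1 & E2)].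
  - destruct (lexnonneg_small _ _ _ H1) as (d1 & Hd1 & P1).
    destruct (lexneg_small _ _ _ H2) as (d2 & Hd2 & P2).
    destruct (lexneg_small _ _ _ H3) as (d3 & Hd3 & P3).
    set (d := Rmin d1 (Rmin d2 d3) / 2).
    assert (Hd : 0 < d /\ d < d1 /\ d < d2 /\ d < d3).
    { pose proof (Rmin_l d1 (Rmin d2 d3)). pose proof (Rmin_r d1 (Rmin d2 d3)).
      pose proof (Rmin_l d2 d3). pose proof (Rmin_r d2 d3).
      assert (0 < Rmin d1 (Rmin d2 d3)) by (repeat apply Rmin_glb_lt; auto).
      unfold d. lra. }
    specialize (P1 d ltac:(lra)). specialize (P2 d ltac:(lra)). specialize (P3 d ltac:(lra)).
    set (x := lc 1 (e (s - 1)%Z) d (e s)) in *.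
    pose proof (st_east Hst i) as Hpi. fold (unorm tz ez i) in Hpi.
    (* Straight up from [x] the side is met at [x + l p]. This point is in the open eye, because [p]
       is and [x] is weakly right of all lanes. *)
    set (l := - dot (unorm tz ez i) x / dot (unorm tz ez i) p).
    assert (Hl : 0 < l) by (apply Rdiv_lt_0_compat; lra).
    assert (Hz : cint (tz i) (ez i) (lc 1 x l p)).
    { apply (side_cint _ _ _ _ _ _ _ Hst); rewrite dot_lc, ?merid_p.
      - lra.
      - lra.
      - unfold l. field. lra. }
    destruct Hz as (a & b & Ha & Hb & E).
    apply (Hav i a b); [lra|lra|]. rewrite <- E. intros r. rewrite dot_lc.
    assert (dot (rnormal t e r) x >= 0).
    { unfold x. rewrite dot_lc.
      pose proof (right_turning_convex _ _ _ r (s - 1)%Z H). pose proof (right_turning_convex _ _ _ r s H). nra. }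
    specialize (Hp r). nra.
  - pose proof (st_east Hst j) as Hj. specialize (Hp s). unfold rnormal in Hp.
    rewrite E1, E2 in Hp.
    replace (dot (cross (ez j) (tz j)) p) with (- dot (cross (tz j) (ez j)) p) in Hp; [lra|].
    vring.
Qed.

(** * Lanes of a diagram *)

Definition normalize (x : vec3) : vec3 := vscale (/ sqrt (dot x x)) x.

Lemma sqrt_norm_pos x : x <> vzero -> 0 < / sqrt (dot x x).
Proof. intros H. apply Rinv_0_lt_compat, sqrt_lt_R0, dot_self_pos, H. Qed.

Lemma normalize_on_sphere x : x <> vzero -> on_sphere (normalize x).
Proof.
  intros H. pose proof (dot_self_pos _ H) as Hp. pose proof (sqrt_lt_R0 _ Hp) as Hs.
  unfold on_sphere, normalize.
  replace (dot (vscale (/ sqrt (dot x x)) x) (vscale (/ sqrt (dot x x)) x))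
    with (/ sqrt (dot x x) * / sqrt (dot x x) * dot x x).
  - rewrite <- (sqrt_sqrt (dot x x)) at 3 by lra. field. lra.
  - vring.
Qed.

Lemma in_relint_cint x B : in_relint x B -> cint (a_u B) (a_v B) x.
Proof. intros [_ H]. exact H. Qed.

(** By Lagrange's identity the squared length of the cross product is [1 - (u.v)^2], so dependence
    forces [u.v = 1] or [u.v = -1], that is equal or antipodal endpoints. *)
Lemma arc_valid_indep B : arc_valid B -> cross (a_u B) (a_v B) <> vzero.
Proof.
  intros (Hu & Hv & Hne & Hna) E. destruct B as [u v]; simpl in *. unfold on_sphere in *.
  assert (Hd : dot u v * dot u v = 1).
  { assert (dot (cross u v) (cross u v) = dot u u * dot v v - dot u v * dot u v) by vring.
    rewrite E, Hu, Hv in H. unfold dot at 1, vzero in H; simpl in H. lra. }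
  assert (dot u v = 1 \/ dot u v = -1) as [H|H] by (destruct (Rle_dec 0 (dot u v)); [left|right]; nra).
  - apply Hne. assert (Hz : lc 1 u (-1) v = vzero).
    { apply NNPP. intros Hn. apply dot_self_pos in Hn.
      replace (dot (lc 1 u (-1) v) (lc 1 u (-1) v)) with (dot u u + dot v v - 2 * dot u v) in Hn by vring. lra. }
    destruct u, v; vsimp. injection Hz. intros. f_equal; lra.
  - apply Hna. assert (Hz : lc 1 u 1 v = vzero).
    { apply NNPP. intros Hn. apply dot_self_pos in Hn.
      replace (dot (lc 1 u 1 v) (lc 1 u 1 v)) with (dot u u + dot v v + 2 * dot u v) in Hn by vring. lra. }
    destruct u, v; vsimp. injection Hz. intros. f_equal; lra.
Qed.

Definition lane := (nat * bool)%type.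
Definition lend (D : list arc) (l : lane) : vec3 :=
  if snd l then a_v (arcD D (fst l)) else a_u (arcD D (fst l)).
Definition ltail (D : list arc) (l : lane) : vec3 := lend D (fst l, negb (snd l)).
Definition lane_of (D : list arc) (l : lane) : Prop := (fst l < length D)%nat.
Definition lane_vecs (D : list arc) (t e : vec3) : Prop :=
  exists l, lane_of D l /\ t = ltail D l /\ e = lend D l.
Definition arc_cint (D : list arc) (i : nat) (x : vec3) : Prop :=
  cint (a_u (arcD D i)) (a_v (arcD D i)) x.

Lemma lane_cint D l x : cint (ltail D l) (lend D l) x <-> arc_cint D (fst l) x.
Proof.
  destruct l as [i []]; unfold ltail, lend, arc_cint; simpl; split; intros H; auto using cint_sym.
Qed.

Lemma lane_vecs_intro D l : lane_of D l -> lane_vecs D (ltail D l) (lend D l).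
Proof. exists l. auto. Qed.

Lemma sd_arc_valid D i : is_SD D -> (i < length D)%nat -> arc_valid (arcD D i).
Proof. intros (_ & H & _) Hi. apply H, nth_In, Hi. Qed.

Lemma sd_lane_indep D l : is_SD D -> lane_of D l -> cross (ltail D l) (lend D l) <> vzero.
Proof.
  intros H Hl. pose proof (arc_valid_indep _ (sd_arc_valid _ _ H Hl)) as Hi.
  destruct l as [i []]; unfold ltail, lend; simpl in *; auto.
  intros E. apply Hi.
  replace (cross (a_u (arcD D i)) (a_v (arcD D i))) with (vscale (-1) (cross (a_v (arcD D i)) (a_u (arcD D i)))) by (clear; destruct (arcD D i); simpl; veq).
  rewrite E. unfold vscale, vzero; simpl. f_equal; ring.
Qed.

Lemma sd_cint_disjoint D i j x : is_SD D -> (i < length D)%nat -> (j < length D)%nat ->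
  arc_cint D i x -> arc_cint D j x -> i = j.
Proof.
  intros H Hi Hj H1 H2. destruct (Nat.eq_dec i j) as [|Hn]; auto. exfalso.
  destruct H as (H0 & Hv & Hd & Hr). apply (Hd i j Hi Hj Hn).
  assert (Hx : x <> vzero).
  { apply (cint_indep_nonzero _ _ _ (arc_valid_indep _ (sd_arc_valid D i (conj H0 (conj Hv (conj Hd Hr))) Hi)) H1). }
  exists (normalize x). pose proof (sqrt_norm_pos _ Hx).
  split; (split; [apply normalize_on_sphere; auto|]); apply cint_scale; auto.
Qed.

Lemma sd_hit D l : is_SD D -> lane_of D l -> exists j, (j < length D)%nat /\ arc_cint D j (lend D l).
Proof.
  intros (_ & _ & _ & Hr) Hl.
  destruct (Hr (arcD D (fst l)) (lend D l) (ltail D l)) as (B & HB & He).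
  - apply nth_In, Hl.
  - destruct l as [i []]; unfold ends, ltail, lend; simpl; auto.
  - destruct (In_nth _ _ (Arc vzero vzero) HB) as (j & Hj & Ej).
    exists j. split; auto. unfold arc_cint, arcD. rewrite Ej. apply in_relint_cint; auto.
Qed.

Lemma end_not_in_cint t e : cross t e <> vzero -> ~ cint t e e.
Proof.
  intros Hi (a & b & Ha & Hb & E). apply Hi.
  assert (E2 : cross t e = vscale (/ a) (cross (lc a t b e) e)).
  { clear E. destruct t, e; vsimp. f_equal; field; lra. }
  rewrite <- E in E2. rewrite E2. destruct e; vsimp. f_equal; ring.
Qed.

Lemma sd_end_not_own D l : is_SD D -> lane_of D l -> ~ arc_cint D (fst l) (lend D l).
Proof.
  intros H Hl Hc. apply lane_cint in Hc. apply (end_not_in_cint _ _ (sd_lane_indep _ _ H Hl) Hc).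
Qed.

(* An arc ending inside another arc is transversal to it, for otherwise the two would overlap. *)
Lemma sd_transversal D l j : is_SD D -> lane_of D l -> (j < length D)%nat -> arc_cint D j (lend D l) ->
  dot (cross (a_u (arcD D j)) (a_v (arcD D j))) (ltail D l) <> 0.
Proof.
  intros H Hl Hj Hc H0.
  assert (Hij : fst l <> j) by (intros E; apply (sd_end_not_own D l H Hl); rewrite E; auto).
  set (u := a_u (arcD D j)) in *. set (v := a_v (arcD D j)) in *.
  destruct (plane_decomposition v u (ltail D l)) as (m & k & Et); auto.
  { apply (arc_valid_indep _ (sd_arc_valid _ _ H Hj)). }
  destruct Hc as (a & b & Ha & Hb & Ee). fold u v in Ee.
  (* Small enough for [s t + e], a point inside the arc of [l], to have positive coordinates with
     respect to [u] and [v], hence to lie inside arc [j] too. *)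
  set (s := Rmin (a / (Rabs k + 1)) (b / (Rabs m + 1)) / 2).
  pose proof (Rabs_pos k). pose proof (Rabs_pos m).
  assert (Hs : 0 < s /\ s * (Rabs k + 1) < a /\ s * (Rabs m + 1) < b).
  { assert (0 < a / (Rabs k + 1)) by (apply Rdiv_lt_0_compat; lra).
    assert (0 < b / (Rabs m + 1)) by (apply Rdiv_lt_0_compat; lra).
    assert (0 < Rmin (a / (Rabs k + 1)) (b / (Rabs m + 1))) by (apply Rmin_glb_lt; auto).
    pose proof (Rmin_l (a / (Rabs k + 1)) (b / (Rabs m + 1))).
    pose proof (Rmin_r (a / (Rabs k + 1)) (b / (Rabs m + 1))).
    assert (E1 : a / (Rabs k + 1) * (Rabs k + 1) = a) by (field; lra).
    assert (E2 : b / (Rabs m + 1) * (Rabs m + 1) = b) by (field; lra).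
    unfold s. split; [lra|]. split; nra. }
  destruct Hs as (Hs & Hsk & Hsm).
  assert (- Rabs k <= k) by (pose proof (Rle_abs (- k)); rewrite Rabs_Ropp in *; lra).
  assert (- Rabs m <= m) by (pose proof (Rle_abs (- m)); rewrite Rabs_Ropp in *; lra).
  apply Hij. apply (sd_cint_disjoint D (fst l) j (lc s (ltail D l) 1 (lend D l)) H Hl Hj).
  - apply lane_cint. exists s, 1. repeat split; auto; lra.
  - exists (a + s * k), (b + s * m). split; [nra|]. split; [nra|].
    fold u v. rewrite Et, Ee. veq.
Qed.

Lemma sd_next_lane D l : is_SD D -> lane_of D l ->
  exists l', lane_of D l' /\ next_lane (ltail D l) (lend D l) (ltail D l') (lend D l').
Proof.
  intros H Hl. destruct (sd_hit D l H Hl) as (j & Hj & Hc).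
  pose proof (sd_transversal D l j H Hl Hj Hc) as Ht.
  assert (G : forall b, cint (ltail D (j, b)) (lend D (j, b)) (lend D l)) by (intros b; apply lane_cint; auto).
  unfold next_lane.
  destruct Hc as (a & b & Ha & Hb & Ee).
  set (u := a_u (arcD D j)) in *. set (v := a_v (arcD D j)) in *.
  destruct (Rtotal_order (dot (cross u v) (ltail D l)) 0) as [Hlt|[|Hgt]]; [|contradiction|].
  - exists (j, true). split; [auto|]. split; [auto|].
    change (lend D (j, true)) with v. rewrite Ee.
    replace (dot (cross (lc a u b v) (ltail D l)) v) with (- (a * dot (cross u v) (ltail D l))); [nra|].
    vring.
  - exists (j, false). split; [auto|]. split; [auto|].
    change (lend D (j, false)) with u. rewrite Ee.
    replace (dot (cross (lc a u b v) (ltail D l)) u) with (b * dot (cross u v) (ltail D l)); [nra|].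
    vring.
Qed.

Lemma lane_vecs_inj D l l' : is_SD D -> lane_of D l -> lane_of D l' ->
  ltail D l = ltail D l' -> lend D l = lend D l' -> l = l'.
Proof.
  intros H Hl Hl' E1 E2.
  assert (Hc : cint (ltail D l) (lend D l) (lc 1 (ltail D l) 1 (lend D l))) by (exists 1, 1; repeat split; lra).
  assert (Ei : fst l = fst l').
  { apply (sd_cint_disjoint D _ _ (lc 1 (ltail D l) 1 (lend D l)) H Hl Hl').
    - apply lane_cint. auto.
    - apply lane_cint. rewrite <- E1, <- E2. auto. }
  destruct l as [i b], l' as [i' b']; simpl in *. subst i'. f_equal.
  destruct (sd_arc_valid _ _ H Hl) as (_ & _ & Hne & _).
  destruct b, b'; auto; exfalso; unfold lend in E2; simpl in E2; auto.
Qed.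

Lemma sd_arc_system D : is_SD D -> arc_system (lane_vecs D).
Proof.
  intros H. split.
  - intros t e (l & Hl & -> & ->). apply sd_lane_indep; auto.
  - intros t e (l & Hl & -> & ->). exists (fst l, negb (snd l)). split; [exact Hl|].
    unfold ltail; simpl. rewrite Bool.negb_involutive. destruct l; auto.
  - intros t e t' e' x (l & Hl & -> & ->) (l' & Hl' & -> & ->) Hx Hx'.
    apply lane_cint in Hx, Hx'.
    pose proof (sd_cint_disjoint _ _ _ _ H Hl Hl' Hx Hx') as E.
    destruct l as [i b], l' as [i' b']; simpl in *; subst i'.
    destruct (Bool.bool_dec b b') as [->|Hn]; [left; auto|right].
    assert (Eb : b' = negb b) by (destruct b, b'; auto; contradiction).
    unfold ltail; simpl. rewrite Eb, Bool.negb_involutive. auto.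
Qed.

(** Both ends inside arc [j] would place arc [i] on the great circle of [j], against
    transversality. *)
Lemma sd_ends_hit_distinct D i j : is_SD D -> (i < length D)%nat -> (j < length D)%nat ->
  arc_cint D j (lend D (i, true)) -> ~ arc_cint D j (lend D (i, false)).
Proof.
  intros H Hi Hj H1 H2. apply (sd_transversal D (i, true) j H Hi Hj H1).
  apply (dot_cint_zero _ _ _ _ (dot_cross_l _ _) (dot_cross_r _ _) H2).
Qed.

Lemma sd_sigma D : is_SD D -> exists sg : lane -> lane, forall l, lane_of D l ->
  lane_of D (sg l) /\ next_lane (ltail D l) (lend D l) (ltail D (sg l)) (lend D (sg l)).
Proof.
  intros H.
  assert (G : forall l, exists l', lane_of D l -> lane_of D l' /\ next_lane (ltail D l) (lend D l) (ltail D l') (lend D l')).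
  { intros l. destruct (classic (lane_of D l)) as [Hl|Hl].
    - destruct (sd_next_lane D l H Hl) as (l' & Hl'). exists l'. auto.
    - exists l. contradiction. }
  exists (fun l => proj1_sig (constructive_indefinite_description _ (G l))).
  intros l. apply (proj2_sig (constructive_indefinite_description _ (G l))).
Qed.

(** * Two clockwise swirls *)

Lemma iter_add {X} (f : X -> X) a b x : Nat.iter (a + b) f x = Nat.iter a f (Nat.iter b f x).
Proof. induction a; simpl; congruence. Qed.

Lemma iter_collision {X} (f : X -> X) (ls : list X) x0 :
  (forall a, In (Nat.iter a f x0) ls) ->
  exists a q, (0 < q)%nat /\ Nat.iter (a + q) f x0 = Nat.iter a f x0.
Proof.
  intros H. apply NNPP. intros Hn.
  assert (Hnd : NoDup (map (fun a => Nat.iter a f x0) (seq 0 (S (length ls))))).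
  { apply NoDup_map_NoDup_ForallPairs; [|apply seq_NoDup].
    intros a b _ _ E. destruct (Nat.lt_trichotomy a b) as [L|[L|L]]; auto; exfalso; apply Hn.
    - exists a, (b - a)%nat. split; [lia|]. replace (a + (b - a))%nat with b by lia. auto.
    - exists b, (a - b)%nat. split; [lia|]. replace (b + (a - b))%nat with a by lia. auto. }
  assert (Hin : incl (map (fun a => Nat.iter a f x0) (seq 0 (S (length ls)))) ls).
  { intros y Hy. apply in_map_iff in Hy. destruct Hy as (a & <- & _). apply H. }
  pose proof (NoDup_incl_length Hnd Hin) as HL.
  rewrite length_map, length_seq in HL. lia.
Qed.

(** [K] is the least return time of a recurrent point, which makes the period exact; reading indices
    modulo [K] extends the orbit to Z and gives every element a predecessor. *)
Lemma iter_cycle {X} (f : X -> X) (ls : list X) x0 :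
  (forall a, In (Nat.iter a f x0) ls) ->
  exists (K : Z) (L : Z -> X), (0 < K)%Z /\ (forall z, L (z + 1)%Z = f (L z)) /\
    (forall z, L (z + K)%Z = L z) /\ (forall i j, L i = L j -> (K | i - j)%Z) /\
    (forall z, exists a, L z = Nat.iter a f x0).
Proof.
  intros H. destruct (iter_collision f ls x0 H) as (a & q0 & Hq0 & E0).
  set (x := Nat.iter a f x0).
  set (P := fun q => (0 < q)%nat /\ Nat.iter q f x = x).
  assert (HP : exists q, P q).
  { exists q0. split; auto. unfold x. rewrite <- iter_add, Nat.add_comm. auto. }
  destruct (dec_inh_nat_subset_has_unique_least_element P (fun n => classic (P n)) HP)
    as (q & ((Hq & Eq) & Hmin) & _).
  set (K := Z.of_nat q).
  assert (Hper : forall m r, Nat.iter (r + m * q) f x = Nat.iter r f x).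
  { induction m as [|m IH]; intros r; simpl.
    - rewrite Nat.add_0_r. auto.
    - replace (r + (q + m * q))%nat with ((r + m * q) + q)%nat by lia.
      rewrite iter_add, Eq. apply IH. }
  exists K, (fun z => Nat.iter (Z.to_nat (z mod K)) f x).
  assert (HK : (0 < K)%Z) by (unfold K; lia).
  assert (Hmod : forall z, Nat.iter (S (Z.to_nat (z mod K))) f x = Nat.iter (Z.to_nat ((z + 1) mod K)) f x).
  { intros z. pose proof (Z.mod_pos_bound z K HK) as B.
    destruct (Z.eq_dec (z mod K) (K - 1)) as [E|E].
    - replace ((z + 1) mod K)%Z with 0%Z.
      + rewrite E. replace (S (Z.to_nat (K - 1))) with q by (unfold K; lia). auto.
      + rewrite <- Zplus_mod_idemp_l, E. replace (K - 1 + 1)%Z with K by lia. symmetry. apply Z_mod_same_full.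
    - replace ((z + 1) mod K)%Z with (z mod K + 1)%Z.
      + f_equal. lia.
      + rewrite <- (Zplus_mod_idemp_l z 1 K). symmetry. apply Z.mod_small. lia. }
  split; [auto|]. split; [|split; [|split]].
  - intros z. rewrite <- Hmod. auto.
  - intros z. replace (z + K)%Z with (z + 1 * K)%Z by lia. rewrite Z_mod_plus_full. auto.
  - intros i j E.
    pose proof (Z.mod_pos_bound i K HK) as Bi. pose proof (Z.mod_pos_bound j K HK) as Bj.
    assert (G : forall u v, (u < v < q)%nat -> Nat.iter u f x <> Nat.iter v f x).
    { intros u v Huv Euv.
      assert (Hu : P (q - v + u)%nat).
      { split; [lia|]. rewrite iter_add, Euv, <- iter_add. replace (q - v + v)%nat with q by lia. auto. }
      specialize (Hmin _ Hu). lia. }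
    assert (Eij : (i mod K = j mod K)%Z).
    { destruct (Nat.lt_trichotomy (Z.to_nat (i mod K)) (Z.to_nat (j mod K))) as [L|[L|L]].
      - exfalso. apply (G (Z.to_nat (i mod K)) (Z.to_nat (j mod K))); [unfold K in *; lia|exact E].
      - lia.
      - exfalso. apply (G (Z.to_nat (j mod K)) (Z.to_nat (i mod K))); [unfold K in *; lia|exact (eq_sym E)]. }
    exists (i / K - j / K)%Z.
    pose proof (Z.div_mod i K ltac:(lia)). pose proof (Z.div_mod j K ltac:(lia)). lia.
  - intros z. exists (Z.to_nat (z mod K) + a)%nat. unfold x. rewrite <- iter_add. auto.
Qed.

Lemma periodic_mod {X} (L : Z -> X) K z : (0 < K)%Z -> (forall z, L (z + K)%Z = L z) -> L (z mod K)%Z = L z.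
Proof.
  intros HK H. rewrite <- (periodic_shift L K (z mod K) (z / K) H). f_equal.
  pose proof (Z.div_mod z K ltac:(lia)). lia.
Qed.

Lemma positive_perturb (C : list vec3) x v : (forall c, In c C -> dot c x > 0) ->
  exists d, 0 < d /\ forall s, 0 < s < d -> forall c, In c C -> dot c (lc 1 x s v) > 0.
Proof.
  induction C as [|c C IH]; intros H.
  - exists 1. split; [lra|]. intros s _ c [].
  - destruct IH as (d1 & Hd1 & P1); [intros; apply H; right; auto|].
    destruct (lexpos_small c x v) as (d2 & Hd2 & P2); [left; apply H; left; auto|].
    exists (Rmin d1 d2). split; [apply Rmin_glb_lt; auto|].
    intros s [Hs1 Hs2] c' [<-|Hc'].
    + apply P2. pose proof (Rmin_r d1 d2). lra.
    + apply P1; auto. pose proof (Rmin_l d1 d2). lra.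
Qed.

(** A point on the great circle of [n] is pushed along [n] itself, by so little that all strict
    signs obtained before persist; [sg] orients the other normals so that their nonvanishing becomes
    positivity. *)
Lemma generic_point (L : list vec3) : forall (C : list vec3) x,
  (forall n, In n L -> n <> vzero) -> (forall c, In c C -> dot c x > 0) ->
  exists y, (forall c, In c C -> dot c y > 0) /\ forall n, In n L -> dot n y <> 0.
Proof.
  induction L as [|n L IH]; intros C x HL HC.
  - exists x. split; auto.
  - destruct (IH C x) as (y & Hy1 & Hy2); auto; [intros; apply HL; right; auto|].
    destruct (Req_dec (dot n y) 0) as [E|E].
    + set (sg := fun m => if Rlt_dec 0 (dot m y) then m else vopp m).
      assert (Hsg : forall m z, dot (vopp m) z = - dot m z) by (intros; vring).
      destruct (positive_perturb (C ++ map sg L) y n) as (d & Hd & P).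
      { intros c Hc. apply in_app_or in Hc. destruct Hc as [Hc|Hc]; auto.
        apply in_map_iff in Hc. destruct Hc as (m & <- & Hm). unfold sg.
        destruct (Rlt_dec 0 (dot m y)); auto. rewrite Hsg. specialize (Hy2 m Hm). lra. }
      exists (lc 1 y (d / 2) n). specialize (P (d / 2) ltac:(lra)).
      split; [intros c Hc; apply P, in_or_app; auto|].
      intros m [<-|Hm].
      * rewrite dot_lc, E. assert (0 < dot n n) by (apply dot_self_pos, HL; left; auto). nra.
      * assert (Hp : dot (sg m) (lc 1 y (d / 2) n) > 0).
        { apply P, in_or_app. right. apply in_map. auto. }
        unfold sg in Hp. destruct (Rlt_dec 0 (dot m y)); [lra|]. rewrite Hsg in Hp. lra.
    + exists y. split; auto. intros m [<-|Hm]; auto.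
Qed.

Definition all_lanes (n : nat) : list lane :=
  map (fun i => (i, true)) (seq 0 n) ++ map (fun i => (i, false)) (seq 0 n).

Lemma in_all_lanes n l : (fst l < n)%nat -> In l (all_lanes n).
Proof.
  destruct l as [i []]; simpl; intros H; apply in_or_app; [left|right];
  apply in_map_iff; exists i; split; auto; apply in_seq; lia.
Qed.

Definition lane_cycle (D : list arc) (sg : lane -> lane) (K : Z) (L : Z -> lane) : Prop :=
  (0 < K)%Z /\ (forall z, L (z + 1)%Z = sg (L z)) /\ (forall z, L (z + K)%Z = L z) /\
  (forall i j, L i = L j -> (K | i - j)%Z) /\ forall z, lane_of D (L z).

Definition right_turn_map (D : list arc) (sg : lane -> lane) : Prop :=
  forall l, lane_of D l ->
  lane_of D (sg l) /\ next_lane (ltail D l) (lend D l) (ltail D (sg l)) (lend D (sg l)).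

Lemma lane_cycle_right_turning D sg K L : is_SD D -> right_turn_map D sg -> lane_cycle D sg K L ->
  right_turning (fun i => ltail D (L i)) (fun i => lend D (L i)) K.
Proof.
  intros H Hs (HK & H1 & HP & Hm & Hl).
  assert (Hn : forall i, next_lane (ltail D (L (i - 1)%Z)) (lend D (L (i - 1)%Z)) (ltail D (L i)) (lend D (L i))).
  { intros i. pose proof (proj2 (Hs _ (Hl (i - 1)%Z))) as Hx. rewrite <- H1 in Hx.
    replace (i - 1 + 1)%Z with i in Hx by lia. auto. }
  split; auto.
  - intros i. rewrite HP. auto.
  - intros i. rewrite HP. auto.
  - intros i j E1 E2. apply Hm. apply (lane_vecs_inj D _ _ H (Hl i) (Hl j) E1 E2).
  - intros i. apply (Hn i).
  - intros i. apply (Hn i).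
  - intros i j x. apply (as_disj _ (sd_arc_system D H)); apply lane_vecs_intro; auto.
Qed.

Definition cycle_arcs (K : Z) (L : Z -> lane) : list nat :=
  map (fun j => fst (L (Z.of_nat j))) (seq 0 (Z.to_nat K)).

Lemma cycle_arcs_length K L : length (cycle_arcs K L) = Z.to_nat K.
Proof. unfold cycle_arcs. rewrite length_map, length_seq. auto. Qed.

Lemma cycle_arcs_nth K L k : (0 < K)%Z -> (forall z, L (z + K)%Z = L z) ->
  nth (k mod length (cycle_arcs K L)) (cycle_arcs K L) 0%nat = fst (L (Z.of_nat k)).
Proof.
  intros HK HP. rewrite cycle_arcs_length. unfold cycle_arcs.
  assert (Hb : (k mod Z.to_nat K < Z.to_nat K)%nat) by (apply Nat.mod_upper_bound; lia).
  rewrite (nth_indep _ 0%nat ((fun j => fst (L (Z.of_nat j))) 0%nat)) by (rewrite length_map, length_seq; auto).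
  rewrite (map_nth (fun j => fst (L (Z.of_nat j)))), seq_nth by auto. simpl.
  rewrite Nat2Z.inj_mod, Z2Nat.id by lia. rewrite (periodic_mod L K _ HK HP). auto.
Qed.

Lemma lane_ends D l : ends (arcD D (fst l)) (lend D l) (ltail D l).
Proof. destruct l as [i []]; unfold ends, ltail, lend; simpl; auto. Qed.

Lemma lane_end_on_sphere D l : is_SD D -> lane_of D l -> on_sphere (lend D l).
Proof.
  intros H Hl. destruct (sd_arc_valid _ _ H Hl) as (Hu & Hv & _).
  unfold lend. destruct (snd l); auto.
Qed.

(** Distinct lanes of the cycle could still be the two directions of one arc. A point of the eye is
    on the right of every lane, which is impossible for two opposite lanes. *)
Lemma lane_cycle_swirl D sg K L : is_SD D -> right_turn_map D sg -> lane_cycle D sg K L ->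
  is_swirl D true (cycle_arcs K L).
Proof.
  intros H Hs Hc. pose proof (lane_cycle_right_turning _ _ _ _ H Hs Hc) as HR.
  pose proof Hc as (HK & H1 & HP & Hm & Hl).
  assert (Hin : forall i, lane_of D (L i) -> (fst (L i) < length D)%nat) by auto.
  split; [|split; [|split]].
  - intros E. pose proof (cycle_arcs_length K L) as HL. rewrite E in HL. simpl in HL. lia.
  - apply NoDup_map_NoDup_ForallPairs; [|apply seq_NoDup].
    intros i j Hi Hj E. apply in_seq in Hi, Hj.
    destruct (right_turning_eye _ _ _ HR) as (p & Hp).
    destruct (Bool.bool_dec (snd (L (Z.of_nat i))) (snd (L (Z.of_nat j)))) as [Eb|Eb].
    + assert (EL : L (Z.of_nat i) = L (Z.of_nat j)).
      { destruct (L (Z.of_nat i)), (L (Z.of_nat j)); simpl in *; congruence. }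
      destruct (Hm _ _ EL) as (q & Hq). assert (q = 0)%Z by nia. lia.
    + exfalso. pose proof (Hp (Z.of_nat i)) as P1. pose proof (Hp (Z.of_nat j)) as P2.
      unfold rnormal in P1, P2.
      assert (EL : L (Z.of_nat j) = (fst (L (Z.of_nat i)), negb (snd (L (Z.of_nat i))))).
      { destruct (L (Z.of_nat i)) as [? b1], (L (Z.of_nat j)) as [? b2]; simpl in *; subst.
        f_equal. destruct b1, b2; simpl; congruence. }
      rewrite EL in P2. unfold ltail in P1, P2; simpl in P2. rewrite Bool.negb_involutive in P2.
      destruct (L (Z.of_nat i)) as [i0 b0]; simpl in *.
      replace (dot (cross (lend D (i0, negb b0)) (lend D (i0, b0))) p)
        with (- dot (cross (lend D (i0, b0)) (lend D (i0, negb b0))) p) in P2; [lra|].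
      vring.
  - intros i Hi. unfold cycle_arcs in Hi. apply in_map_iff in Hi. destruct Hi as (j & <- & _). apply Hl.
  - intros k Hk. rewrite <- (Nat.mod_small _ _ Hk) at 1. rewrite !cycle_arcs_nth by auto.
    assert (E1 : L (Z.of_nat (k + 1)) = sg (L (Z.of_nat k))) by (rewrite <- H1; f_equal; lia).
    assert (E2 : L (Z.of_nat (k + 2)) = sg (L (Z.of_nat (k + 1)))) by (rewrite <- H1; f_equal; lia).
    pose proof (proj2 (Hs _ (Hl (Z.of_nat k)))) as [N1 N1'].
    pose proof (proj2 (Hs _ (Hl (Z.of_nat (k + 1))))) as [N2 N2'].
    rewrite <- E1 in N1, N1'. rewrite <- E2 in N2, N2'.
    exists (lend D (L (Z.of_nat k))), (ltail D (L (Z.of_nat k))),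
      (lend D (L (Z.of_nat (k + 1)))), (ltail D (L (Z.of_nat (k + 1)))).
    split; [apply lane_ends|]. split; [split; [apply lane_end_on_sphere; auto|apply lane_cint in N1; apply N1]|].
    split; [apply lane_ends|]. split; [split; [apply lane_end_on_sphere; auto|apply lane_cint in N2; apply N2]|].
    replace (det3 (lend D (L (Z.of_nat k))) (ltail D (L (Z.of_nat k))) (lend D (L (Z.of_nat (k + 1)))))
      with (dot (cross (lend D (L (Z.of_nat k))) (ltail D (L (Z.of_nat k)))) (lend D (L (Z.of_nat (k + 1)))));
    [auto|vring].
Qed.

Lemma iter_lane_of D sg l a : right_turn_map D sg -> lane_of D l -> lane_of D (Nat.iter a sg l).
Proof. intros Hs Hl. induction a; simpl; auto. apply (Hs _ IHa). Qed.

Lemma lane_cycle_exists D sg l : right_turn_map D sg -> lane_of D l ->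
  exists K L, lane_cycle D sg K L /\ forall z, exists a, L z = Nat.iter a sg l.
Proof.
  intros Hs Hl.
  destruct (iter_cycle sg (all_lanes (length D)) l) as (K & L & HK & H1 & HP & Hm & Ha).
  { intros a. apply in_all_lanes, iter_lane_of; auto. }
  exists K, L. split; auto. repeat split; auto.
  intros z. destruct (Ha z) as (a & ->). apply iter_lane_of; auto.
Qed.

(* Given a swirl with eye point p, the eastbound lanes starting from the swirl end in a strand that
   never enters the eye, and the right-turning walk started on the strand stays below it. *)
Lemma second_lane_cycle D sg K L : is_SD D -> right_turn_map D sg -> lane_cycle D sg K L ->
  exists K' L', lane_cycle D sg K' L' /\ forall i j, L' i <> L j.
Proof.
  intros H Hs Hc. pose proof (lane_cycle_right_turning _ _ _ _ H Hs Hc) as HR.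
  pose proof Hc as (HK & H1 & HP & Hm & Hl).
  set (t := fun i => ltail D (L i)) in *. set (e := fun i => lend D (L i)) in *.
  pose proof (sd_arc_system D H) as HA.
  destruct (right_turning_eye _ _ _ HR) as (p0 & Hp0).
  (* The eye is open, so its point can be moved off the great circles of all arcs; every arc is then
     eastbound in exactly one direction, recorded by [bE]. *)
  destruct (generic_point (map (fun l => cross (ltail D l) (lend D l)) (filter (fun l => fst l <? length D)%nat (all_lanes (length D))))
    (map (fun j => rnormal t e (Z.of_nat j)) (seq 0 (Z.to_nat K))) p0) as (p & Hp1 & Hp2).
  { intros n Hn. apply in_map_iff in Hn. destruct Hn as (l & <- & Hin).
    apply filter_In in Hin. destruct Hin as [_ Hin]. apply Nat.ltb_lt in Hin. apply sd_lane_indep; auto. }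
  { intros c Hcin. apply in_map_iff in Hcin. destruct Hcin as (j & <- & _). apply Hp0. }
  assert (Heye : in_eye t e p).
  { intros s. rewrite (rnormal_period _ _ _ s HR). apply Hp1. apply in_map_iff.
    pose proof (Z.mod_pos_bound s K HK). exists (Z.to_nat (s mod K)). split.
    - rewrite Z2Nat.id by lia. auto.
    - apply in_seq. lia. }
  assert (Hgen : forall l, lane_of D l -> dot (cross (ltail D l) (lend D l)) p <> 0).
  { intros l Hl'. apply Hp2. apply in_map_iff. exists l. split; auto.
    apply filter_In. split; [apply in_all_lanes; auto|apply Nat.ltb_lt; auto]. }
  assert (Hgen' : forall t e, lane_vecs D t e -> dot (cross p t) e <> 0).
  { intros a b (l & Hl' & -> & ->). specialize (Hgen l Hl').
    replace (dot (cross p (ltail D l)) (lend D l)) with (dot (cross (ltail D l) (lend D l)) p); auto.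
    vring. }
  set (bE := fun i : nat => if Rlt_dec 0 (dot (cross (ltail D (i, true)) (lend D (i, true))) p) then true else false).
  assert (HbE : forall i, (i < length D)%nat -> dot (cross (ltail D (i, bE i)) (lend D (i, bE i))) p > 0).
  { intros i Hi. unfold bE. destruct (Rlt_dec 0 (dot (cross (ltail D (i, true)) (lend D (i, true))) p)); [auto|].
    pose proof (Hgen (i, true) Hi) as Hg. unfold ltail in *; simpl in *.
    replace (dot (cross (lend D (i, true)) (lend D (i, false))) p)
      with (- dot (cross (lend D (i, false)) (lend D (i, true))) p); [lra|].
    vring. }
  (* Each arc is left through its eastern end, and the arc hit there is again taken eastwards,
     whichever turn this requires. *)
  set (rho := fun i => fst (sg (i, bE i))).
  assert (Hrho : forall i, (i < length D)%nat -> (rho i < length D)%nat) by (intros i Hi; apply (Hs (i, bE i)), Hi).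
  set (i0 := fst (L 0%Z)). assert (Hi0 : (i0 < length D)%nat) by apply Hl.
  assert (Hit : forall a, (Nat.iter a rho i0 < length D)%nat) by (induction a; simpl; auto).
  destruct (iter_cycle rho (seq 0 (length D)) i0) as (M & Zc & HM & HZ1 & HZP & _ & HZa).
  { intros a. apply in_seq. specialize (Hit a). lia. }
  assert (HZl : forall z, (Zc z < length D)%nat) by (intros z; destruct (HZa z) as (a & ->); auto).
  set (tz := fun z => ltail D (Zc z, bE (Zc z))). set (ez := fun z => lend D (Zc z, bE (Zc z))).
  assert (Hst : strand (lane_vecs D) p tz ez M).
  { split; auto.
    - intros i. unfold tz. rewrite HZP. auto.
    - intros i. unfold ez. rewrite HZP. auto.
    - intros i. apply lane_vecs_intro. apply HZl.
    - intros i. unfold tz, ez. apply lane_cint. simpl.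
      pose proof (proj2 (Hs (Zc (i - 1)%Z, bE (Zc (i - 1)%Z)) (HZl _))) as [N _].
      apply lane_cint in N. fold (rho (Zc (i - 1)%Z)) in N. rewrite <- HZ1 in N.
      replace (i - 1 + 1)%Z with i in N by lia. auto.
    - intros i. apply HbE, HZl. }
  assert (Hav : forall i, (i < length D)%nat -> avoids_eye t e (ltail D (i, bE i)) (lend D (i, bE i)) ->
     avoids_eye t e (ltail D (rho i, bE (rho i))) (lend D (rho i, bE (rho i)))).
  { intros i Hi. apply (avoids_eye_step (lane_vecs D) t e K _ _ _ _ HA HR).
    - intros s. apply lane_vecs_intro, Hl.
    - apply lane_vecs_intro. apply Hrho; auto.
    - apply lane_cint. simpl. pose proof (proj2 (Hs (i, bE i) Hi)) as [N _]. apply lane_cint in N. auto. }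
  (* The starting arc lies on the great circle of a lane of the swirl, where the open condition
     defining the eye fails. *)
  assert (Hav0 : avoids_eye t e (ltail D (i0, bE i0)) (lend D (i0, bE i0))).
  { intros al be _ _ Hin. specialize (Hin 0%Z). rewrite dot_lc in Hin.
    assert (E : forall b, dot (rnormal t e 0) (lend D (i0, b)) = 0).
    { intros b. pose proof (rnormal_t t e 0) as E1. pose proof (rnormal_e t e 0) as E2.
      unfold t at 2 in E1. unfold e at 2 in E2. unfold i0. unfold ltail in E1.
      destruct (L 0%Z) as [j []], b; simpl in *; auto. }
    unfold ltail in Hin. rewrite !E in Hin. lra. }
  assert (Hava : forall a, avoids_eye t e (ltail D (Nat.iter a rho i0, bE (Nat.iter a rho i0)))
     (lend D (Nat.iter a rho i0, bE (Nat.iter a rho i0)))) by (induction a; simpl; auto).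
  assert (Havz : forall i, avoids_eye t e (tz i) (ez i)).
  { intros i. unfold tz, ez. destruct (HZa i) as (a & ->). auto. }
  set (g0 := (Zc 0%Z, bE (Zc 0%Z))). assert (Hg0 : lane_of D g0) by apply HZl.
  (* [q] is the point at which the lane is entered: the previous vertex of the strand at the start,
     the end of the previous lane afterwards. *)
  assert (HI : forall a, exists q, cint (ltail D (Nat.iter a sg g0)) (lend D (Nat.iter a sg g0)) q /\
    (forall a', a = S a' -> q = lend D (Nat.iter a' sg g0)) /\
    under_strand p tz ez q (ltail D (Nat.iter a sg g0)) (lend D (Nat.iter a sg g0))).
  { induction a as [|a (q & Hq & _ & HU)].
    - exists (ez (-1)%Z). simpl. split; [apply (st_hit Hst 0%Z)|]. split; [discriminate|].
      right. exists 0%Z. auto.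
    - pose proof (iter_lane_of D sg g0 a Hs Hg0) as Hga.
      destruct (Hs _ Hga) as [Hgs Hn].
      exists (lend D (Nat.iter a sg g0)). split; [apply Hn|].
      split; [intros a' Ea; injection Ea as <-; auto|].
      apply (under_strand_step (lane_vecs D) p tz ez M q (ltail D (Nat.iter a sg g0)) _ _ _ HA Hst Hgen'); auto;
      apply lane_vecs_intro; auto. }
  destruct (lane_cycle_exists D sg g0 Hs Hg0) as (K' & L' & Hc' & Ha').
  exists K', L'. split; auto. intros i j E. destruct (Ha' i) as (a & Ea).
  destruct (HI (S a)) as (q & _ & Hq & HU). rewrite (Hq a eq_refl) in HU. simpl in HU.
  rewrite <- Ea, E, <- H1 in HU.
  apply (eye_lane_not_under (lane_vecs D) p t e K tz ez M (j + 1)%Z HR Heye Hst Havz).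
  unfold t, e. replace (j + 1 - 1)%Z with j by lia. auto.
Qed.

Lemma same_cycle_rotation s t : same_cycle s t -> exists d, forall k, (s <> []) ->
  nth (k mod length t) t 0%nat = nth ((k + d) mod length s) s 0%nat.
Proof.
  intros (l1 & l2 & -> & ->). exists (length l1). intros k Hne.
  rewrite !length_app. set (n1 := length l1). set (n2 := length l2).
  assert (Hn : (n1 + n2 <> 0)%nat).
  { intros E. apply Hne. destruct l1, l2; simpl in *; auto; unfold n1, n2 in E; simpl in E; lia. }
  replace (n2 + n1)%nat with (n1 + n2)%nat by lia.
  rewrite <- (Nat.Div0.add_mod_idemp_l k n1).
  pose proof (Nat.mod_upper_bound k (n1 + n2) Hn) as B. set (r := (k mod (n1 + n2))%nat) in *.
  destruct (lt_dec r n2) as [Hr|Hr].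
  - rewrite app_nth1 by (fold n2; lia).
    rewrite Nat.mod_small by lia. rewrite app_nth2 by (fold n1; lia). f_equal. fold n1. lia.
  - rewrite app_nth2 by (fold n2; lia).
    replace (r + n1)%nat with ((r - n2) + 1 * (n1 + n2))%nat by lia.
    rewrite Nat.Div0.mod_add, Nat.mod_small by lia. rewrite app_nth1 by (fold n1; lia). auto.
Qed.

(** Two cycles without a common lane might still run through the same arcs. If they did so in the
    same cyclic order, some arc would be traversed in opposite directions and both its ends would
    hit the same next arc. *)
Lemma sd_two_clockwise D : is_SD D -> at_least_two_swirls D true.
Proof.
  intros H. destruct (sd_sigma D H) as (sg & Hs). fold (right_turn_map D sg) in Hs.
  assert (Hl0 : lane_of D (0%nat, true)).
  { unfold lane_of; simpl. destruct H as (Hne & _). destruct D; [contradiction|simpl; lia]. }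
  destruct (lane_cycle_exists D sg _ Hs Hl0) as (K & L & Hc & _).
  destruct (second_lane_cycle D sg K L H Hs Hc) as (K' & L' & Hc' & Hdis).
  exists (cycle_arcs K L), (cycle_arcs K' L').
  split; [apply (lane_cycle_swirl D sg); auto|]. split; [apply (lane_cycle_swirl D sg); auto|].
  intros Hsame. destruct (same_cycle_rotation _ _ Hsame) as (d & Hd).
  destruct Hc as (HK & H1 & HP & _ & Hl). destruct Hc' as (HK' & H1' & HP' & _ & Hl').
  assert (Hne : cycle_arcs K L <> []).
  { intros E. pose proof (cycle_arcs_length K L) as HL. rewrite E in HL. simpl in HL. lia. }
  pose proof (Hd 0%nat Hne) as E0. pose proof (Hd 1%nat Hne) as E1.
  rewrite !cycle_arcs_nth in E0, E1 by auto.
  change (Z.of_nat 1) with 1%Z in E1. change (Z.of_nat 0) with 0%Z in E0. change (0 + d)%nat with d in E0.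
  replace (Z.of_nat (1 + d)) with (Z.of_nat d + 1)%Z in E1 by lia.
  specialize (Hdis 0%Z (Z.of_nat d)).
  pose proof (proj2 (Hs _ (Hl (Z.of_nat d)))) as [N _]. rewrite <- H1 in N.
  pose proof (proj2 (Hs _ (Hl' 0%Z))) as [N' _]. rewrite <- H1' in N'.
  apply lane_cint in N, N'. change (0 + 1)%Z with 1%Z in N'.
  rewrite <- E1 in N.
  pose proof (Hl (Z.of_nat d)) as Hd'. pose proof (Hl' 1%Z) as Hl1.
  destruct (L (Z.of_nat d)) as [i b], (L' 0%Z) as [i' b']. unfold lane_of in *. simpl in *. subst i'.
  assert (b <> b') by congruence.
  destruct b, b'; try congruence; eapply (sd_ends_hit_distinct D i (fst (L' 1%Z))); eauto.
Qed.

(** * Mirror images *)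

Definition mirror (x : vec3) : vec3 := V3 (vx x) (vy x) (- vz x).
Definition mirror_arc (B : arc) : arc := Arc (mirror (a_u B)) (mirror (a_v B)).

Lemma mirror_involutive x : mirror (mirror x) = x.
Proof. destruct x; unfold mirror; simpl. f_equal. ring. Qed.

Lemma mirror_arc_involutive B : mirror_arc (mirror_arc B) = B.
Proof. destruct B; unfold mirror_arc; simpl. rewrite !mirror_involutive. auto. Qed.

Lemma mirror_on_sphere x : on_sphere x -> on_sphere (mirror x).
Proof. destruct x; unfold on_sphere, mirror, dot; simpl. intros <-. ring. Qed.

Lemma mirror_lc a x b y : mirror (vadd (vscale a x) (vscale b y)) = vadd (vscale a (mirror x)) (vscale b (mirror y)).
Proof. destruct x, y; unfold mirror, vadd, vscale; simpl. f_equal; ring. Qed.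

Lemma mirror_vopp x : mirror (vopp x) = vopp (mirror x).
Proof. destruct x; unfold mirror, vopp, vscale; simpl. f_equal; ring. Qed.

Lemma mirror_det3 x y z : det3 (mirror x) (mirror y) (mirror z) = - det3 x y z.
Proof. unfold mirror. vring. Qed.

Lemma mirror_in_relint x B : in_relint x B -> in_relint (mirror x) (mirror_arc B).
Proof.
  intros (Hs & a & b & Ha & Hb & ->). split; [apply mirror_on_sphere; auto|].
  exists a, b. repeat split; auto. apply mirror_lc.
Qed.

Lemma mirror_in_relint_inv x B : in_relint x (mirror_arc B) -> in_relint (mirror x) B.
Proof. intros H. apply mirror_in_relint in H. rewrite mirror_arc_involutive in H. auto. Qed.

Lemma mirror_ends B e w : ends (mirror_arc B) e w -> ends B (mirror e) (mirror w).
Proof. destruct B as [u v]. unfold ends; simpl. intros [[-> ->]|[-> ->]]; rewrite !mirror_involutive; auto. Qed.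

Lemma mirror_arc_valid B : arc_valid B -> arc_valid (mirror_arc B).
Proof.
  destruct B as [u v]. unfold arc_valid; simpl. intros (Hu & Hv & Hn & Ha).
  split; [apply mirror_on_sphere; auto|]. split; [apply mirror_on_sphere; auto|]. split; intros E.
  - apply Hn. rewrite <- (mirror_involutive u), E, mirror_involutive. auto.
  - apply Ha. rewrite <- (mirror_involutive u), E, mirror_vopp, mirror_involutive. auto.
Qed.

Lemma mirror_arcD D i : arcD (map mirror_arc D) i = mirror_arc (arcD D i).
Proof.
  unfold arcD. rewrite <- (map_nth mirror_arc).
  replace (mirror_arc (Arc vzero vzero)) with (Arc vzero vzero); auto.
  unfold mirror_arc, mirror, vzero; simpl. rewrite Ropp_0. auto.
Qed.

Lemma mirror_is_SD D : is_SD D -> is_SD (map mirror_arc D).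
Proof.
  intros (Hne & Hv & Hd & Hr). split; [|split; [|split]].
  - destruct D; [contradiction|discriminate].
  - intros B HB. apply in_map_iff in HB. destruct HB as (B' & <- & HB). apply mirror_arc_valid; auto.
  - rewrite length_map. intros i j Hi Hj Hij (x & H1 & H2). rewrite !mirror_arcD in *.
    apply (Hd i j Hi Hj Hij). exists (mirror x). split; apply mirror_in_relint_inv; auto.
  - intros B e w HB He. apply in_map_iff in HB. destruct HB as (B' & <- & HB).
    destruct (Hr B' _ _ HB (mirror_ends _ _ _ He)) as (C & HC & Hin).
    exists (mirror_arc C). split; [apply in_map; auto|].
    rewrite <- (mirror_involutive e). apply mirror_in_relint; auto.
Qed.

Lemma mirror_swirl D s : is_swirl (map mirror_arc D) true s -> is_swirl D false s.
Proof.
  intros (Hne & Hnd & Hl & Ht). rewrite length_map in Hl. repeat split; auto.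
  intros k Hk. destruct (Ht k Hk) as (e & w & e' & w' & H1 & H2 & H3 & H4 & H5).
  rewrite !mirror_arcD in *.
  exists (mirror e), (mirror w), (mirror e'), (mirror w').
  split; [apply mirror_ends; auto|]. split; [apply mirror_in_relint_inv; auto|].
  split; [apply mirror_ends; auto|]. split; [apply mirror_in_relint_inv; auto|].
  rewrite mirror_det3. lra.
Qed.

Lemma sd_two_counterclockwise D : is_SD D -> at_least_two_swirls D false.
Proof.
  intros H. destruct (sd_two_clockwise _ (mirror_is_SD _ H)) as (s & t & Hs & Ht & Hn).
  exists s, t. auto using mirror_swirl.
Qed.

(** * At least six arcs *)

Definition hits (D : list arc) (i j : nat) : Prop := exists b, arc_cint D j (lend D (i, b)).

Definition turnD (D : list arc) (i j k : nat) (cw : bool) : Prop :=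
  turn (arcD D i) (arcD D j) (arcD D k) cw.

Definition turn_det (D : list arc) (i : nat) (b : bool) (j : nat) (b' : bool) : R :=
  det3 (lend D (i, b)) (ltail D (i, b)) (lend D (j, b')).

Lemma ends_lane D i e w : ends (arcD D i) e w -> exists b, e = lend D (i, b) /\ w = ltail D (i, b).
Proof. intros [[-> ->]|[-> ->]]; [exists false|exists true]; auto. Qed.

Lemma turnD_lanes D i j k cw : turnD D i j k cw -> exists b b',
  arc_cint D j (lend D (i, b)) /\ arc_cint D k (lend D (j, b')) /\
  if cw then turn_det D i b j b' > 0 else turn_det D i b j b' < 0.
Proof.
  intros (e & w & e' & w' & H1 & H2 & H3 & H4 & H5).
  destruct (ends_lane _ _ _ _ H1) as (b & -> & ->). destruct (ends_lane _ _ _ _ H3) as (b' & -> & ->).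
  exists b, b'. split; [apply H2|]. split; [apply H4|]. auto.
Qed.

Lemma lanes_turnD D i j k (cw : bool) b b' : is_SD D -> (i < length D)%nat -> (j < length D)%nat ->
  arc_cint D j (lend D (i, b)) -> arc_cint D k (lend D (j, b')) ->
  (if cw then turn_det D i b j b' > 0 else turn_det D i b j b' < 0) -> turnD D i j k cw.
Proof.
  intros H Hi Hj H1 H2 H3.
  exists (lend D (i, b)), (ltail D (i, b)), (lend D (j, b')), (ltail D (j, b')).
  split; [apply (lane_ends D (i, b))|]. split; [split; [apply (lane_end_on_sphere D (i, b) H Hi)|apply H1]|].
  split; [apply (lane_ends D (j, b'))|]. split; [split; [apply (lane_end_on_sphere D (j, b') H Hj)|apply H2]|].
  exact H3.
Qed.

Lemma turnD_hits D i j k cw : turnD D i j k cw -> hits D i j /\ hits D j k.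
Proof. intros H. destruct (turnD_lanes _ _ _ _ _ H) as (b & b' & H1 & H2 & _). split; eexists; eauto. Qed.

Lemma hits_lane_unique D i j b b' : is_SD D -> (i < length D)%nat -> (j < length D)%nat ->
  arc_cint D j (lend D (i, b)) -> arc_cint D j (lend D (i, b')) -> b = b'.
Proof.
  intros H Hi Hj H1 H2. destruct b, b'; auto; exfalso; eapply (sd_ends_hit_distinct D i j); eauto.
Qed.

Lemma hits_irrefl D i : is_SD D -> (i < length D)%nat -> ~ hits D i i.
Proof. intros H Hi (b & Hb). apply (sd_end_not_own D (i, b) H Hi Hb). Qed.

(* Two arcs hitting each other would span the same great circle. *)
Lemma hits_antisym D i j : is_SD D -> (i < length D)%nat -> (j < length D)%nat ->
  hits D i j -> ~ hits D j i.
Proof.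
  intros H Hi Hj (b & Hb) (b' & Hb').
  apply (sd_transversal D (i, b) j H Hi Hj Hb).
  set (n := cross (a_u (arcD D j)) (a_v (arcD D j))).
  assert (E1 : dot n (lend D (i, b)) = 0) by (apply (dot_cint_zero _ _ _ _ (dot_cross_l _ _) (dot_cross_r _ _) Hb)).
  assert (E2 : dot n (lend D (j, b')) = 0) by (unfold lend; simpl; destruct b'; [apply dot_cross_r|apply dot_cross_l]).
  apply (lane_cint D (i, b)) in Hb'. destruct Hb' as (x & y & Hx & Hy & E).
  rewrite E, dot_lc, E1 in E2. nra.
Qed.

(** The hit is interior to arc [j] and transversal, so the great circle of arc [i] separates the two
    endpoints of [j]. *)
Lemma turn_det_opposite D i b j b' : is_SD D -> (i < length D)%nat -> (j < length D)%nat ->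
  arc_cint D j (lend D (i, b)) ->
  (turn_det D i b j b' > 0 /\ turn_det D i b j (negb b') < 0) \/
  (turn_det D i b j b' < 0 /\ turn_det D i b j (negb b') > 0).
Proof.
  intros H Hi Hj Hc. pose proof (sd_transversal D (i, b) j H Hi Hj Hc) as Ht.
  destruct Hc as (x & y & Hx & Hy & E). unfold turn_det. rewrite E.
  set (u := a_u (arcD D j)) in *. set (v := a_v (arcD D j)) in *. set (t := ltail D (i, b)) in *.
  assert (E1 : det3 (lc x u y v) t v = - (x * dot (cross u v) t)) by (vring).
  assert (E2 : det3 (lc x u y v) t u = y * dot (cross u v) t) by (vring).
  change (lend D (j, b')) with (if b' then v else u). 
  change (lend D (j, negb b')) with (if negb b' then v else u).
  destruct (Rtotal_order (dot (cross u v) t) 0) as [|[|]]; [|contradiction|];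
  destruct b'; simpl; rewrite E1, E2; ((left; split; nra) || (right; split; nra)).
Qed.

Lemma turnD_total D i j k : is_SD D -> (i < length D)%nat -> (j < length D)%nat ->
  hits D i j -> hits D j k -> turnD D i j k true \/ turnD D i j k false.
Proof.
  intros H Hi Hj (b & Hb) (b' & Hb').
  destruct (turn_det_opposite D i b j b' H Hi Hj Hb) as [[H1 _]|[H1 _]]; [left|right];
  apply (lanes_turnD D i j k _ b b'); auto.
Qed.

Lemma turnD_exclusive D i j k : is_SD D -> (i < length D)%nat -> (j < length D)%nat -> (k < length D)%nat ->
  turnD D i j k true -> ~ turnD D i j k false.
Proof.
  intros H Hi Hj Hk H1 H2.
  destruct (turnD_lanes _ _ _ _ _ H1) as (b1 & b1' & P1 & P2 & P3).
  destruct (turnD_lanes _ _ _ _ _ H2) as (b2 & b2' & Q1 & Q2 & Q3).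
  rewrite (hits_lane_unique D i j b1 b2 H Hi Hj P1 Q1) in *.
  rewrite (hits_lane_unique D j k b1' b2' H Hj Hk P2 Q2) in *. lra.
Qed.

Lemma turnD_other D i j k k' cw : is_SD D -> (i < length D)%nat -> (j < length D)%nat ->
  (k < length D)%nat -> (k' < length D)%nat ->
  turnD D i j k cw -> hits D j k' -> k <> k' -> turnD D i j k' (negb cw).
Proof.
  intros H Hi Hj Hk Hk' H1 (b2 & Hb2) Hn.
  destruct (turnD_lanes _ _ _ _ _ H1) as (b & b' & P1 & P2 & P3).
  assert (Eb : b2 = negb b').
  { destruct (Bool.bool_dec b2 b') as [->|]; [|destruct b2, b'; auto; congruence].
    exfalso. apply Hn. apply (sd_cint_disjoint D _ _ _ H Hk Hk' P2 Hb2). }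
  apply (lanes_turnD D i j k' _ b b2); auto. subst b2.
  destruct (turn_det_opposite D i b j b' H Hi Hj P1), cw; simpl; lra.
Qed.

(* All three turns of a 3-cycle of hits have the sign of one determinant, that of the three hitting points. *)
Lemma turnD_triangle D i j k cw : is_SD D -> (i < length D)%nat -> (j < length D)%nat -> (k < length D)%nat ->
  turnD D i j k cw -> hits D k i -> turnD D j k i cw.
Proof.
  intros H Hi Hj Hk H1 (b3 & Hb3).
  destruct (turnD_lanes _ _ _ _ _ H1) as (b1 & b2 & P1 & P2 & P3).
  apply (lanes_turnD D j k i _ b2 b3); auto.
  unfold turn_det in *.
  apply (lane_cint D (i, b1)) in Hb3. destruct Hb3 as (x & y & Hx & Hy & E3).
  apply (lane_cint D (j, b2)) in P1. destruct P1 as (x' & y' & Hx' & Hy' & E1).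
  set (e1 := lend D (i, b1)) in *. set (e2 := lend D (j, b2)) in *. set (e3 := lend D (k, b3)) in *.
  set (t1 := ltail D (i, b1)) in *. set (t2 := ltail D (j, b2)) in *.
  assert (F1 : det3 e1 e3 e2 = x * det3 e1 t1 e2) by (rewrite E3; vring).
  assert (F2 : det3 e2 e1 e3 = x' * det3 e2 t2 e3) by (rewrite E1 at 1; vring).
  assert (F3 : det3 e1 e3 e2 = det3 e2 e1 e3) by (vring).
  destruct cw; nra.
Qed.

(** * Excluding the regular tournament on five arcs *)

Definition five_hits (D : list arc) (v0 v1 v2 v3 v4 : nat) : Prop :=
  hits D v0 v1 /\ hits D v0 v2 /\ hits D v1 v2 /\ hits D v1 v3 /\ hits D v2 v3 /\ hits D v2 v4 /\
  hits D v3 v4 /\ hits D v3 v0 /\ hits D v4 v0 /\ hits D v4 v1.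

(** In the tournament where [v_i] hits [v_(i+1)] and [v_(i+2)] modulo 5, adding 3 to the indices
    reverses the turn: it is moved along the triangle [v0, v1, v3], reversed by passing to the other
    arc hit by [v3], and moved along the triangle [v1, v3, v4]. *)
Lemma five_step D v0 v1 v3 v4 cw : is_SD D -> (v0 < length D)%nat -> (v1 < length D)%nat ->
  (v3 < length D)%nat -> (v4 < length D)%nat ->
  v0 <> v4 -> hits D v3 v0 -> hits D v3 v4 -> hits D v4 v1 -> turnD D v0 v1 v3 cw -> turnD D v3 v4 v1 (negb cw).
Proof.
  intros H L0 L1 L3 L4 Hn H1 H2 H3 Ht.
  assert (Ht2 : turnD D v1 v3 v0 cw) by (apply turnD_triangle; auto).
  assert (Ht3 : turnD D v1 v3 v4 (negb cw)) by (apply (turnD_other D v1 v3 v0 v4 cw); auto).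
  apply turnD_triangle; auto.
Qed.

(** Five shifts by 3 return to the initial turn after an odd number of reversals. *)
Lemma no_five_hits D v0 v1 v2 v3 v4 : is_SD D ->
  (forall x, In x [v0; v1; v2; v3; v4] -> (x < length D)%nat) -> NoDup [v0; v1; v2; v3; v4] ->
  ~ five_hits D v0 v1 v2 v3 v4.
Proof.
  intros H L Hnd (H01 & H02 & H12 & H13 & H23 & H24 & H34 & H30 & H40 & H41).
  assert (G : v0 <> v4 /\ v3 <> v2 /\ v1 <> v0 /\ v4 <> v3 /\ v2 <> v1).
  { inversion_clear Hnd. inversion_clear H1. inversion_clear H3. inversion_clear H4. simpl in *. intuition. }
  destruct G as (G1 & G2 & G3 & G4 & G5).
  assert (L0 : (v0 < length D)%nat) by (apply L; simpl; auto).
  assert (L1 : (v1 < length D)%nat) by (apply L; simpl; auto).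
  assert (L2 : (v2 < length D)%nat) by (apply L; simpl; auto).
  assert (L3 : (v3 < length D)%nat) by (apply L; simpl; auto 6).
  assert (L4 : (v4 < length D)%nat) by (apply L; simpl; auto 6).
  assert (F : forall cw, turnD D v0 v1 v3 cw -> turnD D v0 v1 v3 (negb cw)).
  { intros cw Ht.
    pose proof (five_step D v0 v1 v3 v4 _ H L0 L1 L3 L4 G1 H30 H34 H41 Ht) as Ht1.
    pose proof (five_step D v3 v4 v1 v2 _ H L3 L4 L1 L2 G2 H13 H12 H24 Ht1) as Ht2.
    pose proof (five_step D v1 v2 v4 v0 _ H L1 L2 L4 L0 G3 H41 H40 H02 Ht2) as Ht3.
    pose proof (five_step D v4 v0 v2 v3 _ H L4 L0 L2 L3 G4 H24 H23 H30 Ht3) as Ht4.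
    pose proof (five_step D v2 v3 v0 v1 _ H L2 L3 L0 L1 G5 H02 H01 H13 Ht4) as Ht5.
    rewrite !Bool.negb_involutive in Ht5. auto. }
  destruct (turnD_total D v0 v1 v3 H L0 L1 H01 H13) as [Ht|Ht]; pose proof (F _ Ht) as Ht'; simpl in Ht';
  apply (turnD_exclusive D v0 v1 v3 H L0 L1 L3); auto.
Qed.

Definition ordered_pairs (n : nat) : list (nat * nat) :=
  filter (fun p => fst p <? snd p)%nat (list_prod (seq 0 n) (seq 0 n)).

(** With n arcs the 2n arc ends determine 2n different unordered pairs of arcs, so [2n <= n(n-1)/2]
    and [n >= 5]. For n = 5 all ten pairs occur, and the hits form a tournament in which every arc
    hits exactly two others. *)
Lemma sd_arc_count D : is_SD D -> (6 <= length D)%nat.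
Proof.
  intros H. destruct (le_lt_dec 6 (length D)) as [|Hlt]; auto. exfalso.
  assert (Hh : forall l, exists j, lane_of D l -> (j < length D)%nat /\ arc_cint D j (lend D l)).
  { intros l. destruct (classic (lane_of D l)) as [Hl|]; [|exists 0%nat; contradiction].
    destruct (sd_hit D l H Hl) as (j & Hj). exists j. auto. }
  set (h := fun l => proj1_sig (constructive_indefinite_description _ (Hh l))).
  assert (Hsp : forall l, lane_of D l -> (h l < length D)%nat /\ arc_cint D (h l) (lend D l))
    by (intros l; apply (proj2_sig (constructive_indefinite_description _ (Hh l)))).
  clearbody h. clear Hh.
  set (P := map (fun l => (Nat.min (fst l) (h l), Nat.max (fst l) (h l))) (all_lanes (length D))).
  assert (Hal : forall l, In l (all_lanes (length D)) -> lane_of D l).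
  { intros l Hl. unfold all_lanes in Hl. apply in_app_or in Hl.
    destruct Hl as [Hl|Hl]; apply in_map_iff in Hl; destruct Hl as (i & <- & Hi); apply in_seq in Hi;
    unfold lane_of; simpl; lia. }
  assert (Hhit : forall l, lane_of D l -> hits D (fst l) (h l)).
  { intros l Hl. exists (snd l). replace (fst l, snd l) with l by (destruct l; auto). apply Hsp; auto. }
  assert (Hnd : NoDup P).
  { apply NoDup_map_NoDup_ForallPairs.
    - intros l l' Hl Hl' E. apply Hal in Hl, Hl'. injection E as E1 E2.
      destruct (Hsp l Hl) as [B1 C1]. destruct (Hsp l' Hl') as [B1' C1'].
      assert (Hc : (fst l = fst l' /\ h l = h l') \/ (fst l = h l' /\ h l = fst l')) by lia.
      destruct Hc as [[E3 E4]|[E3 E4]].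
      + destruct l as [i b], l' as [i' b']; simpl in *. subst i'. f_equal.
        apply (hits_lane_unique D i (h (i, b)) b b' H Hl B1 C1). rewrite E4. auto.
      + exfalso. pose proof (Hhit l Hl) as Q1. pose proof (Hhit l' Hl') as Q2.
        rewrite <- E3, <- E4 in Q2. apply (hits_antisym D _ _ H Hl B1 Q1 Q2).
    - unfold all_lanes. apply NoDup_app.
      + apply NoDup_map_NoDup_ForallPairs; [|apply seq_NoDup]. intros a b _ _ E. congruence.
      + apply NoDup_map_NoDup_ForallPairs; [|apply seq_NoDup]. intros a b _ _ E. congruence.
      + intros a Ha Hb. apply in_map_iff in Ha, Hb. destruct Ha as (x & <- & _), Hb as (y & E & _). congruence. }
  assert (Hin : incl P (ordered_pairs (length D))).
  { intros p Hp. apply in_map_iff in Hp. destruct Hp as (l & <- & Hl). apply Hal in Hl.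
    destruct (Hsp l Hl) as [B1 C1].
    assert (Hne : fst l <> h l).
    { intros E. apply (hits_irrefl D (fst l) H Hl). rewrite E at 2. auto. }
    unfold lane_of in Hl. apply filter_In. split.
    - apply in_prod; apply in_seq; lia.
    - apply Nat.ltb_lt. simpl. lia. }
  assert (HPl : length P = (2 * length D)%nat).
  { unfold P, all_lanes. rewrite length_map, length_app, !length_map, length_seq. lia. }
  pose proof (NoDup_incl_length Hnd Hin) as HL. rewrite HPl in HL.
  assert (Hn0 : (0 < length D)%nat) by (destruct H as (Hne & _); destruct D; [contradiction|simpl; lia]).
  assert (H5 : length D = 5%nat).
  { destruct (length D) as [|[|[|[|[|[|n]]]]]]; simpl in HL; lia. }
  assert (Hin' : incl (ordered_pairs (length D)) P).
  { apply NoDup_length_incl; auto. rewrite HPl, H5. simpl. lia. }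
  assert (Htot : forall i j, (i < 5)%nat -> (j < 5)%nat -> i <> j -> hits D i j \/ hits D j i).
  { intros i j Hi Hj Hij.
    assert (Hp : In (Nat.min i j, Nat.max i j) P).
    { apply Hin'. apply filter_In. split; [apply in_prod; apply in_seq; lia|apply Nat.ltb_lt; simpl; lia]. }
    apply in_map_iff in Hp. destruct Hp as (l & E & Hl). apply Hal in Hl. injection E as E1 E2.
    pose proof (Hhit l Hl) as Q.
    assert (Hc : (fst l = i /\ h l = j) \/ (fst l = j /\ h l = i)) by lia.
    destruct Hc as [[<- <-]|[<- <-]]; auto. }
  assert (Hout : forall i j, (i < 5)%nat -> hits D i j -> (j < 5)%nat -> j = h (i, false) \/ j = h (i, true)).
  { intros i j Hi (b & Hb) Hj. assert (Hl : lane_of D (i, b)) by (unfold lane_of; simpl; lia).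
    destruct (Hsp (i, b) Hl) as [B C].
    assert (j = h (i, b)) by (apply (sd_cint_disjoint D _ _ (lend D (i, b)) H); auto; lia).
    destruct b; auto. }
  assert (Hout2 : forall i x y z, (i < 5)%nat -> (x < 5)%nat -> (y < 5)%nat -> (z < 5)%nat ->
    hits D i x -> hits D i y -> hits D i z -> x <> y -> z = x \/ z = y).
  { intros i x y z Hi Hx Hy Hz Q1 Q2 Q3 Hn.
    apply Hout in Q1, Q2, Q3; auto. intuition congruence. }
  assert (Hanti : forall i j, (i < 5)%nat -> (j < 5)%nat -> hits D i j -> ~ hits D j i).
  { intros i j Hi Hj. apply hits_antisym; auto; lia. }
  assert (K0 : lane_of D (0%nat, false)) by (unfold lane_of; simpl; lia).
  assert (K1 : lane_of D (0%nat, true)) by (unfold lane_of; simpl; lia).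
  pose proof (Hhit _ K0) as Q0. pose proof (Hhit _ K1) as Q1. simpl in Q0, Q1.
  destruct (Hsp _ K0) as [A0 C0]. destruct (Hsp _ K1) as [A1 C1]. rewrite H5 in A0, A1.
  assert (N01 : h (0%nat, false) <> h (0%nat, true)).
  { intros E. rewrite E in C0. apply (sd_ends_hit_distinct D 0 (h (0%nat, true)) H); auto; lia. }
  (* Arc 0 hits [x] and [y], named so that [x] hits [y]; the two remaining arcs are named so that
     [u] hits [w]. Out-degree two then forces all other hits. *)
  assert (exists x y, hits D 0 x /\ hits D 0 y /\ hits D x y /\ (x < 5)%nat /\ (y < 5)%nat /\ x <> y)
    as (x & y & X1 & X2 & X3 & X4 & X5 & X6).
  { destruct (Htot _ _ A0 A1 N01); [exists (h (0%nat, false)), (h (0%nat, true))|exists (h (0%nat, true)), (h (0%nat, false))]; auto 8. }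
  assert (Nx : x <> 0%nat) by (intros ->; apply (hits_irrefl D 0 H); auto; lia).
  assert (Ny : y <> 0%nat) by (intros ->; apply (hits_irrefl D 0 H); auto; lia).
  assert (exists c d, (c < 5)%nat /\ (d < 5)%nat /\ c <> d /\ c <> 0%nat /\ d <> 0%nat /\ c <> x /\ c <> y /\ d <> x /\ d <> y /\ hits D c d)
    as (u & w & U1 & U2 & U3 & U4 & U5 & U6 & U7 & U8 & U9 & U10).
  { assert (exists c d, (c < 5)%nat /\ (d < 5)%nat /\ c <> d /\ c <> 0%nat /\ d <> 0%nat /\ c <> x /\ c <> y /\ d <> x /\ d <> y)
      as (c & d & V1 & V2 & V3 & V4 & V5 & V6 & V7 & V8 & V9).
    { assert (Gs : forall z, (z < 5)%nat -> z = 0%nat \/ z = 1%nat \/ z = 2%nat \/ z = 3%nat \/ z = 4%nat) by (intros; lia).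
      destruct (Gs x X4) as [|[|[|[|]]]]; destruct (Gs y X5) as [|[|[|[|]]]]; try lia; subst x y;
      first [exists 1%nat, 2%nat; lia|exists 1%nat, 3%nat; lia|exists 1%nat, 4%nat; lia|exists 2%nat, 3%nat; lia
            |exists 2%nat, 4%nat; lia|exists 3%nat, 4%nat; lia]. }
    destruct (Htot c d V1 V2 V3); [exists c, d|exists d, c]; auto 12. }
  assert (P0 : (0 < 5)%nat) by lia.
  assert (Tr : forall i a b j, (i < 5)%nat -> (a < 5)%nat -> (b < 5)%nat -> (j < 5)%nat -> hits D i a -> hits D i b -> a <> b ->
     j <> i -> j <> a -> j <> b -> hits D j i).
  { intros i a b j Bi Ba Bb Bj Ha Hb Hab Hji Hja Hjb. destruct (Htot j i Bj Bi Hji) as [|Hij]; auto.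
    destruct (Hout2 i a b j); auto; congruence. }
  pose proof (Tr 0%nat x y u P0 X4 X5 U1 X1 X2 X6 U4 U6 U7) as E1.
  pose proof (Tr 0%nat x y w P0 X4 X5 U2 X1 X2 X6 U5 U8 U9) as E2.
  pose proof (Tr u 0%nat w x U1 P0 U2 X4 E1 U10 ltac:(auto) ltac:(auto) Nx ltac:(auto)) as E3.
  pose proof (Tr u 0%nat w y U1 P0 U2 X5 E1 U10 ltac:(auto) ltac:(auto) Ny ltac:(auto)) as E4.
  pose proof (Tr x y u w X4 X5 U1 U2 X3 E3 ltac:(auto) ltac:(auto) ltac:(auto) ltac:(auto)) as E5.
  pose proof (Tr w 0%nat x y U2 P0 X4 X5 E2 E5 ltac:(auto) ltac:(auto) Ny ltac:(auto)) as E6.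
  apply (no_five_hits D 0 x y u w H).
  - simpl. intros z Hz. rewrite H5. intuition lia.
  - repeat constructor; simpl; intuition lia.
  - repeat split; auto.
Qed.

(** * At least eight arcs in a one-sided diagram *)

(** The sign depends only on the end [b'] of arc [j] and on the side from which [j] is reached. This
    is the form in which one-sidedness can be applied to turns. *)
Lemma turn_det_sign D i b j b' : is_SD D -> (i < length D)%nat -> (j < length D)%nat ->
  arc_cint D j (lend D (i, b)) ->
  exists c, 0 < c /\ turn_det D i b j b' =
    (if b' then -1 else 1) * (c * dot (cross (a_u (arcD D j)) (a_v (arcD D j))) (ltail D (i, b))).
Proof.
  intros H Hi Hj (x & y & Hx & Hy & E). unfold turn_det. rewrite E.
  change (lend D (j, b')) with (if b' then a_v (arcD D j) else a_u (arcD D j)).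
  generalize (ltail D (i, b)) (a_u (arcD D j)) (a_v (arcD D j)). intros t u v.
  destruct b'; [exists x|exists y]; split; auto; vring.
Qed.

Lemma sod_turn D a a' b c cw : is_SOD D -> (a < length D)%nat -> (a' < length D)%nat ->
  (b < length D)%nat -> turnD D a b c cw -> hits D a' b -> turnD D a' b c cw.
Proof.
  intros [H HS] La La' Lb Ht (b2 & Hb2).
  destruct (turnD_lanes _ _ _ _ _ Ht) as (b1 & b' & P1 & P2 & P3).
  apply (lanes_turnD D a' b c cw b2 b'); auto.
  destruct (turn_det_sign D a b1 b b' H La Lb P1) as (c1 & Hc1 & E1).
  destruct (turn_det_sign D a' b2 b b' H La' Lb Hb2) as (c2 & Hc2 & E2).
  assert (Hside : dot (cross (a_u (arcD D b)) (a_v (arcD D b))) (ltail D (a, b1)) *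
                  dot (cross (a_u (arcD D b)) (a_v (arcD D b))) (ltail D (a', b2)) > 0).
  { apply (HS (arcD D b) (arcD D a) (arcD D a') (lend D (a, b1)) _ (lend D (a', b2)) _).
    - apply nth_In; auto.
    - apply nth_In; auto.
    - apply nth_In; auto.
    - apply (lane_ends D (a, b1)).
    - apply (lane_ends D (a', b2)).
    - split; [apply (lane_end_on_sphere D (a, b1) H La)|exact P1].
    - split; [apply (lane_end_on_sphere D (a', b2) H La')|exact Hb2]. }
  rewrite E1 in P3. rewrite E2.
  set (x := dot (cross (a_u (arcD D b)) (a_v (arcD D b))) (ltail D (a, b1))) in *.
  set (y := dot (cross (a_u (arcD D b)) (a_v (arcD D b))) (ltail D (a', b2))) in *.
  assert (Hxy : (0 < x /\ 0 < y) \/ (x < 0 /\ y < 0)).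
  { assert (x <> 0) by (intros E; rewrite E in Hside; lra).
    destruct (Rlt_le_dec 0 x); [left; split; nra|right; split; nra]. }
  clearbody x y.
  assert (Hp : forall z, 0 < z -> 0 < c1 * z /\ 0 < c2 * z) by (intros; split; nra).
  destruct Hxy as [[Hx Hy]|[Hx Hy]].
  - pose proof (Hp _ Hx). pose proof (Hp _ Hy). destruct cw, b'; lra.
  - pose proof (Hp (- x) ltac:(lra)). pose proof (Hp (- y) ltac:(lra)). destruct cw, b'; lra.
Qed.

(* In an SOD the arc reached from [x] by turning in a given direction does not depend on the arc
   hitting [x]. *)
Definition turn_next (D : list arc) (cw : bool) (x y : nat) : Prop :=
  (x < length D)%nat /\ (y < length D)%nat /\ exists a, (a < length D)%nat /\ turnD D a x y cw.

Lemma turn_next_hits D cw x y : turn_next D cw x y -> hits D x y.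
Proof. intros (_ & _ & a & _ & H). apply (turnD_hits _ _ _ _ _ H). Qed.

Lemma turn_next_functional D cw x y y' : is_SOD D -> turn_next D cw x y -> turn_next D cw x y' -> y = y'.
Proof.
  intros H (Lx & Ly & a & La & Ht) (_ & Ly' & a' & La' & Ht').
  apply (sod_turn D a' a x y' cw H La' La Lx) in Ht'; [|apply (turnD_hits _ _ _ _ _ Ht)].
  destruct (Nat.eq_dec y y') as [|Hn]; auto. exfalso. destruct H as [H _].
  assert (Hn' : turnD D a x y' (negb cw)).
  { apply (turnD_other D a x y y' cw); auto. apply (turnD_hits _ _ _ _ _ Ht'). }
  destruct cw; eapply (turnD_exclusive D a x y'); eauto.
Qed.

Lemma turn_next_opposite D cw x y : is_SOD D -> turn_next D cw x y -> ~ turn_next D (negb cw) x y.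
Proof.
  intros H (Lx & Ly & a & La & Ht) (_ & Ly' & a' & La' & Ht').
  apply (sod_turn D a' a x y _ H La' La Lx) in Ht'; [|apply (turnD_hits _ _ _ _ _ Ht)].
  destruct H as [H _]. destruct cw; eapply (turnD_exclusive D a x y); eauto.
Qed.

Lemma turn_next_antisym D cw cw' x y : is_SOD D -> turn_next D cw x y -> ~ turn_next D cw' y x.
Proof.
  intros [H _] H1 H2. pose proof H1 as (Lx & Ly & _).
  apply (hits_antisym D x y H Lx Ly); [apply (turn_next_hits _ _ _ _ H1)|apply (turn_next_hits _ _ _ _ H2)].
Qed.

(** By one-sidedness each turn may be taken after the preceding arc of the 3-cycle of hits, and
    there all three turns agree. *)
Lemma turn_next_no_mixed_triangle D cw x y z : is_SOD D ->
  turn_next D (negb cw) x y -> turn_next D cw y z -> ~ turn_next D cw z x.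
Proof.
  intros H Hxy Hyz Hzx.
  pose proof Hxy as (Lx & Ly & a & La & Ta). pose proof Hyz as (_ & Lz & b & Lb & Tb).
  apply (sod_turn D a z x y _ H La Lz Lx) in Ta; [|apply (turn_next_hits _ _ _ _ Hzx)].
  apply (sod_turn D b x y z _ H Lb Lx Ly) in Tb; [|apply (turn_next_hits _ _ _ _ Hxy)].
  destruct H as [H _].
  apply (turnD_triangle D x y z cw H Lx Ly Lz) in Tb; [|apply (turn_next_hits _ _ _ _ Hzx)].
  apply (turnD_triangle D y z x cw H Ly Lz Lx) in Tb; [|apply (turn_next_hits _ _ _ _ Hxy)].
  destruct cw; eapply (turnD_exclusive D z x y); eauto.
Qed.

Definition cyc (s : list nat) (k : nat) : nat := nth (k mod length s) s 0%nat.

Lemma cyc_small s k : (k < length s)%nat -> cyc s k = nth k s 0%nat.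
Proof. intros H. unfold cyc. rewrite Nat.mod_small; auto. Qed.

Lemma cyc_in s k : s <> [] -> In (cyc s k) s.
Proof. intros H. apply nth_In, Nat.mod_upper_bound. destruct s; [contradiction|discriminate]. Qed.

Lemma swirl_turn_next D cw s k : is_swirl D cw s -> turn_next D cw (cyc s k) (cyc s (k + 1)).
Proof.
  intros (Hne & Hnd & Hl & Ht).
  assert (Hn : length s <> 0%nat) by (destruct s; [contradiction|discriminate]).
  set (j := ((k + (length s - 1)) mod length s)%nat).
  assert (Hj : (j < length s)%nat) by (apply Nat.mod_upper_bound; auto).
  assert (E1 : ((j + 1) mod length s = k mod length s)%nat).
  { unfold j. rewrite Nat.Div0.add_mod_idemp_l.
    replace (k + (length s - 1) + 1)%nat with (k + 1 * length s)%nat by lia. apply Nat.Div0.mod_add. }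
  assert (E2 : ((j + 2) mod length s = (k + 1) mod length s)%nat).
  { unfold j. rewrite Nat.Div0.add_mod_idemp_l.
    replace (k + (length s - 1) + 2)%nat with (k + 1 + 1 * length s)%nat by lia. apply Nat.Div0.mod_add. }
  split; [apply Hl, cyc_in, Hne|]. split; [apply Hl, cyc_in, Hne|].
  exists (nth j s 0%nat). split; [apply Hl, nth_In, Hj|].
  specialize (Ht j Hj). unfold turnD, cyc. rewrite <- E1, <- E2. exact Ht.
Qed.

Lemma cyc_inj s i j : NoDup s -> s <> [] -> cyc s i = cyc s j -> (i mod length s = j mod length s)%nat.
Proof.
  intros Hnd Hne E. assert (length s <> 0%nat) by (destruct s; [contradiction|discriminate]).
  apply (proj1 (NoDup_nth s 0%nat) Hnd); auto using Nat.mod_upper_bound.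
Qed.

Lemma rotation_same_cycle (s t : list nat) d : length t = length s -> (d < length s)%nat ->
  (forall k, (k < length s)%nat -> nth k t 0%nat = cyc s (k + d)) -> same_cycle s t.
Proof.
  intros HL Hd Hk. exists (firstn d s), (skipn d s). split; [symmetry; apply firstn_skipn|].
  apply (nth_ext _ _ 0%nat 0%nat).
  - rewrite length_app, length_skipn, length_firstn. lia.
  - intros k Hk'. rewrite Hk by lia. unfold cyc.
    destruct (lt_dec k (length s - d)) as [Hs|Hs].
    + rewrite app_nth1 by (rewrite length_skipn; lia). rewrite nth_skipn, Nat.mod_small by lia.
      f_equal. lia.
    + rewrite app_nth2 by (rewrite length_skipn; lia). rewrite length_skipn.
      rewrite nth_firstn. replace (k - (length s - d) <? d)%nat with true by (symmetry; apply Nat.ltb_lt; lia).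
      f_equal. replace (k + d)%nat with (k - (length s - d) + 1 * length s)%nat by lia.
      rewrite Nat.Div0.mod_add, Nat.mod_small; lia.
Qed.

(** The length of [t] is a period of the common sequence, while [s] has no repetitions within its
    own length. *)
Lemma cyc_length_le s t i j : NoDup s -> s <> [] -> t <> [] ->
  (forall k, cyc s (i + k) = cyc t (j + k)) -> (i < length s)%nat -> (length s <= length t)%nat.
Proof.
  intros Hnd Hs Ht E Hi. pose proof (E (length t)) as E1. pose proof (E 0%nat) as E0. rewrite !Nat.add_0_r in E0.
  assert (E2 : cyc t (j + length t) = cyc t j).
  { unfold cyc. replace (j + length t)%nat with (j + 1 * length t)%nat by lia. rewrite Nat.Div0.mod_add. auto. }
  rewrite E2, <- E0 in E1. apply cyc_inj in E1; auto.
  assert (length t <> 0%nat) by (destruct t; [contradiction|discriminate]).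
  destruct (le_lt_dec (length s) (length t)) as [|Hlt]; auto. exfalso.
  rewrite (Nat.mod_small i) in E1 by auto.
  destruct (lt_dec (i + length t) (length s)).
  - rewrite Nat.mod_small in E1; lia.
  - replace (i + length t)%nat with (i + length t - length s + 1 * length s)%nat in E1 by lia.
    rewrite Nat.Div0.mod_add, Nat.mod_small in E1; lia.
Qed.

(** [turn_next] is functional, so two swirls of equal direction agree from a common arc onwards. *)
Lemma sod_swirls_disjoint D cw s t x : is_SOD D -> is_swirl D cw s -> is_swirl D cw t ->
  In x s -> In x t -> same_cycle s t.
Proof.
  intros H Hs Ht Hxs Hxt.
  destruct (In_nth _ _ 0%nat Hxs) as (i & Hi & Ei). destruct (In_nth _ _ 0%nat Hxt) as (j & Hj & Ej).
  pose proof Hs as (Hnes & Hnds & _). pose proof Ht as (Hnet & Hndt & _).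
  assert (E : forall k, cyc s (i + k) = cyc t (j + k)).
  { induction k as [|k IH].
    - rewrite !Nat.add_0_r, !cyc_small by auto. congruence.
    - pose proof (swirl_turn_next D cw s (i + k) Hs) as N1. pose proof (swirl_turn_next D cw t (j + k) Ht) as N2.
      rewrite IH in N1. replace (i + S k)%nat with (i + k + 1)%nat by lia.
      replace (j + S k)%nat with (j + k + 1)%nat by lia.
      apply (turn_next_functional D cw _ _ _ H N1 N2). }
  pose proof (cyc_length_le s t i j Hnds Hnes Hnet E Hi).
  pose proof (cyc_length_le t s j i Hndt Hnet Hnes (fun k => eq_sym (E k)) Hj).
  assert (HL : length t = length s) by lia.
  apply (rotation_same_cycle s t ((i + (length s - j)) mod length s)); auto.
  { apply Nat.mod_upper_bound. lia. }
  intros k Hk. rewrite <- (cyc_small t) by lia.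
  pose proof (E (k + (length s - j))%nat) as Ek.
  assert (Q : cyc t (j + (k + (length s - j))) = cyc t k).
  { unfold cyc. rewrite HL. replace (j + (k + (length s - j)))%nat with (k + 1 * length s)%nat by lia.
    rewrite Nat.Div0.mod_add. auto. }
  rewrite Q in Ek. rewrite <- Ek. unfold cyc. rewrite Nat.Div0.add_mod_idemp_r. f_equal. f_equal. lia.
Qed.

Lemma swirl_length D cw s : is_SD D -> is_swirl D cw s -> (3 <= length s)%nat.
Proof.
  intros H Hs. pose proof Hs as (Hne & Hnd & Hl & _).
  pose proof (swirl_turn_next D cw s 0 Hs) as N0. pose proof (swirl_turn_next D cw s 1 Hs) as N1.
  destruct s as [|x [|y [|z s]]]; simpl; try lia; try contradiction; exfalso.
  - apply turn_next_hits in N0. apply (hits_irrefl D x H); [apply Hl; simpl; auto|apply N0].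
  - apply turn_next_hits in N0, N1. apply (hits_antisym D x y H); auto; apply Hl; simpl; auto.
Qed.

(** Consecutive arcs of the swirl are linked by a turn of the wrong direction or by a hit the wrong
    way round. In a 4-swirl two opposite arcs could also occur, but the link from [x] to [y] would
    then close a mixed triangle with the half of the swirl leading back from [y] to [x]. *)
Lemma sod_share D cw s x y : is_SOD D -> is_swirl D cw s ->
  (length s = 3 \/ length s = 4)%nat -> turn_next D (negb cw) x y -> In x s -> ~ In y s.
Proof.
  intros H Hs HL Hxy Hx Hy.
  destruct (In_nth _ _ 0%nat Hx) as (i & Hi & Ei). destruct (In_nth _ _ 0%nat Hy) as (j & Hj & Ej).
  assert (Np : forall k, turn_next D cw (cyc s k) (cyc s (k + 1))) by (intros; apply swirl_turn_next; auto).
  rewrite <- (cyc_small s) in Ei, Ej by auto.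
  assert (Hper : forall k, cyc s (k + length s) = cyc s k).
  { intros k. unfold cyc. replace (k + length s)%nat with (k + 1 * length s)%nat by lia. rewrite Nat.Div0.mod_add. auto. }
  assert (C1 : forall k, x = cyc s k -> y <> cyc s (k + 1)).
  { intros k E1 E2. apply (turn_next_opposite D cw x y H); auto. rewrite E1, E2. auto. }
  assert (C2 : forall k, x = cyc s (k + 1) -> y <> cyc s k).
  { intros k E1 E2. apply (turn_next_antisym D (negb cw) cw x y H); auto. rewrite E1, E2. auto. }
  assert (C0 : x <> y).
  { intros <-. apply (turn_next_antisym D (negb cw) (negb cw) x x H); auto. }
  assert (C3 : forall k, length s = 4%nat -> x = cyc s k -> y <> cyc s (k + 2)).
  { intros k E E1 E2. apply (turn_next_no_mixed_triangle D cw x y (cyc s (k + 3)) H Hxy).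
    - rewrite E2. replace (k + 3)%nat with (k + 2 + 1)%nat by lia. auto.
    - rewrite E1. rewrite <- (Hper k), E. replace (k + 4)%nat with (k + 3 + 1)%nat by lia. auto. }
  assert (Hc : (j = i \/ j = i + 1 \/ i = j + 1 \/ (j = i + 2) \/ (i = j + 2) \/ (j = i + 3) \/ (i = j + 3))%nat) by lia.
  destruct Hc as [->|[->|[->|[->|[->|[->| ->]]]]]].
  - congruence.
  - apply (C1 i); auto.
  - apply (C2 j); auto.
  - destruct HL as [HL|HL].
    + apply (C2 (i + 2)%nat); auto. rewrite <- Ei, <- (Hper i). f_equal. lia.
    + apply (C3 i); auto.
  - destruct HL as [HL|HL].
    + apply (C1 (j + 2)%nat); auto. rewrite <- Ej, <- (Hper j). f_equal. lia.
    + apply (C3 (j + 2)%nat); auto. rewrite <- Ej, <- (Hper j). f_equal. lia.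
  - apply (C2 (i + 3)%nat); auto. rewrite <- Ei, <- (Hper i). f_equal. lia.
  - apply (C1 (j + 3)%nat); auto. rewrite <- Ej, <- (Hper j). f_equal. lia.
Qed.

Lemma swirl3_linked D cw u x y : is_swirl D cw u -> length u = 3%nat -> In x u -> In y u -> x <> y ->
  turn_next D cw x y \/ turn_next D cw y x.
Proof.
  intros Hu HL Hx Hy Hn.
  destruct u as [|a [|b [|c [|]]]]; simpl in HL; try lia.
  pose proof (swirl_turn_next D cw _ 0 Hu) as N0. pose proof (swirl_turn_next D cw _ 1 Hu) as N1.
  pose proof (swirl_turn_next D cw _ 2 Hu) as N2. unfold cyc in *; simpl in N0, N1, N2.
  simpl in Hx, Hy. intuition (subst; auto; congruence).
Qed.

(** Among three elements of [w], at most one is in [s] and at most one in [t]. *)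
Lemma exists_outside (s t w : list nat) : NoDup w -> (3 <= length w)%nat ->
  (forall x y, In x w -> In y w -> x <> y -> ~ (In x s /\ In y s)) ->
  (forall x y, In x w -> In y w -> x <> y -> ~ (In x t /\ In y t)) ->
  exists g, In g w /\ ~ In g s /\ ~ In g t.
Proof.
  intros Hnd HL Hs Ht.
  destruct w as [|a [|b [|c w]]]; simpl in HL; try lia.
  assert (Hab : a <> b /\ a <> c /\ b <> c).
  { inversion_clear Hnd. inversion_clear H0. simpl in *. intuition. }
  destruct Hab as (Hab & Hac & Hbc).
  assert (Ia : In a (a :: b :: c :: w)) by (simpl; auto).
  assert (Ib : In b (a :: b :: c :: w)) by (simpl; auto).
  assert (Ic : In c (a :: b :: c :: w)) by (simpl; auto).
  pose proof (Hs a b Ia Ib Hab). pose proof (Hs a c Ia Ic Hac). pose proof (Hs b c Ib Ic Hbc).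
  pose proof (Ht a b Ia Ib Hab). pose proof (Ht a c Ia Ic Hac). pose proof (Ht b c Ib Ic Hbc).
  destruct (in_dec Nat.eq_dec a s), (in_dec Nat.eq_dec b s), (in_dec Nat.eq_dec c s),
    (in_dec Nat.eq_dec a t), (in_dec Nat.eq_dec b t), (in_dec Nat.eq_dec c t);
  try (exfalso; tauto); first [exists a; tauto|exists b; tauto|exists c; tauto].
Qed.

Lemma disjoint_swirls_length D cw cw' u v : is_swirl D cw u -> is_swirl D cw' v ->
  (forall x, In x u -> ~ In x v) -> (length u + length v <= length D)%nat.
Proof.
  intros (_ & Ndu & Bu & _) (_ & Ndv & Bv & _) Duv.
  assert (HI : incl (u ++ v) (seq 0 (length D))).
  { intros x X. apply in_seq. apply in_app_or in X. destruct X as [X|X]; [apply Bu in X|apply Bv in X]; lia. }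
  pose proof (NoDup_incl_length (NoDup_app Ndu Ndv Duv) HI) as Q. rewrite length_app, length_seq in Q. lia.
Qed.

(** With at most seven arcs, disjointness gives lengths 3 and at most 4 for the swirls of each
    direction. A counterclockwise 3-swirl has an arc [g] outside both clockwise ones, which forces
    these to have length 3. Then the other counterclockwise swirl also has an arc [g'] outside them,
    and [3 + 3 + 2 > 7]. *)
Lemma sod_arc_count D : is_SOD D -> (8 <= length D)%nat.
Proof.
  intros H. destruct (le_lt_dec 8 (length D)) as [|Hlt]; auto. exfalso.
  pose proof H as [HSD _].
  destruct (sd_two_clockwise D HSD) as (s & t & Hs & Ht & Hst).
  assert (Dst : forall x, In x s -> ~ In x t).
  { intros x X1 X2. apply Hst. apply (sod_swirls_disjoint D true s t x); auto. }
  pose proof (swirl_length _ _ _ HSD Hs) as Ls. pose proof (swirl_length _ _ _ HSD Ht) as Lt.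
  pose proof Hs as (_ & Nds & Bs & _). pose proof Ht as (_ & Ndt & Bt & _).
  assert (Count : forall l, NoDup l -> (forall x, In x l -> ~ In x s /\ ~ In x t /\ (x < length D)%nat) ->
    (length l + length s + length t <= 7)%nat).
  { intros l Hnd Hl.
    assert (HN : NoDup (l ++ s ++ t)).
    { repeat apply NoDup_app; auto. intros x X1 X2. destruct (Hl x X1) as (Y1 & Y2 & _).
      apply in_app_or in X2. tauto. }
    assert (HI : incl (l ++ s ++ t) (seq 0 (length D))).
    { intros x X. apply in_seq. apply in_app_or in X. destruct X as [X|X]; [destruct (Hl x X); lia|].
      apply in_app_or in X. destruct X as [X|X]; [apply Bs in X|apply Bt in X]; lia. }
    pose proof (NoDup_incl_length HN HI) as Q. rewrite !length_app, length_seq in Q. lia. }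
  pose proof (Count [] (NoDup_nil _) ltac:(intros x [])) as C0. simpl in C0.
  assert (G : exists u v, is_swirl D false u /\ is_swirl D false v /\ ~ same_cycle u v /\ length u = 3%nat).
  { destruct (sd_two_counterclockwise D HSD) as (u & v & Hu & Hv & Huv).
    assert (Duv : forall x, In x u -> ~ In x v).
    { intros x X1 X2. apply Huv. apply (sod_swirls_disjoint D false u v x); auto. }
    pose proof (swirl_length _ _ _ HSD Hu) as Lu. pose proof (swirl_length _ _ _ HSD Hv) as Lv.
    pose proof (disjoint_swirls_length D _ _ u v Hu Hv Duv).
    destruct (Nat.eq_dec (length u) 3); [exists u, v; auto|].
    exists v, u. repeat split; auto; try apply Hv; try apply Hu; [|lia].
    intros (l1 & l2 & E1 & E2). apply Huv. exists l2, l1. auto. }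
  destruct G as (u & v & Hu & Hv & Huv & Lu).
  assert (Duv : forall x, In x u -> ~ In x v).
  { intros x X1 X2. apply Huv. apply (sod_swirls_disjoint D false u v x); auto. }
  pose proof (swirl_length _ _ _ HSD Hv) as Lv.
  pose proof Hu as (_ & Ndu & Bu & _). pose proof Hv as (_ & Ndv & Bv & _).
  assert (Sh : forall r, is_swirl D true r -> (length r = 3 \/ length r = 4)%nat ->
     forall x y, In x u -> In y u -> x <> y -> ~ (In x r /\ In y r)).
  { intros r Hr Lr x y X1 X2 Hn [Y1 Y2].
    destruct (swirl3_linked D false u x y Hu Lu X1 X2 Hn) as [N|N].
    - apply (sod_share D true r x y H Hr Lr N Y1 Y2).
    - apply (sod_share D true r y x H Hr Lr N Y2 Y1). }
  destruct (exists_outside s t u) as (g & G1 & G2 & G3); auto; try lia.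
  { apply Sh; auto. lia. }
  { apply Sh; auto. lia. }
  pose proof (Count [g]) as C1.
  assert (C1' : (1 + length s + length t <= 7)%nat).
  { apply C1; [repeat constructor; auto|]. intros x [<-|[]]. auto. }
  assert (Lv4 : (length v = 3 \/ length v = 4)%nat).
  { pose proof (disjoint_swirls_length D _ _ u v Hu Hv Duv). lia. }
  assert (Sh' : forall r, is_swirl D true r -> length r = 3%nat ->
     forall x y, In x v -> In y v -> x <> y -> ~ (In x r /\ In y r)).
  { intros r Hr Lr x y X1 X2 Hn [Y1 Y2].
    destruct (swirl3_linked D true r x y Hr Lr Y1 Y2 Hn) as [N|N].
    - apply (sod_share D false v x y H Hv Lv4 N X1 X2).
    - apply (sod_share D false v y x H Hv Lv4 N X2 X1). }
  destruct (exists_outside s t v) as (g' & G1' & G2' & G3'); auto.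
  { apply Sh'; auto. lia. }
  { apply Sh'; auto. lia. }
  assert (C2 : (2 + length s + length t <= 7)%nat).
  { apply (Count [g; g']).
    - repeat constructor; simpl; auto. intros [<-|[]]. apply (Duv g'); auto.
    - intros x [<-|[<-|[]]]; auto. }
  lia.
Qed.

(** * Integer models of diagrams *)

Definition zvec := (Z * Z * Z)%type.
Definition zx (a : zvec) : Z := fst (fst a).
Definition zy (a : zvec) : Z := snd (fst a).
Definition zz (a : zvec) : Z := snd a.
Definition zdot (a b : zvec) : Z := (zx a * zx b + zy a * zy b + zz a * zz b)%Z.
Definition zcross (a b : zvec) : zvec :=
  (zy a * zz b - zz a * zy b, zz a * zx b - zx a * zz b, zx a * zy b - zy a * zx b)%Z.
Definition to_vec3 (a : zvec) : vec3 := V3 (IZR (zx a)) (IZR (zy a)) (IZR (zz a)).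
Definition unit_vec (a : zvec) : vec3 := normalize (to_vec3 a).
Definition znonzero (a : zvec) : bool := (0 <? zdot a a)%Z.

Lemma zdot_spec a b : dot (to_vec3 a) (to_vec3 b) = IZR (zdot a b).
Proof. unfold dot, to_vec3, zdot; simpl. rewrite !plus_IZR, !mult_IZR. auto. Qed.

Lemma zcross_spec a b : cross (to_vec3 a) (to_vec3 b) = to_vec3 (zcross a b).
Proof. unfold cross, to_vec3, zcross; simpl. unfold zx, zy, zz; simpl. rewrite !minus_IZR, !mult_IZR. auto. Qed.

Lemma znonzero_spec a : znonzero a = true -> to_vec3 a <> vzero.
Proof.
  unfold znonzero. intros H E. apply Z.ltb_lt in H. apply IZR_lt in H. rewrite <- zdot_spec, E in H.
  unfold dot, vzero in H; simpl in H. lra.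
Qed.

Lemma unit_vec_scale a : znonzero a = true -> exists c, 0 < c /\ unit_vec a = vscale c (to_vec3 a).
Proof. intros H. exists (/ sqrt (dot (to_vec3 a) (to_vec3 a))). split; auto. apply sqrt_norm_pos, znonzero_spec, H. Qed.

Lemma unit_vec_on_sphere a : znonzero a = true -> on_sphere (unit_vec a).
Proof. intros H. apply normalize_on_sphere, znonzero_spec, H. Qed.

Lemma znonzero_cross_l a b : znonzero (zcross a b) = true -> znonzero a = true /\ znonzero b = true.
Proof.
  unfold znonzero. intros H. apply Z.ltb_lt in H.
  assert (E : (zdot (zcross a b) (zcross a b) = zdot a a * zdot b b - zdot a b * zdot a b)%Z).
  { unfold zdot, zcross, zx, zy, zz; simpl. ring. }
  assert (Ha : (0 <= zdot a a)%Z) by (unfold zdot; nia). assert (Hb : (0 <= zdot b b)%Z) by (unfold zdot; nia).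
  rewrite !Z.ltb_lt. split; nia.
Qed.

Lemma unit_vec_not_multiple a b s : znonzero (zcross a b) = true -> unit_vec a <> vscale s (unit_vec b).
Proof.
  intros H E. destruct (znonzero_cross_l _ _ H) as [Ha Hb].
  destruct (unit_vec_scale _ Ha) as (c & Hc & Ea). destruct (unit_vec_scale _ Hb) as (d & Hd & Eb).
  apply znonzero_spec in H. apply H. rewrite <- zcross_spec.
  assert (Q : vscale c (cross (to_vec3 a) (to_vec3 b)) = vscale (s * d) (cross (to_vec3 b) (to_vec3 b))).
  { replace (vscale c (cross (to_vec3 a) (to_vec3 b))) with (cross (vscale c (to_vec3 a)) (to_vec3 b)) by (veq).
    rewrite <- Ea, E, Eb. veq. }
  assert (Q2 : cross (to_vec3 a) (to_vec3 b) = vscale (/ c) (vscale c (cross (to_vec3 a) (to_vec3 b)))).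
  { destruct (cross (to_vec3 a) (to_vec3 b)); unfold vscale; simpl. f_equal; field; lra. }
  rewrite Q2, Q. generalize (to_vec3 b). intros x. destruct x; vsimp. f_equal; ring.
Qed.

Definition zarc := (zvec * zvec)%type.
Definition unit_arc (p : zarc) : arc := Arc (unit_vec (fst p)) (unit_vec (snd p)).
Definition zdiagram (E : list zarc) : list arc := map unit_arc E.
Definition zarc_at (E : list zarc) (i : nat) : zarc := nth i E ((0, 0, 0), (0, 0, 0))%Z.
Definition zend (E : list zarc) (l : lane) : zvec :=
  if snd l then snd (zarc_at E (fst l)) else fst (zarc_at E (fst l)).
Definition ztail (E : list zarc) (l : lane) : zvec := zend E (fst l, negb (snd l)).
Definition znormal (E : list zarc) (i : nat) : zvec := zcross (fst (zarc_at E i)) (snd (zarc_at E i)).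

Lemma zdiagram_arcD E i : (i < length E)%nat -> arcD (zdiagram E) i = unit_arc (zarc_at E i).
Proof.
  intros H. unfold arcD, zdiagram, zarc_at.
  rewrite (nth_indep _ _ (unit_arc ((0, 0, 0), (0, 0, 0))%Z)) by (rewrite length_map; auto). apply map_nth.
Qed.

Lemma zdiagram_lend E l : (fst l < length E)%nat -> lend (zdiagram E) l = unit_vec (zend E l).
Proof. intros H. unfold lend, zend. rewrite zdiagram_arcD by auto. destruct (snd l); auto. Qed.

Lemma zdiagram_ltail E l : (fst l < length E)%nat -> ltail (zdiagram E) l = unit_vec (ztail E l).
Proof. intros H. apply (zdiagram_lend E (fst l, negb (snd l)) H). Qed.

(* [hit_table] lists, for the two ends of each arc in turn, the arc hit and integers [(k, a, b)] with
   [k * end = a * u + b * v] for that arc [(u, v)]. *)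
Definition hit_entry := (nat * Z * Z * Z)%type.
Definition hit_of (T : list hit_entry) (l : lane) : hit_entry :=
  nth (2 * fst l + (if snd l then 1 else 0)) T (0%nat, 0, 0, 0)%Z.
Definition hit_arc (T : list hit_entry) (l : lane) : nat := fst (fst (fst (hit_of T l))).

Definition zvec_eqb (a b : zvec) : bool := ((zx a =? zx b) && (zy a =? zy b) && (zz a =? zz b))%Z%bool.
Definition zlc (a : Z) (x : zvec) (b : Z) (y : zvec) : zvec :=
  (a * zx x + b * zx y, a * zy x + b * zy y, a * zz x + b * zz y)%Z.
Definition zscale (a : Z) (x : zvec) : zvec := (a * zx x, a * zy x, a * zz x)%Z.

Definition check_hit (E : list zarc) (T : list hit_entry) (l : lane) : bool :=
  let '(j, k, a, b) := hit_of T l in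
  ((j <? length E)%nat && (0 <? k)%Z && (0 <? a)%Z && (0 <? b)%Z &&
   zvec_eqb (zscale k (zend E l)) (zlc a (fst (zarc_at E j)) b (snd (zarc_at E j))))%bool.

(** Points inside an arc have two positive coefficients, so weak separation with one strict
    inequality among the four endpoints keeps the interiors disjoint. *)
Definition separates (m : zvec) (A B : zarc) : bool :=
  ((0 <=? zdot m (fst A)) && (0 <=? zdot m (snd A)) && (zdot m (fst B) <=? 0) && (zdot m (snd B) <=? 0) &&
   ((0 <? zdot m (fst A)) || (0 <? zdot m (snd A)) || (zdot m (fst B) <? 0) || (zdot m (snd B) <? 0)))%Z%bool.

Definition check_separation (E : list zarc) (W : list zvec) : bool :=
  forallb (fun i => forallb (fun j => if (i <? j)%nat then existsb (fun m => separates m (zarc_at E i) (zarc_at E j)) W else true)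
    (seq 0 (length E))) (seq 0 (length E)).

Definition check_SD (E : list zarc) (T : list hit_entry) (W : list zvec) : bool :=
  ((0 <? length E)%nat && forallb (fun i => znonzero (znormal E i)) (seq 0 (length E)) &&
   forallb (check_hit E T) (all_lanes (length E)) && check_separation E W)%bool.

Lemma zvec_eqb_spec a b : zvec_eqb a b = true -> a = b.
Proof.
  destruct a as [[a1 a2] a3], b as [[b1 b2] b3]. unfold zvec_eqb, zx, zy, zz; simpl.
  rewrite !Bool.andb_true_iff, !Z.eqb_eq. intros [[-> ->] ->]. auto.
Qed.

Lemma zlc_spec a x b y : to_vec3 (zlc a x b y) = lc (IZR a) (to_vec3 x) (IZR b) (to_vec3 y).
Proof. unfold to_vec3, zlc, zx, zy, zz, lc, vadd, vscale; simpl. rewrite !plus_IZR, !mult_IZR. auto. Qed.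

Lemma zscale_spec a x : to_vec3 (zscale a x) = vscale (IZR a) (to_vec3 x).
Proof. unfold to_vec3, zscale, zx, zy, zz, vscale; simpl. rewrite !mult_IZR. auto. Qed.

Lemma check_SD_nonzero E T W i : check_SD E T W = true -> (i < length E)%nat ->
  znonzero (znormal E i) = true /\ znonzero (fst (zarc_at E i)) = true /\ znonzero (snd (zarc_at E i)) = true.
Proof.
  unfold check_SD. rewrite !Bool.andb_true_iff. intros [[[_ H] _] _] Hi.
  rewrite forallb_forall in H. specialize (H i ltac:(apply in_seq; lia)).
  split; auto. apply znonzero_cross_l; auto.
Qed.

Lemma check_SD_end_nonzero E T W l : check_SD E T W = true -> (fst l < length E)%nat -> znonzero (zend E l) = true.
Proof. intros H Hl. destruct (check_SD_nonzero _ _ _ _ H Hl) as (_ & H1 & H2). unfold zend. destruct (snd l); auto. Qed.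

Lemma check_SD_hit E T W l : check_SD E T W = true -> (fst l < length E)%nat ->
  (hit_arc T l < length E)%nat /\ arc_cint (zdiagram E) (hit_arc T l) (lend (zdiagram E) l).
Proof.
  intros H Hl. pose proof (check_SD_end_nonzero _ _ _ l H Hl) as He.
  pose proof H as H'. unfold check_SD in H'. rewrite !Bool.andb_true_iff in H'. destruct H' as [[_ Hh] _].
  rewrite forallb_forall in Hh. specialize (Hh l (in_all_lanes _ _ Hl)).
  unfold check_hit in Hh. unfold hit_arc. destruct (hit_of T l) as [[[j k] a] b]. simpl.
  rewrite !Bool.andb_true_iff in Hh. destruct Hh as [[[[Hj Hk] Ha] Hb] Hv].
  apply Nat.ltb_lt in Hj. apply Z.ltb_lt, IZR_lt in Hk. apply Z.ltb_lt, IZR_lt in Ha. apply Z.ltb_lt, IZR_lt in Hb.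
  apply zvec_eqb_spec in Hv. split; auto.
  rewrite zdiagram_lend by auto. unfold arc_cint. rewrite zdiagram_arcD by auto. simpl.
  destruct (check_SD_nonzero _ _ _ _ H Hj) as (_ & H1 & H2).
  destruct (unit_vec_scale _ He) as (c & Hc & ->).
  destruct (unit_vec_scale _ H1) as (c1 & Hc1 & ->). destruct (unit_vec_scale _ H2) as (c2 & Hc2 & ->).
  apply cint_scale; auto. apply (cint_unscale _ _ _ (IZR k)); auto.
  rewrite <- zscale_spec, Hv, zlc_spec.
  exists (IZR a / c1), (IZR b / c2).
  split; [apply Rdiv_lt_0_compat; auto|]. split; [apply Rdiv_lt_0_compat; auto|].
  generalize (to_vec3 (fst (zarc_at E j))) (to_vec3 (snd (zarc_at E j))). clear - Hc1 Hc2. intros x y.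
  destruct x, y; vsimp; f_equal; field; lra.
Qed.

Lemma separates_spec m A B x : znonzero (fst A) = true -> znonzero (snd A) = true ->
  znonzero (fst B) = true -> znonzero (snd B) = true -> separates m A B = true ->
  cint (unit_vec (fst A)) (unit_vec (snd A)) x -> ~ cint (unit_vec (fst B)) (unit_vec (snd B)) x.
Proof.
  intros H1 H2 H3 H4 Hs (a & b & Ha & Hb & Ex) (a' & b' & Ha' & Hb' & Ex').
  destruct (unit_vec_scale _ H1) as (c1 & Hc1 & E1). destruct (unit_vec_scale _ H2) as (c2 & Hc2 & E2).
  destruct (unit_vec_scale _ H3) as (c3 & Hc3 & E3). destruct (unit_vec_scale _ H4) as (c4 & Hc4 & E4).
  rewrite E1, E2 in Ex. rewrite E3, E4 in Ex'.
  pose proof (f_equal (dot (to_vec3 m)) Ex) as D1. pose proof (f_equal (dot (to_vec3 m)) Ex') as D2.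
  rewrite dot_lc, !dot_vscale, !zdot_spec in D1. rewrite dot_lc, !dot_vscale, !zdot_spec in D2.
  unfold separates in Hs. rewrite !Bool.andb_true_iff, !Bool.orb_true_iff, !Z.leb_le, !Z.ltb_lt in Hs.
  destruct Hs as [[[[S1 S2] S3] S4] S5].
  apply IZR_le in S1, S2, S3, S4.
  set (p := IZR (zdot m (fst A))) in *. set (q := IZR (zdot m (snd A))) in *.
  set (r := IZR (zdot m (fst B))) in *. set (s := IZR (zdot m (snd B))) in *.
  assert (P1 : 0 <= a * (c1 * p)) by (apply Rmult_le_pos; [lra|apply Rmult_le_pos; lra]).
  assert (P2 : 0 <= b * (c2 * q)) by (apply Rmult_le_pos; [lra|apply Rmult_le_pos; lra]).
  assert (P3 : 0 <= a' * (c3 * - r)) by (apply Rmult_le_pos; [lra|apply Rmult_le_pos; lra]).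
  assert (P4 : 0 <= b' * (c4 * - s)) by (apply Rmult_le_pos; [lra|apply Rmult_le_pos; lra]).
  destruct S5 as [[[S5|S5]|S5]|S5]; apply IZR_lt in S5.
  - assert (0 < a * (c1 * p)) by (repeat apply Rmult_lt_0_compat; auto). lra.
  - assert (0 < b * (c2 * q)) by (repeat apply Rmult_lt_0_compat; auto). lra.
  - assert (0 < a' * (c3 * - r)) by (repeat apply Rmult_lt_0_compat; auto; unfold r; lra). lra.
  - assert (0 < b' * (c4 * - s)) by (repeat apply Rmult_lt_0_compat; auto; unfold s; lra). lra.
Qed.

Lemma check_SD_disjoint E T W i j x : check_SD E T W = true -> (i < length E)%nat -> (j < length E)%nat ->
  i <> j -> arc_cint (zdiagram E) i x -> ~ arc_cint (zdiagram E) j x.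
Proof.
  intros H.
  assert (G : forall i j, (i < j)%nat -> (j < length E)%nat -> arc_cint (zdiagram E) i x -> ~ arc_cint (zdiagram E) j x).
  { clear i j. intros i j Hij Hj. assert (Hi : (i < length E)%nat) by lia.
    destruct (check_SD_nonzero _ _ _ _ H Hi) as (_ & H1 & H2).
    destruct (check_SD_nonzero _ _ _ _ H Hj) as (_ & H3 & H4).
    pose proof H as H'. unfold check_SD in H'. rewrite !Bool.andb_true_iff in H'. destruct H' as [_ Hs].
    unfold check_separation in Hs. rewrite forallb_forall in Hs.
    specialize (Hs i ltac:(apply in_seq; lia)). rewrite forallb_forall in Hs.
    specialize (Hs j ltac:(apply in_seq; lia)). simpl in Hs.
    rewrite (proj2 (Nat.ltb_lt i j) Hij) in Hs. apply existsb_exists in Hs. destruct Hs as (m & _ & Hm).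
    unfold arc_cint. rewrite !zdiagram_arcD by auto. apply (separates_spec m); auto. }
  intros Hi Hj Hn H1 H2. destruct (lt_dec i j).
  - apply (G i j); auto.
  - apply (G j i); auto. lia.
Qed.

Lemma check_SD_correct E T W : check_SD E T W = true -> is_SD (zdiagram E).
Proof.
  intros H. split; [|split; [|split]].
  - unfold check_SD in H. rewrite !Bool.andb_true_iff in H. destruct H as [[[H _] _] _].
    apply Nat.ltb_lt in H. destruct E; simpl in *; [lia|discriminate].
  - intros A HA. apply in_map_iff in HA. destruct HA as (p & <- & Hp).
    destruct (In_nth _ _ ((0, 0, 0), (0, 0, 0))%Z Hp) as (i & Hi & Ep).
    change (zarc_at E i = p) in Ep. subst p.
    destruct (check_SD_nonzero _ _ _ _ H Hi) as (H0 & H1 & H2).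
    assert (Hx := fun c => unit_vec_not_multiple _ _ c H0).
    split; [apply unit_vec_on_sphere; auto|]. split; [apply unit_vec_on_sphere; auto|]. split; simpl.
    + intros Ee. apply (Hx 1). rewrite Ee. unfold vscale. destruct (unit_vec (snd (zarc_at E i))); simpl. f_equal; ring.
    + intros Ee. apply (Hx (-1)). exact Ee.
  - intros i j Hi Hj Hij (x & H1 & H2). unfold zdiagram in Hi, Hj. rewrite length_map in Hi, Hj.
    apply (check_SD_disjoint E T W i j x H Hi Hj Hij).
    + apply H1.
    + apply H2.
  - intros B e w HB He. destruct (In_nth _ _ (Arc vzero vzero) HB) as (i & Hi & Ei).
    unfold zdiagram in Hi. rewrite length_map in Hi.
    fold (arcD (zdiagram E) i) in Ei. rewrite <- Ei in He.
    destruct (ends_lane _ _ _ _ He) as (b & -> & ->).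
    destruct (check_SD_hit _ _ _ (i, b) H Hi) as (Hj & Hc).
    exists (arcD (zdiagram E) (hit_arc T (i, b))). split.
    + apply nth_In. unfold zdiagram. rewrite length_map. auto.
    + split; auto. rewrite zdiagram_lend by auto. apply unit_vec_on_sphere, (check_SD_end_nonzero _ _ _ (i, b) H Hi).
Qed.

Definition check_one_sided (E : list zarc) (T : list hit_entry) : bool :=
  forallb (fun l => forallb (fun l' => if (hit_arc T l =? hit_arc T l')%nat
    then (0 <? zdot (znormal E (hit_arc T l)) (ztail E l) * zdot (znormal E (hit_arc T l)) (ztail E l'))%Z else true)
    (all_lanes (length E))) (all_lanes (length E)).

Lemma zdiagram_length E : length (zdiagram E) = length E.
Proof. apply length_map. Qed.

Lemma check_SD_hit_unique E T W l j : check_SD E T W = true -> (fst l < length E)%nat -> (j < length E)%nat ->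
  arc_cint (zdiagram E) j (lend (zdiagram E) l) -> j = hit_arc T l.
Proof.
  intros H Hl Hj Hc. destruct (check_SD_hit _ _ _ l H Hl) as (H1 & H2).
  destruct (Nat.eq_dec j (hit_arc T l)) as [|Hn]; auto.
  exfalso. apply (check_SD_disjoint E T W j (hit_arc T l) _ H Hj H1 Hn Hc H2).
Qed.

Lemma check_SOD_correct E T W : check_SD E T W = true -> check_one_sided E T = true -> is_SOD (zdiagram E).
Proof.
  intros H HO. split; [apply (check_SD_correct E T W H)|].
  intros A B1 B2 e1 w1 e2 w2 HA HB1 HB2 He1 He2 Hr1 Hr2.
  destruct (In_nth _ _ (Arc vzero vzero) HA) as (j & Hj & Ej).
  destruct (In_nth _ _ (Arc vzero vzero) HB1) as (i1 & Hi1 & E1).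
  destruct (In_nth _ _ (Arc vzero vzero) HB2) as (i2 & Hi2 & E2).
  rewrite zdiagram_length in Hj, Hi1, Hi2.
  change (arcD (zdiagram E) j = A) in Ej. change (arcD (zdiagram E) i1 = B1) in E1.
  change (arcD (zdiagram E) i2 = B2) in E2. subst A B1 B2.
  destruct (ends_lane _ _ _ _ He1) as (b1 & -> & ->). destruct (ends_lane _ _ _ _ He2) as (b2 & -> & ->).
  pose proof (check_SD_hit_unique E T W (i1, b1) j H Hi1 Hj (proj2 Hr1)) as Q1.
  pose proof (check_SD_hit_unique E T W (i2, b2) j H Hi2 Hj (proj2 Hr2)) as Q2.
  unfold check_one_sided in HO. rewrite forallb_forall in HO.
  specialize (HO (i1, b1) (in_all_lanes (length E) (i1, b1) Hi1)). rewrite forallb_forall in HO.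
  specialize (HO (i2, b2) (in_all_lanes (length E) (i2, b2) Hi2)). rewrite <- Q1, <- Q2, Nat.eqb_refl in HO.
  apply Z.ltb_lt, IZR_lt in HO. rewrite mult_IZR in HO.
  assert (Hn1 : znonzero (ztail E (i1, b1)) = true) by apply (check_SD_end_nonzero E T W (i1, negb b1) H Hi1).
  assert (Hn2 : znonzero (ztail E (i2, b2)) = true) by apply (check_SD_end_nonzero E T W (i2, negb b2) H Hi2).
  destruct (check_SD_nonzero _ _ _ _ H Hj) as (_ & Hu & Hv).
  rewrite zdiagram_arcD, !zdiagram_ltail by auto. simpl.
  destruct (unit_vec_scale _ Hn1) as (c1 & Hc1 & ->). destruct (unit_vec_scale _ Hn2) as (c2 & Hc2 & ->).
  destruct (unit_vec_scale _ Hu) as (c3 & Hc3 & ->). destruct (unit_vec_scale _ Hv) as (c4 & Hc4 & ->).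
  assert (Ecr : forall x y z, dot (cross (vscale c3 x) (vscale c4 y)) z = c3 * c4 * dot (cross x y) z) by (intros; vring).
  rewrite !Ecr, !dot_vscale, !zcross_spec, !zdot_spec. fold (znormal E j).
  set (p := IZR (zdot (znormal E j) (ztail E (i1, b1)))) in *.
  set (q := IZR (zdot (znormal E j) (ztail E (i2, b2)))) in *.
  replace (c3 * c4 * (c1 * p) * (c3 * c4 * (c2 * q))) with ((c3 * c4) * (c3 * c4) * (c1 * c2) * (p * q)) by ring.
  apply Rmult_lt_0_compat; [repeat apply Rmult_lt_0_compat; auto|exact HO].
Qed.

(** * Enumerating the swirls of an integer diagram *)

Definition zturn_det (E : list zarc) (l l' : lane) : Z := zdot (zend E l) (zcross (ztail E l) (zend E l')).

Definition zturn (E : list zarc) (T : list hit_entry) (cw : bool) (i j k : nat) : bool :=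
  existsb (fun b => existsb (fun b' => (hit_arc T (i, b) =? j)%nat && (hit_arc T (j, b') =? k)%nat &&
    (if cw then 0 <? zturn_det E (i, b) (j, b') else zturn_det E (i, b) (j, b') <? 0)%Z)%bool [true; false]) [true; false].

Lemma zturn_det_spec E T W i b j b' : check_SD E T W = true -> (i < length E)%nat -> (j < length E)%nat ->
  exists c, 0 < c /\ turn_det (zdiagram E) i b j b' = c * IZR (zturn_det E (i, b) (j, b')).
Proof.
  intros H Hi Hj. unfold turn_det, zturn_det.
  rewrite !zdiagram_lend, zdiagram_ltail by auto.
  destruct (unit_vec_scale _ (check_SD_end_nonzero E T W (i, b) H Hi)) as (c1 & Hc1 & ->).
  destruct (unit_vec_scale _ (check_SD_end_nonzero E T W (i, negb b) H Hi)) as (c2 & Hc2 & E2).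
  destruct (unit_vec_scale _ (check_SD_end_nonzero E T W (j, b') H Hj)) as (c3 & Hc3 & ->).
  fold (ztail E (i, b)) in E2. change (zend E (i, negb b)) with (ztail E (i, b)) in E2. rewrite E2.
  exists (c1 * c2 * c3). split; [repeat apply Rmult_lt_0_compat; auto|].
  rewrite <- zdot_spec, <- zcross_spec.
  vring.
Qed.

Lemma zturn_spec E T W cw i j k : check_SD E T W = true -> (i < length E)%nat -> (j < length E)%nat ->
  (k < length E)%nat -> turnD (zdiagram E) i j k cw <-> zturn E T cw i j k = true.
Proof.
  intros H Hi Hj Hk. unfold zturn. split.
  - intros Ht. destruct (turnD_lanes _ _ _ _ _ Ht) as (b & b' & H1 & H2 & H3).
    apply (check_SD_hit_unique E T W (i, b) j H Hi Hj) in H1.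
    apply (check_SD_hit_unique E T W (j, b') k H Hj Hk) in H2.
    apply existsb_exists. exists b. split; [destruct b; simpl; auto|].
    apply existsb_exists. exists b'. split; [destruct b'; simpl; auto|].
    rewrite !Bool.andb_true_iff, !Nat.eqb_eq. split; [auto|].
    destruct (zturn_det_spec E T W i b j b' H Hi Hj) as (c & Hc & Ec). rewrite Ec in H3.
    destruct cw; apply Z.ltb_lt, lt_IZR; simpl; nra.
  - intros Ht. apply existsb_exists in Ht. destruct Ht as (b & _ & Ht).
    apply existsb_exists in Ht. destruct Ht as (b' & _ & Ht).
    rewrite !Bool.andb_true_iff, !Nat.eqb_eq in Ht. destruct Ht as [[<- <-] Ht].
    destruct (check_SD_hit E T W (i, b) H Hi) as [_ Q1].
    destruct (check_SD_hit E T W (hit_arc T (i, b), b') H Hj) as [_ Q2].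
    apply (lanes_turnD _ _ _ _ cw b b'); rewrite ?zdiagram_length; auto; [apply (check_SD_correct E T W H)|].
    destruct (zturn_det_spec E T W i b (hit_arc T (i, b)) b' H Hi Hj) as (c & Hc & ->).
    destruct cw; apply Z.ltb_lt, IZR_lt in Ht; simpl in Ht; nra.
Qed.

(** The state is a pair of consecutive arcs: in a diagram that is not one-sided, the next arc
    depends on the arc from which the present one is reached. *)
Definition znext (E : list zarc) (T : list hit_entry) (cw : bool) (p : nat * nat) : nat * nat :=
  match find (zturn E T cw (fst p) (snd p)) (seq 0 (length E)) with
  | Some k => (snd p, k) | None => p
  end.

Lemma swirl_turnD D cw s k : is_swirl D cw s -> turnD D (cyc s k) (cyc s (k + 1)) (cyc s (k + 2)) cw.
Proof.
  intros (Hne & _ & _ & Ht).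
  assert (Hn : length s <> 0%nat) by (destruct s; [contradiction|discriminate]).
  specialize (Ht (k mod length s) (Nat.mod_upper_bound _ _ Hn)).
  rewrite !Nat.Div0.add_mod_idemp_l in Ht. exact Ht.
Qed.

Lemma znext_spec E T W cw i j k : check_SD E T W = true -> (i < length E)%nat -> (j < length E)%nat ->
  (k < length E)%nat -> turnD (zdiagram E) i j k cw -> znext E T cw (i, j) = (j, k).
Proof.
  intros H Hi Hj Hk Ht. unfold znext. simpl.
  pose proof (check_SD_correct E T W H) as HS. pose proof (zdiagram_length E) as HL.
  destruct (find (zturn E T cw i j) (seq 0 (length E))) as [k'|] eqn:Ef.
  - apply find_some in Ef. destruct Ef as [Ek Ez]. apply in_seq in Ek.
    apply (zturn_spec E T W cw i j k' H) in Ez; auto; [|lia].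
    destruct (Nat.eq_dec k k') as [->|Hn]; auto. exfalso.
    assert (Hn' : turnD (zdiagram E) i j k' (negb cw)).
    { apply (turnD_other _ i j k k' cw); rewrite ?HL; auto; try lia. apply (turnD_hits _ _ _ _ _ Ez). }
    destruct cw; eapply (turnD_exclusive (zdiagram E) i j k'); rewrite ?HL; eauto; lia.
  - exfalso. apply (zturn_spec E T W cw i j k H) in Ht; auto.
    pose proof (find_none _ _ Ef k ltac:(apply in_seq; lia)). simpl in H0. congruence.
Qed.

Definition triple_edges (s : nat * nat * nat) : list (nat * nat) :=
  let '(a, b, c) := s in [(a, b); (b, c); (c, a)].
Definition triple_list (s : nat * nat * nat) : list nat := let '(a, b, c) := s in [a; b; c].

Definition edge_eqb (p q : nat * nat) : bool := ((fst p =? fst q) && (snd p =? snd q))%nat%bool.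
Definition edge_mem (p : nat * nat) (l : list (nat * nat)) : bool := existsb (edge_eqb p) l.

Definition check_triple (E : list zarc) (T : list hit_entry) (cw : bool) (s : nat * nat * nat) : bool :=
  let '(a, b, c) := s in
  ((a <? length E) && (b <? length E) && (c <? length E) && negb (a =? b) && negb (b =? c) && negb (a =? c) &&
   zturn E T cw a b c && zturn E T cw b c a && zturn E T cw c a b)%nat%bool.

(* Every pair of consecutive hits is driven into one of the two given swirls by at most 16 turns. *)
Definition check_swirls (E : list zarc) (T : list hit_entry) (cw : bool) (s t : nat * nat * nat) : bool :=
  (check_triple E T cw s && check_triple E T cw t &&
   (* Swirls of equal direction may share arcs, so one arc of [s] missing from [t] is what tells the
      two cycles apart. *)
   negb (existsb (Nat.eqb (hd 0%nat (triple_list s))) (triple_list t)) &&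
   forallb (fun i => forallb (fun j => negb (existsb (zturn E T cw i j) (seq 0 (length E))) ||
     edge_mem (Nat.iter 16 (znext E T cw) (i, j)) (triple_edges s ++ triple_edges t))%bool
     (seq 0 (length E))) (seq 0 (length E)))%bool.

Lemma edge_mem_spec p l : edge_mem p l = true -> In p l.
Proof.
  unfold edge_mem. intros H. apply existsb_exists in H. destruct H as ([a b] & Hin & He).
  unfold edge_eqb in He. apply Bool.andb_true_iff in He. rewrite !Nat.eqb_eq in He. destruct p; simpl in He.
  destruct He as [-> ->]. auto.
Qed.

Lemma check_triple_swirl E T W cw s : check_SD E T W = true -> check_triple E T cw s = true ->
  is_swirl (zdiagram E) cw (triple_list s).
Proof.
  intros H Hc. destruct s as [[a b] c]. unfold check_triple in Hc.
  rewrite !Bool.andb_true_iff, !Nat.ltb_lt, !Bool.negb_true_iff, !Nat.eqb_neq in Hc.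
  destruct Hc as [[[[[[[[Ha Hb] Hcc] N1] N2] N3] Z1] Z2] Z3]. simpl.
  apply (zturn_spec E T W cw) in Z1, Z2, Z3; auto.
  split; [discriminate|]. split; [repeat constructor; simpl; intuition|].
  rewrite zdiagram_length. split; [simpl; intuition lia|].
  intros k Hk. simpl in Hk. destruct k as [|[|[|]]]; simpl; auto. lia.
Qed.

Lemma check_triple_znext E T W cw a b c : check_SD E T W = true -> check_triple E T cw (a, b, c) = true ->
  znext E T cw (a, b) = (b, c) /\ znext E T cw (b, c) = (c, a) /\ znext E T cw (c, a) = (a, b).
Proof.
  intros H Hc. unfold check_triple in Hc.
  rewrite !Bool.andb_true_iff, !Nat.ltb_lt, !Bool.negb_true_iff, !Nat.eqb_neq in Hc.
  destruct Hc as [[[[[[[[Ha Hb] Hcc] N1] N2] N3] Z1] Z2] Z3].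
  apply (zturn_spec E T W cw) in Z1, Z2, Z3; auto.
  split; [|split]; apply (znext_spec E T W); auto.
Qed.

Lemma check_triple_edges E T W cw s p : check_SD E T W = true -> check_triple E T cw s = true ->
  In p (triple_edges s) ->
  In (znext E T cw p) (triple_edges s) /\ Nat.iter 3 (znext E T cw) p = p /\
  same_cycle [fst p; snd p; snd (znext E T cw p)] (triple_list s).
Proof.
  intros H Hc Hp. destruct s as [[a b] c].
  destruct (check_triple_znext E T W cw a b c H Hc) as (E1 & E2 & E3). simpl in Hp.
  destruct Hp as [<-|[<-|[<-|[]]]].
  - simpl. rewrite E1, E2, E3. repeat split; auto. exists [], [a; b; c]. auto.
  - simpl. rewrite E2, E3, E1. repeat split; auto. exists [b; c], [a]. auto.
  - simpl. rewrite E3, E1, E2. repeat split; auto. exists [c], [a; b]. auto.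
Qed.

(** The successive pairs of a swirl recur under [znext], so if they are eventually driven into one
    of the given 3-cycles they belong to it from the start; period 3 without repetition gives length
    3. The 16 turns are as many as the arc ends of the eight-arc example, enough for any walk to
    have entered its cycle. *)
Lemma check_swirls_correct E T W cw s t : check_SD E T W = true -> check_swirls E T cw s t = true ->
  exactly_two_swirls (zdiagram E) cw.
Proof.
  intros H Hc. unfold check_swirls in Hc. rewrite !Bool.andb_true_iff in Hc.
  destruct Hc as [[[Hs Ht] Hd] Hall]. rewrite Bool.negb_true_iff in Hd.
  pose proof (check_SD_correct E T W H) as HS.
  exists (triple_list s), (triple_list t).
  split; [apply (check_triple_swirl E T W); auto|]. split; [apply (check_triple_swirl E T W); auto|].
  split.
  - intros (l1 & l2 & E1 & E2).
    assert (Hin : In (hd 0%nat (triple_list s)) (triple_list t)).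
    { rewrite E2. apply in_or_app.
      assert (Hin : In (hd 0%nat (triple_list s)) (triple_list s)) by (destruct s as [[a b] c]; simpl; auto).
      rewrite E1 in Hin at 2. apply in_app_or in Hin. tauto. }
    assert (Q : existsb (Nat.eqb (hd 0%nat (triple_list s))) (triple_list t) = true).
    { apply existsb_exists. eexists. split; [apply Hin|apply Nat.eqb_refl]. }
    congruence.
  - intros u Hu. pose proof Hu as (Hne & Hnd & Hl & _). rewrite zdiagram_length in Hl.
    assert (Hb : forall k, (cyc u k < length E)%nat) by (intros; apply Hl, cyc_in, Hne).
    set (st := fun k => (cyc u k, cyc u (k + 1))).
    assert (Hst : forall k, znext E T cw (st k) = st (k + 1)%nat).
    { intros k. unfold st. rewrite <- Nat.add_assoc. apply (znext_spec E T W); auto. apply swirl_turnD; auto. }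
    assert (Hit : forall m k, Nat.iter m (znext E T cw) (st k) = st (k + m)%nat).
    { induction m as [|m IH]; intros k; simpl; [rewrite Nat.add_0_r; auto|].
      rewrite IH, Hst. f_equal. lia. }
    assert (Hper : forall m k, st (k + m * length u)%nat = st k).
    { intros m k. unfold st, cyc.
      replace (k + m * length u + 1)%nat with (k + 1 + m * length u)%nat by lia. rewrite !Nat.Div0.mod_add. auto. }
    assert (Hcyc : forall p, In p (triple_edges s ++ triple_edges t) ->
      In (znext E T cw p) (triple_edges s ++ triple_edges t) /\ Nat.iter 3 (znext E T cw) p = p /\
      (same_cycle [fst p; snd p; snd (znext E T cw p)] (triple_list s) \/
       same_cycle [fst p; snd p; snd (znext E T cw p)] (triple_list t))).
    { intros p Hp. apply in_app_or in Hp. destruct Hp as [Hp|Hp];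
      [destruct (check_triple_edges E T W cw s p H Hs Hp) as (Q1 & Q2 & Q3)
      |destruct (check_triple_edges E T W cw t p H Ht Hp) as (Q1 & Q2 & Q3)];
      (split; [apply in_or_app; auto|]); auto. }
    assert (Hlen : (3 <= length u)%nat) by (apply (swirl_length _ _ _ HS Hu)).
    assert (H16 : In (st 16%nat) (triple_edges s ++ triple_edges t)).
    { rewrite forallb_forall in Hall. specialize (Hall (cyc u 0) ltac:(apply in_seq; specialize (Hb 0%nat); lia)).
      rewrite forallb_forall in Hall. specialize (Hall (cyc u 1) ltac:(apply in_seq; specialize (Hb 1%nat); lia)).
      apply Bool.orb_true_iff in Hall. destruct Hall as [Hall|Hall].
      - exfalso. apply Bool.negb_true_iff in Hall.
        assert (Q : existsb (zturn E T cw (cyc u 0) (cyc u 1)) (seq 0 (length E)) = true).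
        { apply existsb_exists. exists (cyc u 2). split; [apply in_seq; specialize (Hb 2%nat); lia|].
          apply (zturn_spec E T W); auto. apply (swirl_turnD _ _ u 0 Hu). }
        congruence.
      - apply edge_mem_spec in Hall. change (cyc u 0, cyc u 1) with (st 0%nat) in Hall. rewrite Hit in Hall. auto. }
    assert (Hge : forall m, In (st (16 + m)%nat) (triple_edges s ++ triple_edges t)).
    { induction m as [|m IH]; auto. replace (16 + S m)%nat with (16 + m + 1)%nat by lia.
      rewrite <- Hst. apply Hcyc; auto. }
    assert (H0 : In (st 0%nat) (triple_edges s ++ triple_edges t)).
    { rewrite <- (Hper 16%nat 0%nat). replace (0 + 16 * length u)%nat with (16 + (16 * length u - 16))%nat by lia. auto. }
    destruct (Hcyc _ H0) as (_ & Hi3 & Hsame). rewrite Hit in Hi3. simpl in Hi3.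
    assert (E3 : cyc u 3 = cyc u 0) by (injection Hi3; auto).
    apply cyc_inj in E3; auto. rewrite Nat.Div0.mod_0_l in E3.
    assert (Hl3 : length u = 3%nat).
    { destruct (Nat.eq_dec (length u) 3) as [|Hn]; auto. rewrite Nat.mod_small in E3; lia. }
    rewrite Hst in Hsame. unfold st in Hsame. simpl in Hsame.
    destruct u as [|a [|b [|c [|]]]]; simpl in Hl3; try lia. exact Hsame.
Qed.

(** * Orientation and alignment of integer models *)

Definition zpole (P : list zvec) (i : nat) : zvec := nth i P (0, 0, 0)%Z.

Lemma zpoles_nth P i : (i < length P)%nat -> nth i (map unit_vec P) vzero = unit_vec (zpole P i).
Proof.
  intros H. unfold zpole. rewrite (nth_indep _ _ (unit_vec (0, 0, 0)%Z)) by (rewrite length_map; auto). apply map_nth.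
Qed.

(* Coordinates of opposite signs in the basis of the endpoints keep both the pole and its antipode
   off the arc. *)
Definition check_arc_oriented (A : zarc) (p : zvec) : bool :=
  let n := zcross (fst A) (snd A) in
  (znonzero n && znonzero p && (zdot n p =? 0)%Z &&
   (zdot (zcross n (fst A)) p * zdot (zcross (snd A) n) p <? 0)%Z)%bool.

Lemma check_arc_oriented_correct A p : check_arc_oriented A p = true -> arc_oriented_to (unit_arc A) (unit_vec p).
Proof.
  unfold check_arc_oriented. rewrite !Bool.andb_true_iff, Z.eqb_eq, Z.ltb_lt.
  intros [[[Hn Hp] H0] Hs].
  destruct (znonzero_cross_l _ _ Hn) as [Hu Hv].
  destruct (unit_vec_scale _ Hp) as (c & Hc & Ec).
  destruct (unit_vec_scale _ Hu) as (c1 & Hc1 & E1). destruct (unit_vec_scale _ Hv) as (c2 & Hc2 & E2).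
  set (u := fst A) in *. set (v := snd A) in *. set (n := zcross u v) in *.
  assert (Hnn : 0 < dot (to_vec3 n) (to_vec3 n)) by (apply dot_self_pos, znonzero_spec, Hn).
  apply IZR_lt in Hs. rewrite mult_IZR, <- !zdot_spec, <- !zcross_spec in Hs.
  assert (G : forall s, s * s = 1 -> ~ in_arc (vscale s (unit_vec p)) (unit_arc A)).
  { intros s Hss (_ & a & b & Ha & Hb & E). simpl in E. fold u v in E. rewrite E1, E2, Ec in E.
    pose proof (f_equal (dot (cross (to_vec3 n) (to_vec3 u))) E) as D1.
    pose proof (f_equal (dot (cross (to_vec3 v) (to_vec3 n))) E) as D2.
    assert (Q1 : forall x y, dot (cross (to_vec3 n) (to_vec3 u)) (vadd (vscale x (vscale c1 (to_vec3 u))) (vscale y (vscale c2 (to_vec3 v))))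
      = y * c2 * dot (to_vec3 n) (to_vec3 n)).
    { intros x y. unfold n. rewrite <- zcross_spec. vring. }
    assert (Q2 : forall x y, dot (cross (to_vec3 v) (to_vec3 n)) (vadd (vscale x (vscale c1 (to_vec3 u))) (vscale y (vscale c2 (to_vec3 v))))
      = x * c1 * dot (to_vec3 n) (to_vec3 n)).
    { intros x y. unfold n. rewrite <- zcross_spec. vring. }
    rewrite Q1, !dot_vscale in D1. rewrite Q2, !dot_vscale in D2.
    set (X := dot (cross (to_vec3 n) (to_vec3 u)) (to_vec3 p)) in *.
    set (Y := dot (cross (to_vec3 v) (to_vec3 n)) (to_vec3 p)) in *.
    set (N := dot (to_vec3 n) (to_vec3 n)) in *.
    assert (P1 : (s * (c * X)) * (s * (c * Y)) = c * c * (X * Y)).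
    { replace ((s * (c * X)) * (s * (c * Y))) with (s * s * (c * c * (X * Y))) by ring. rewrite Hss. ring. }
    assert (P2 : 0 <= (b * c2 * N) * (a * c1 * N)) by (repeat apply Rmult_le_pos; lra).
    rewrite <- D1, <- D2, P1 in P2.
    assert (0 < c * c) by nra. nra. }
  split; [|split].
  - exists (to_vec3 n). split; [apply znonzero_spec; auto|]. split.
    + split; [apply unit_vec_on_sphere; auto|]. rewrite Ec, dot_vscale, zdot_spec, H0. simpl. ring.
    + intros x (Hx & a & b & _ & _ & E). split; auto. simpl in E. fold u v in E. rewrite E, E1, E2.
      unfold n. rewrite <- zcross_spec. vring.
  - intros Hin. apply (G 1); [ring|]. replace (vscale 1 (unit_vec p)) with (unit_vec p); auto.
    destruct (unit_vec p); unfold vscale; simpl. f_equal; ring.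
  - intros Hin. apply (G (-1)); [ring|]. exact Hin.
Qed.

(** With [w] the cross product of [x] and [y], the vector triple product writes [|w|^2 n] as a
    multiple of [w] plus terms with factors [n.x] and [n.y]. *)
Lemma normal_to_two n x y : dot n x = 0 -> dot n y = 0 -> cross x y <> vzero ->
  exists c, n = vscale c (cross x y).
Proof.
  intros Hx Hy Hw. apply dot_self_pos in Hw. set (w := cross x y) in *.
  exists (dot n w / dot w w).
  assert (Id : vscale (dot w w) n = vadd (vscale (dot n w) w) (cross w (lc (dot n y) x (- dot n x) y))).
  { unfold w. generalize x y n. clear. intros. veq. }
  rewrite Hx, Hy in Id.
  assert (E : n = vscale (/ dot w w) (vscale (dot w w) n)).
  { assert (dot w w <> 0) by lra. destruct n; unfold vscale; simpl. f_equal; field; auto. }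
  rewrite E at 1. rewrite Id. unfold Rdiv. generalize (dot n w) (dot w w). clear. clearbody w. intros. veq.
Qed.

Lemma same_gc_scaled c c' w : c <> 0 -> c' <> 0 -> same_gc (vscale c w) (vscale c' w).
Proof.
  intros Hc Hc' x. unfold great_circle.
  assert (E : forall a, dot (vscale a w) x = a * dot w x) by (intros; vring).
  rewrite !E. split; intros [H1 H2]; (split; [auto|]); apply Rmult_integral in H2;
  destruct H2 as [|H2]; try contradiction; rewrite H2; ring.
Qed.

(* [js] are the indices of three poles spanning with pole [i] the circles through it. *)
Definition check_circles (P : list zvec) (i : nat) (js : nat * nat * nat) : bool :=
  let '(a, b, c) := js in
  let nm := fun j => zcross (zpole P i) (zpole P j) in
  let on := fun j k => (zdot (nm j) (zpole P k) =? 0)%Z in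
  (forallb (fun j => (j <? length P)%nat && negb (j =? i)%nat) [a; b; c] &&
   negb (on a b) && negb (on a c) && negb (on b a) && negb (on b c) && negb (on c a) && negb (on c b) &&
   forallb (fun j => (j =? i)%nat || on a j || on b j || on c j) (seq 0 (length P)))%bool.

Definition check_poles (P : list zvec) : bool :=
  forallb (fun i => forallb (fun j => ((i =? j)%nat || znonzero (zcross (zpole P i) (zpole P j)))%bool)
    (seq 0 (length P))) (seq 0 (length P)).

Lemma check_poles_cross P i j : check_poles P = true -> (i < length P)%nat -> (j < length P)%nat -> i <> j ->
  znonzero (zcross (zpole P i) (zpole P j)) = true.
Proof.
  unfold check_poles. rewrite forallb_forall. intros H Hi Hj Hn. specialize (H i ltac:(apply in_seq; lia)).
  rewrite forallb_forall in H. specialize (H j ltac:(apply in_seq; lia)).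
  apply Bool.orb_true_iff in H. destruct H as [H|H]; auto. apply Nat.eqb_eq in H. contradiction.
Qed.

Lemma check_poles_nonzero P i : check_poles P = true -> (1 < length P)%nat -> (i < length P)%nat ->
  znonzero (zpole P i) = true.
Proof.
  intros H H1 Hi.
  assert (exists j, (j < length P)%nat /\ i <> j) as (j & Hj & Hn).
  { destruct (Nat.eq_dec i 0); [exists 1%nat|exists 0%nat]; lia. }
  apply (znonzero_cross_l _ _ (check_poles_cross P i j H Hi Hj Hn)).
Qed.

Lemma check_poles_ok P : check_poles P = true -> (1 < length P)%nat -> poles_ok (map unit_vec P).
Proof.
  intros H H1. split.
  - intros p Hp. apply in_map_iff in Hp. destruct Hp as (z & <- & Hz).
    destruct (In_nth _ _ (0, 0, 0)%Z Hz) as (i & Hi & Ei). change (zpole P i = z) in Ei. subst z.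
    apply unit_vec_on_sphere, check_poles_nonzero; auto.
  - rewrite length_map. intros i j Hi Hj Hn. rewrite !zpoles_nth by auto.
    pose proof (check_poles_cross P i j H Hi Hj Hn) as Hx. split.
    + intros E. apply (unit_vec_not_multiple _ _ 1 Hx). rewrite E.
      destruct (unit_vec (zpole P j)); unfold vscale; simpl. f_equal; ring.
    + apply (unit_vec_not_multiple _ _ (-1) Hx).
Qed.

(** Two listed circles differ because the pole defining one is off the other. Any circle through
    poles [i] and [j] is the listed one that contains [j], since both normals are multiples of the
    cross product of these poles. *)
Lemma check_circles_correct P i js : check_poles P = true -> (1 < length P)%nat -> (i < length P)%nat ->
  check_circles P i js = true -> circles_count (map unit_vec P) i 3.
Proof.
  intros H H1 Hi Hc. destruct js as [[a b] c]. unfold check_circles in Hc.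
  rewrite !Bool.andb_true_iff, !Bool.negb_true_iff, !Z.eqb_neq in Hc.
  destruct Hc as [[[[[[[Hj N1] N2] N3] N4] N5] N6] Hall].
  rewrite forallb_forall in Hj, Hall.
  assert (Hj' : forall j, In j [a; b; c] -> (j < length P)%nat /\ j <> i).
  { intros j Hin. specialize (Hj j Hin). rewrite Bool.andb_true_iff, Nat.ltb_lt, Bool.negb_true_iff, Nat.eqb_neq in Hj. auto. }
  set (nm := fun j => cross (unit_vec (zpole P i)) (unit_vec (zpole P j))).
  assert (Hsc : forall j, (j < length P)%nat -> exists d, 0 < d /\ unit_vec (zpole P j) = vscale d (to_vec3 (zpole P j))).
  { intros j Hjl. apply unit_vec_scale, check_poles_nonzero; auto. }
  assert (Hdot : forall j k, (j < length P)%nat -> (k < length P)%nat -> exists d, 0 < d /\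
    dot (nm j) (unit_vec (zpole P k)) = d * IZR (zdot (zcross (zpole P i) (zpole P j)) (zpole P k))).
  { intros j k Hjl Hk. destruct (Hsc i Hi) as (d1 & Hd1 & E1). destruct (Hsc j Hjl) as (d2 & Hd2 & E2).
    destruct (Hsc k Hk) as (d3 & Hd3 & E3). unfold nm. rewrite E1, E2, E3.
    exists (d1 * d2 * d3). split; [repeat apply Rmult_lt_0_compat; auto|].
    rewrite <- zdot_spec, <- zcross_spec.
    vring. }
  assert (Hnz : forall j, (j < length P)%nat -> j <> i -> nm j <> vzero).
  { intros j Hjl Hn E. pose proof (check_poles_cross P i j H Hi Hjl ltac:(auto)) as Hx.
    apply znonzero_spec in Hx. apply Hx. rewrite <- zcross_spec.
    destruct (Hsc i Hi) as (d1 & Hd1 & E1). destruct (Hsc j Hjl) as (d2 & Hd2 & E2).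
    unfold nm in E. rewrite E1, E2 in E.
    assert (Q : cross (to_vec3 (zpole P i)) (to_vec3 (zpole P j)) = vscale (/ (d1 * d2))
      (cross (vscale d1 (to_vec3 (zpole P i))) (vscale d2 (to_vec3 (zpole P j))))).
    { generalize (to_vec3 (zpole P i)) (to_vec3 (zpole P j)). intros x y. destruct x, y; vsimp. f_equal; field; lra. }
    rewrite Q, E. unfold vscale, vzero; simpl. f_equal; ring. }
  assert (Hon : forall k, (k < length P)%nat -> on_sphere (unit_vec (zpole P k))).
  { intros k Hk. apply unit_vec_on_sphere, check_poles_nonzero; auto. }
  assert (Hi0 : forall j, dot (nm j) (unit_vec (zpole P i)) = 0) by (intros; apply dot_cross_l).
  assert (Hj0 : forall j, dot (nm j) (unit_vec (zpole P j)) = 0) by (intros; apply dot_cross_r).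
  exists [nm a; nm b; nm c]. split; [auto|]. split; [|split].
  - assert (G : forall j, In j [a; b; c] -> gc_through_pole_and_other (map unit_vec P) i (nm j)).
    { intros j Hin. destruct (Hj' j Hin) as [Hjl Hn]. split; [apply Hnz; auto|].
      rewrite zpoles_nth by auto. split; [split; auto|].
      exists j. rewrite length_map, zpoles_nth by auto. repeat split; auto. }
    intros n [<-|[<-|[<-|[]]]]; apply G; simpl; auto.
  - assert (D : forall j k, In j [a; b; c] -> In k [a; b; c] ->
      zdot (zcross (zpole P i) (zpole P j)) (zpole P k) <> 0%Z -> ~ same_gc (nm j) (nm k)).
    { intros j k Hjin Hkin Hz Hs. destruct (Hj' j Hjin) as [Hjl _]. destruct (Hj' k Hkin) as [Hkl _].
      destruct (proj2 (Hs (unit_vec (zpole P k)))) as [_ Q]; [split; auto|].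
      destruct (Hdot j k Hjl Hkl) as (d & Hd & E). rewrite E in Q.
      apply Rmult_integral in Q. destruct Q as [Q|Q]; [lra|]. apply eq_IZR in Q. auto. }
    intros x y Hx Hy Hn.
    destruct x as [|[|[|]]]; destruct y as [|[|[|]]]; simpl; try lia; apply D; simpl; auto.
  - intros n (Hn & [_ Hni] & j & Hjl & Hji & [_ Hnj]). rewrite length_map in Hjl.
    rewrite zpoles_nth in Hni, Hnj by auto.
    assert (Hk : exists k, In k [a; b; c] /\ zdot (zcross (zpole P i) (zpole P k)) (zpole P j) = 0%Z).
    { specialize (Hall j ltac:(apply in_seq; lia)). rewrite !Bool.orb_true_iff, Nat.eqb_eq, !Z.eqb_eq in Hall.
      destruct Hall as [[[Hall|Hall]|Hall]|Hall]; [contradiction|exists a|exists b|exists c]; simpl; auto. }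
    destruct Hk as (k & Hkin & Hk0). destruct (Hj' k Hkin) as [Hkl Hkn].
    exists (nm k). split; [simpl in *; intuition (subst; auto)|].
    destruct (Hdot k j Hkl Hjl) as (d & _ & E). rewrite Hk0 in E.
    assert (Hw : nm j <> vzero) by (apply Hnz; auto).
    destruct (normal_to_two n _ _ Hni Hnj Hw) as (c1 & E1).
    destruct (normal_to_two (nm k) _ _ (Hi0 k) ltac:(rewrite E; simpl; ring) Hw) as (c2 & E2).
    pose proof (Hnz k Hkl Hkn) as Hnk. rewrite E1 in Hn |- *. rewrite E2 in Hnk |- *.
    assert (Z0 : forall w, vscale 0 w = vzero) by (intros []; unfold vscale, vzero; simpl; f_equal; ring).
    apply same_gc_scaled; intros ->; [apply Hn|apply Hnk]; apply Z0.
Qed.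

Definition check_oriented (E : list zarc) (P : list zvec) (f : list nat) (J : list (nat * nat * nat)) : bool :=
  ((1 <? length P)%nat && check_poles P &&
   forallb (fun i => (nth i f 0 <? length P)%nat && check_arc_oriented (zarc_at E i) (zpole P (nth i f 0%nat))) (seq 0 (length E)) &&
   forallb (fun i => check_circles P i (nth i J (0, 0, 0)%nat)) (seq 0 (length P)))%bool.

Lemma check_oriented_correct E P f J : check_oriented E P f J = true -> length P = 6%nat ->
  oriented_with_alignment (zdiagram E) 6 [3; 3; 3; 3; 3; 3]%nat.
Proof.
  unfold check_oriented. rewrite !Bool.andb_true_iff, Nat.ltb_lt. intros [[[H1 HP] HA] HC] HL.
  rewrite forallb_forall in HA, HC.
  exists (map unit_vec P), (fun i => nth i f 0%nat). rewrite length_map.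
  split; [auto|]. split; [apply check_poles_ok; auto|]. split.
  - rewrite zdiagram_length. intros i Hi. specialize (HA i ltac:(apply in_seq; lia)).
    rewrite Bool.andb_true_iff, Nat.ltb_lt in HA. destruct HA as [Hf Ho].
    split; [lia|]. rewrite zdiagram_arcD, zpoles_nth by auto. apply check_arc_oriented_correct; auto.
  - split; [rewrite length_map; auto|]. split; [repeat constructor|].
    exists [3; 3; 3; 3; 3; 3]%nat. split; [apply Permutation_refl|].
    rewrite length_map. intros i Hi. replace (nth i [3; 3; 3; 3; 3; 3] 0)%nat with 3%nat.
    + apply (check_circles_correct P i (nth i J (0, 0, 0)%nat)); auto. apply HC, in_seq. lia.
    + rewrite HL in Hi. destruct i as [|[|[|[|[|[|]]]]]]; auto. lia.
Qed.

(* The vertices of a complete quadrilateral: the four planes x +- y +- z = 0 contain three poles each. *)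
Definition quadrilateral_poles : list zvec :=
  [(1, 1, 0); (1, -1, 0); (1, 0, 1); (1, 0, -1); (0, 1, 1); (0, 1, -1)]%Z.
(** Every pole is on two sides and one diagonal of the quadrilateral, which are its three circles.
    Each triple names two poles on the sides and the opposite pole, for instance pole 1 for pole
    0. *)
Definition quadrilateral_circles : list (nat * nat * nat) :=
  [(1, 2, 3); (0, 2, 3); (0, 1, 3); (0, 1, 2); (0, 1, 5); (0, 1, 4)]%nat.

(** The great circles have small integer normals, each orthogonal to the pole of its arc: (3,-3,1)
    and the pole (1,1,0) for the first. An endpoint is, up to scale, the cross product of the
    normals of its arc and of the arc it hits. The eight arcs below are given in the same way. *)
Definition six_arcs : list zarc :=
  [((-7, -8, -3), (8, 7, -3)); ((-3, 4, 3), (8, -5, 9)); ((-3, -2, -2), (7, -4, 9));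
   ((3, 2, -3), (-1, 1, 1)); ((-2, -3, -3), (-2, 3, 3)); ((2, -2, 3), (2, 3, -2))]%Z.
Definition six_hits : list hit_entry :=
  [(2%nat, 13, 42, 5); (5%nat, 1, 1, 3); (3%nat, 5, 1, 18); (5%nat, 5, 17, 3); (4%nat, 12, 13, 5); (1%nat, 17, 3, 16);
   (0%nat, 3, 1, 2); (4%nat, 12, 1, 5); (0%nat, 3, 2, 1); (1%nat, 17, 14, 1); (2%nat, 13, 3, 5); (3%nat, 1, 1, 1)]%Z.
(** Besides a few coordinate planes, the separating planes are those of the arcs themselves, with
    both signs where required; the same holds for eight arcs. *)
Definition six_separators : list zvec :=
  [(0,0,-1);(2,-1,-2);(3,-3,1);(1,-2,-2);(3,3,-1);(1,0,1);(-1,2,2);(0,-1,0);(0,-1,1);(-2,1,2);(0,1,-1);(-1,0,-1);(-1,0,0)]%Z.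

Definition eight_arcs : list zarc :=
  [((-29,-30,-5),(6,5,-5)); ((-10,11,3),(10,-9,3)); ((10,-55,54),(-45,-5,-41)); ((15,5,-14),(-7,10,9));
   ((-25,-34,-54),(-20,45,29)); ((5,-40,37),(15,11,-20)); ((5,-15,12),(-55,50,6)); ((29,25,-24),(-34,-35,-6))]%Z.
Definition eight_hits : list hit_entry :=
  [(2%nat,505,241,379);(3%nat,37,19,9);(4%nat,361,46,123);(5%nat,131,49,71);(6%nat,23,101,5);(4%nat,361,425,281);
   (5%nat,131,18,125);(1%nat,20,37,23);(7%nat,165,281,361);(3%nat,37,23,155);(2%nat,101,73,5);(0%nat,35,9,131);
   (5%nat,131,56,25);(4%nat,361,295,624);(3%nat,37,93,46);(2%nat,505,281,444)]%Z.
Definition eight_separators : list zvec :=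
  [(0,0,-1);(5,-4,-5);(-5,1,-5);(5,-5,1);(-5,5,-1);(3,3,-1);(-3,-3,1);(-4,-5,5);(3,5,5);(0,0,1);(0,-1,0);(-5,4,5);
   (-6,-6,-5);(5,-1,5);(6,6,5);(-1,0,0);(4,5,-5);(-6,6,-1);(-3,-5,-5);(6,-6,1)]%Z.

Theorem mainTheorem7 :
  (forall D : list arc, is_SD D ->
     at_least_two_swirls D true /\ at_least_two_swirls D false /\ (6 <= length D)%nat) /\
  (forall D : list arc, is_SOD D -> (8 <= length D)%nat) /\
  (exists D : list arc, is_SD D /\ oriented_with_alignment D 6 [3;3;3;3;3;3]%nat /\
     exactly_two_swirls D true /\ exactly_two_swirls D false /\ length D = 6%nat) /\
  (exists D : list arc, is_SOD D /\ oriented_with_alignment D 6 [3;3;3;3;3;3]%nat /\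
     exactly_two_swirls D true /\ exactly_two_swirls D false /\ length D = 8%nat).
Proof.
  split; [|split; [|split]].
  - intros D H. auto using sd_two_clockwise, sd_two_counterclockwise, sd_arc_count.
  - exact sod_arc_count.
  - assert (H : check_SD six_arcs six_hits six_separators = true) by (vm_compute; reflexivity).
    exists (zdiagram six_arcs). split; [exact (check_SD_correct _ _ _ H)|]. split; [|split; [|split]].
    + apply (check_oriented_correct _ quadrilateral_poles [0; 1; 2; 3; 4; 5]%nat quadrilateral_circles); vm_compute; reflexivity.
    (* Both clockwise swirls contain arc 5, which arcs 0 and 1 reach from opposite sides. *)
    + apply (check_swirls_correct _ _ _ true (0, 5, 3)%nat (1, 5, 2)%nat H). vm_compute; reflexivity.
    + apply (check_swirls_correct _ _ _ false (1, 3, 4)%nat (0, 2, 4)%nat H). vm_compute; reflexivity.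
    + reflexivity.
  - assert (H : check_SD eight_arcs eight_hits eight_separators = true) by (vm_compute; reflexivity).
    exists (zdiagram eight_arcs). split; [|split; [|split; [|split]]].
    + apply (check_SOD_correct _ _ _ H). vm_compute; reflexivity.
    + apply (check_oriented_correct _ quadrilateral_poles [0; 1; 2; 3; 4; 5; 1; 0]%nat quadrilateral_circles); vm_compute; reflexivity.
    + apply (check_swirls_correct _ _ _ true (2, 6, 5)%nat (1, 4, 3)%nat H). vm_compute; reflexivity.
    + apply (check_swirls_correct _ _ _ false (0, 3, 5)%nat (2, 4, 7)%nat H). vm_compute; reflexivity.
    + reflexivity.
Qed.
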